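(* There are $k\in\mathbb{N}$ and a function $f\in O(\log n)$ such that for every $n\in\mathbb{N}$ and every chordal claw-free graph $G$ of order $n$ there is a $\mathsf{C}^k$-sentence $\Phi^G$ over the vocabulary $\{E\}$ of quantifier depth at most $f(n)$ that describes $G$ up to isomorphism, i.e., for every graph $H$: $H\models\Phi^G$ iff $H\cong G$.
   Context: Graphs are $\{E\}$-structures with $E$ binary; undirected graphs have symmetric irreflexive $E$. An undirected graph is chordal if every cycle of length at least $4$ has a chord, and claw-free if it has no induced subgraph isomorphic to $K_{1,3}$. The order of a graph is its number of vertices. $\mathsf{C}$ is first-order logic extended by counting quantifiers $\exists^{\ge m}x\,\psi$ for all $m\in\mathbb{N}$; $\mathsf{C}^k$ is its fragment using only the variables $x_1,\dots,x_k$ (reusable); quantifier depth is the maximal nesting depth of quantifiers. *)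

(* Defs.v *)
From mathcomp Require Import all_boot.

Set Implicit Arguments.
Unset Strict Implicit.
Unset Printing Implicit Defensive.

(* An {E}-structure: possibly directed, with loops, infinite or empty. *)
Record graph := Graph { vertex :> Type; edge : vertex -> vertex -> Prop }.

Definition isomorphic (G H : graph) : Prop :=
  exists2 g : G -> H, bijective g & forall x y, edge x y <-> edge (g x) (g y).

Definition has_order (G : graph) (n : nat) : Prop :=
  exists g : 'I_n -> G, bijective g.

Definition undirected (G : graph) : Prop :=
  (forall x y : G, edge x y -> edge y x) /\ (forall x : G, ~ edge x x).

Definition induced (G : graph) (A : G -> Prop) : graph :=
  @Graph {x : G | A x} (fun x y => edge (proj1_sig x) (proj1_sig y)).

Definition complete_bipartite (m n : nat) : graph :=
  @Graph ('I_m + 'I_n)%type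
    (fun x y => match x, y with
                | inl _, inr _ | inr _, inl _ => True
                | _, _ => False
                end).

Definition claw_free (G : graph) : Prop :=
  forall A : G -> Prop, ~ isomorphic (induced A) (complete_bipartite 1 3).

(* [ordS i] is the cyclic successor of [i], so the last vertex of a cycle is
   joined to the first one. *)
Definition is_cycle (G : graph) (m : nat) (c : 'I_m -> G) : Prop :=
  injective c /\ forall i, edge (c i) (c (ordS i)).

Definition has_chord (G : graph) (m : nat) (c : 'I_m -> G) : Prop :=
  exists i j : 'I_m, [/\ i != j, j != ordS i, i != ordS j & edge (c i) (c j)].

Definition chordal (G : graph) : Prop :=
  forall (m : nat) (c : 'I_m -> G), 4 <= m -> is_cycle c -> has_chord c.

(* Formulas of C over the vocabulary {E}; the variable x_(i+1) is represented by
   the number i. *)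
Inductive formula : Type :=
  | FEq of nat & nat
  | FEdge of nat & nat
  | FNot of formula
  | FAnd of formula & formula
  | FOr of formula & formula
  | FEx of nat & formula
  | FAll of nat & formula
  | FExGe of nat & nat & formula. (* FExGe m i psi: at least m values of x_(i+1) *)

Fixpoint in_C (k : nat) (phi : formula) : bool :=
  match phi with
  | FEq i j | FEdge i j => (i < k) && (j < k)
  | FNot psi => in_C k psi
  | FAnd psi chi | FOr psi chi => in_C k psi && in_C k chi
  | FEx i psi | FAll i psi | FExGe _ i psi => (i < k) && in_C k psi
  end.

Fixpoint qdepth (phi : formula) : nat :=
  match phi with
  | FEq _ _ | FEdge _ _ => 0
  | FNot psi => qdepth psi
  | FAnd psi chi | FOr psi chi => maxn (qdepth psi) (qdepth chi)
  | FEx _ psi | FAll _ psi | FExGe _ _ psi => (qdepth psi).+1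
  end.

Fixpoint free_vars (phi : formula) : seq nat :=
  match phi with
  | FEq i j | FEdge i j => [:: i; j]
  | FNot psi => free_vars psi
  | FAnd psi chi | FOr psi chi => free_vars psi ++ free_vars chi
  | FEx i psi | FAll i psi | FExGe _ i psi => [seq j <- free_vars psi | j != i]
  end.

Definition sentence (phi : formula) : Prop := free_vars phi = [::].

(* Assignments are partial so that sentences can be evaluated, from the empty
   assignment, in the empty graph too.  An atom with an unassigned variable is
   false, which never happens when a sentence is evaluated. *)
Definition assignment (G : graph) := nat -> option G.

Definition update (G : graph) (s : assignment G) (i : nat) (v : G) :
    assignment G :=
  fun j => if j == i then Some v else s j.

Fixpoint sat (G : graph) (s : assignment G) (phi : formula) : Prop :=
  match phi with
  | FEq i j => exists u v : G, [/\ s i = Some u, s j = Some v & u = v]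
  | FEdge i j => exists u v : G, [/\ s i = Some u, s j = Some v & edge u v]
  | FNot psi => ~ sat s psi
  | FAnd psi chi => sat s psi /\ sat s chi
  | FOr psi chi => sat s psi \/ sat s chi
  | FEx i psi => exists v : G, sat (update s i v) psi
  | FAll i psi => forall v : G, sat (update s i v) psi
  | FExGe m i psi =>
      exists2 g : 'I_m -> G, injective g & forall a, sat (update s i (g a)) psi
  end.

Definition models (G : graph) (phi : formula) : Prop :=
  sat (fun _ => None : option G) phi.

(* Main.v *)
Require Import Defs.
From mathcomp Require Import all_boot all_order all_algebra.
From mathcomp Require Import zify.
From mathcomp Require Import boolp filter reals topology normedtype landau exp.
From mathcomp Require Import Rstruct Rstruct_topology.

Set Implicit Arguments.
Unset Strict Implicit.
Unset Printing Implicit Defensive.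

(* By the bijective pebble game it suffices that a chordal claw-free graph is
   isomorphic to every graph that agrees with it on the formulas of logarithmic
   depth.  Each component has a simplicial vertex; pebble it and call it the root
   [r].  With [depth] the distance from [r], claw-freeness makes the children of
   a vertex a clique, so that a component [K] of the vertices of depth more than
   [i] hangs from a clique of vertices of depth [i], its rim.  Bushes (a
   component together with its rim) form a tree.  Chordality makes the edges
   between a bush and the rest of the graph, and those between the parts hanging
   from a bush, depend only on vertex degrees that counting formulas define from a
   bounded number of pebbles ([bush_edge], [part_edge]).  Partial isomorphisms of
   the parts that preserve these degrees can therefore be glued, and a region
   bounded by at most two rims can be cut, in two steps of constantly many rounds,
   into parts of half its size. *)

(** * Walks and distances *)

(** Two costs must fit into logarithmic depth. The tree of bushes can be almost as high as the graph
    is large, so the recursion has to cut at balanced places instead of following the levels; the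
    cut is chosen so that a region never has more than one upper and one lower boundary, and
    boundedly many pebbles suffice. Depths and bushes are themselves defined by reachability, which
    takes [l] rounds on [2 ^ l] vertices and [2 * l] when nested once. These rounds are held in
    reserve for the end of the game, so they are added to the rounds spent on cuts and do not
    multiply them; with six rounds per halving this gives the factor 8 of [log_depth]. The second
    graph is not known to be chordal or claw-free. Both properties are restated as [edge_filled] and
    [clawless], which few pebbles and reachability can test, and [sim_rooted] carries them over. Nor
    is it known which part corresponds to which: [glue_parts] obtains a matching of parts from a
    mere bijection of vertices. *)

Section Walks.
Variables (T : finType) (e : rel T).

Fixpoint walk (m : nat) (x y : T) : bool :=
  if m is m'.+1 then (x == y) || [exists z, e x z && walk m' z y] else x == y.

Lemma walk_refl m x : walk m x x.
Proof. by case: m => [|m] /=; rewrite eqxx. Qed.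

Lemma walkS m x y : walk m x y -> walk m.+1 x y.
Proof.
elim: m x => [|m IH] x /=; first by move=> ->.
case/orP=> [->//|/existsP [z /andP [exz /IH h]]].
by apply/orP; right; apply/existsP; exists z; rewrite exz.
Qed.

Lemma walk_leq a b x y : a <= b -> walk a x y -> walk b x y.
Proof.
move/subnK <-; elim: (b - a) => [|d IH] // /IH.
exact: walkS.
Qed.

Lemma walk_add a b x y :
  walk (a + b) x y = [exists z, walk a x z && walk b z y].
Proof.
apply/idP/existsP => [|[z /andP []]].
- elim: a x => [|a IH] x /=; first by move=> h; exists x; rewrite eqxx.
  case/orP=> [/eqP <-|/existsP [z /andP [exz /IH [w /andP [h1 h2]]]]].
    by exists x; rewrite eqxx walk_refl.
  exists w; rewrite h2 andbT; apply/orP; right.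
  by apply/existsP; exists z; rewrite exz.
- elim: a x => [|a IH] x; first by move=> /eqP <-.
  case/orP=> [/eqP -> h|/existsP [w /andP [exw h1]] h2].
    by apply: (@walk_leq b _ _ _ _ h); lia.
  by rewrite addSn; apply/orP; right; apply/existsP; exists w; rewrite exw; apply: IH.
Qed.

Lemma walk_connect m x y : walk m x y -> connect e x y.
Proof.
elim: m x => [|m IH] x /=; first by move/eqP->; apply: connect0.
case/orP=> [/eqP ->|/existsP [z /andP [exz /IH]]]; first exact: connect0.
exact/connect_trans/connect1.
Qed.

Lemma connect_walk x y : connect e x y -> walk #|T|.-1 x y.
Proof.
case/connectP=> p0 p0e ->; case/shortenP: p0e => p pe pu _.
have sz : size p <= #|T|.-1.
  have := max_card (mem (x :: p)); rewrite (card_uniqP pu) /=; lia.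
apply: (walk_leq sz); move: pe {pu sz}; elim: p x => [|z p IH] x //=.
case/andP=> exz /IH h; apply/orP; right; apply/existsP; exists z.
by rewrite exz.
Qed.

(** An unreachable vertex gets the value [#|T|], which exceeds every genuine distance;
    [dist_connect] rests on this. *)
Definition dist (x y : T) : nat := find (fun m => walk m x y) (iota 0 #|T|).

Lemma dist_max x y : dist x y <= #|T|.
Proof. by rewrite -[X in _ <= X](size_iota 0) find_size. Qed.

Lemma dist_le m x y : walk m x y -> dist x y <= m.
Proof.
move=> h; case: (leqP #|T| m) => [|lt_m]; first exact/leq_trans/dist_max.
rewrite leqNgt; apply/negP => lt_md.
by have := before_find 0 lt_md; rewrite nth_iota // add0n h.
Qed.

Lemma dist_walk x y : dist x y < #|T| -> walk (dist x y) x y.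
Proof.
move=> lt_d; have h : has (fun m => walk m x y) (iota 0 #|T|).
  by rewrite has_find size_iota.
by have := nth_find 0 h; rewrite nth_iota.
Qed.

Lemma dist_connect x y : (dist x y < #|T|) = connect e x y.
Proof.
apply/idP/idP => [/dist_walk/walk_connect //|/connect_walk/dist_le].
by have := fintype0 x; case: #|T| => // /(_ erefl).
Qed.

Lemma distxx x : dist x x = 0.
Proof. by apply/eqP; rewrite -leqn0; apply: dist_le => /=. Qed.

Lemma dist_eq0 x y : dist x y = 0 -> x = y.
Proof.
move=> h; have /dist_walk : dist x y < #|T|.
  by rewrite h; apply/card_gt0P; exists x.
by rewrite h => /eqP.
Qed.

Lemma dist_step x y z : e y z -> dist x z <= (dist x y).+1.
Proof.
move=> eyz; case: (ltnP (dist x y) #|T|) => [/dist_walk h|h]; last first.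
  by apply: leq_trans (dist_max _ _) _; apply: leqW.
apply: dist_le; rewrite -addn1 walk_add; apply/existsP; exists y.
rewrite h /=; apply/orP; right; apply/existsP; exists z.
by rewrite eyz eqxx.
Qed.

Lemma dist_pred x y : 0 < dist x y < #|T| ->
  exists2 z, e z y & dist x y = (dist x z).+1.
Proof.
case/andP=> d0 dT; have := dist_walk dT.
case def_d : (dist x y) d0 => [//|d] _; rewrite -addn1 walk_add.
case/existsP=> z /andP [wz /= /orP [/eqP zy|/existsP [w /andP [ezw /eqP wy]]]].
  by have := dist_le wz; rewrite zy def_d ltnn.
rewrite -wy; exists z => //; rewrite addn1; congr S; apply/eqP.
rewrite eqn_leq (dist_le wz) andbT.
by have := dist_step x ezw; rewrite wy def_d ltnS.
Qed.

End Walks.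

(** * Reachability inside a vertex set *)

Definition restr (T : finType) (E : rel T) (S : pred T) : rel T :=
  fun a b => [&& E a b, S a & S b].

Definition as_graph (T : finType) (E : rel T) : graph :=
  @Graph T (fun x y => E x y).

(** For an edge [p q] these are the vertices off the edge that form no triangle with it; a vertex
    adjacent to neither end counts as well. *)
Definition private_nbr (T : finType) (E : rel T) (p q : T) : pred T :=
  fun z => [&& z != p, z != q & ~~ (E p z && E q z)].

(* A form of chordality in which no cycle is mentioned and which reachability
   makes definable. *)
Definition edge_filled (T : finType) (E : rel T) : Prop :=
  forall p q x y, E p q -> E p x -> E q y ->
    private_nbr E p q x -> private_nbr E p q y ->
    ~~ connect (restr E (private_nbr E p q)) x y.

Section Connected.
Variables (T : finType) (E : rel T).
Hypotheses (symE : symmetric E).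

Lemma restr_sym S : symmetric (restr E S).
Proof. by move=> a b; rewrite /restr symE; congr andb; rewrite andbC. Qed.

Lemma connect_restr_sym S : connect_sym (restr E S).
Proof. exact/sym_connect_sym/restr_sym. Qed.

Lemma connect_restr_sub (S S' : pred T) : subpred S S' ->
  subrel (connect (restr E S)) (connect (restr E S')).
Proof.
move=> sub; apply: connect_sub => a b /and3P [h1 h2 h3].
by apply: connect1; rewrite /restr h1 !sub.
Qed.

Lemma connect_restr_in (S : pred T) x y : connect (restr E S) x y -> S x -> S y.
Proof.
case/connectP=> p pe ->; elim: p x pe => [|z p IH] x //=.
by case/andP=> /and3P [_ _ Sz] /IH h _; apply: h.
Qed.

End Connected.

(** * Chordal and claw-free graphs without cycles and induced subgraphs *)

(** A forbidden connection closes up with the edge [p q]. Among the private neighbours of [q]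
    reachable from [p] through private vertices, take one nearest to [p]; a geodesic from [p] to it,
    followed by [q], is a chordless cycle. *)
Lemma chordal_edge_filled (T : finType) (E : rel T) :
  symmetric E -> irreflexive E -> chordal (as_graph E) -> edge_filled E.
Proof.
move=> symE irrE chE p q x y Epq Epx Eqy Sx Sy; apply/negP => cxy.
pose S := private_nbr E p q; pose S0 : pred T := fun z => (z == p) || S z.
pose e := restr E S0.
have S0q : ~~ S0 q.
  rewrite /S0 /S /private_nbr eqxx andbF orbF; apply/eqP => qp.
  by rewrite qp irrE in Epq.
have cpy : connect e p y.
  apply: (@connect_trans _ _ x).
    by apply: connect1; rewrite /e /restr Epx /S0 eqxx /S Sx orbT.
  by apply: connect_restr_sub cxy => z Sz; rewrite /S0 [S z]Sz orbT.
have S0c z : connect e p z -> S0 z.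
  by move=> h; apply: (connect_restr_in h); rewrite /S0 eqxx.
pose ok z := [&& E q z, S z & connect e p z].
have oky : ok y by rewrite /ok Eqy cpy /S Sy.
case: (arg_minnP (dist e p) oky) => y0 /and3P [Eqy0 Sy0 cpy0] miny0.
set m := dist e p y0 in miny0.
pose pd z := if [pick w | e w z && (dist e p z == (dist e p w).+1)] is Some w
             then w else z.
have mT : m < #|T| by rewrite dist_connect.
have pdP z : 0 < dist e p z < #|T| ->
    e (pd z) z /\ dist e p z = (dist e p (pd z)).+1.
  move=> hz; rewrite /pd; case: pickP => [w /andP [ewz /eqP dw] //|].
  by case: (dist_pred hz) => w ewz dw /(_ w); rewrite ewz dw eqxx.
have dit j : j <= m -> dist e p (iter j pd y0) = m - j.
  elim: j => [|j IH] jm; first by rewrite subn0.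
  have hj := IH (ltnW jm).
  have [|_ /= h2] := @pdP (iter j pd y0); first by clear -hj jm mT; lia.
  by clear -hj h2; lia.
have eit j : j < m -> e (iter j.+1 pd y0) (iter j pd y0).
  move=> jm; have hj := dit j (ltnW jm).
  by have [|h _] := @pdP (iter j pd y0); first by clear -hj jm mT; lia.
(* At distance at most 1, [y0] would be [p] itself or a common neighbour of [p] and [q], neither of
   which is private. So the cycle has at least four vertices. *)
have m2 : 1 < m.
  case: (ltnP 1 m) => // m1; exfalso.
  have [m0|m0] := posnP m.
    by move: Sy0; rewrite /S /private_nbr -(dist_eq0 m0) eqxx.
  have [h1 h2] := @pdP y0 ltac:(by rewrite m0 mT).
  have := h1; have -> : pd y0 = p by apply/esym/(@dist_eq0 _ e); rewrite -/m in h2; clear -h2 m0 m1; lia.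
  by case/and3P=> Epy0 _ _; move: Sy0; rewrite /S /private_nbr Epy0 Eqy0 /= !andbF.
(* Index [i] holds the geodesic's vertex at distance [i] from [p]; the last index, [m.+1], holds
   [q]. *)
pose c (i : 'I_m.+2) : T := if i <= m then iter (m - i) pd y0 else q.
have dc (i : 'I_m.+2) : i <= m -> dist e p (c i) = i.
  by move=> im; rewrite /c im dit ?leq_subr // subKn.
have cq (i : 'I_m.+2) : m < i -> c i = q by rewrite /c ltnNge => /negbTE ->.
have cS0 (i : 'I_m.+2) : i <= m -> S0 (c i).
  by move=> im; apply: S0c; rewrite -dist_connect dc //; apply: leq_ltn_trans mT.
have cne (i : 'I_m.+2) : i <= m -> c i <> q.
  by move=> im cqi; move: (cS0 i im); rewrite cqi (negbTE S0q).
have vS (i : 'I_m.+2) : i <= m -> val (ordS i) = i.+1.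
  by move=> im /=; rewrite modn_small // !ltnS.
have vSm (i : 'I_m.+2) : m < i -> val (ordS i) = 0.
  move=> im /=; have -> : i.+1 = m.+2 by have := ltn_ord i; clear -im; lia.
  by rewrite modnn.
have cyc : @is_cycle (as_graph E) m.+2 c.
  split=> [i j cij|i].
    apply: val_inj => /=; have [im|im] := leqP i m; have [jm|jm] := leqP j m.
    - by rewrite -(dc i im) -(dc j jm) cij.
    - by case: (cne i im); rewrite cij cq.
    - by case: (cne j jm); rewrite -cij cq.
    - by have := ltn_ord i; have := ltn_ord j; clear -im jm; lia.
  have [im|im] := leqP i m; last first.
    rewrite /= (cq i im) /c vSm //= subn0.
    have -> : iter m pd y0 = p by apply/esym/(@dist_eq0 _ e); rewrite dit ?subnn.
    by rewrite symE.
  have [lt_im|ge_im] := ltnP i m.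
    rewrite /= /c vS //= im lt_im.
    have -> : m - i = (m - i.+1).+1 by clear -lt_im; lia.
    by have /and3P [] := eit (m - i.+1) ltac:(clear -lt_im; lia).
  have eim : (i : nat) = m by apply/eqP; rewrite eqn_leq im.
  by rewrite /= /c vS //= eim ltnn leqnn subnn /= symE.
have nochord (i j : 'I_m.+2) : E (c i) (c j) -> i != j -> j != ordS i ->
    i != ordS j -> i <= m -> False.
  move=> Eij nij nji1 nij1 im.
  have nj1 : j != i.+1 :> nat by rewrite -(vS i im).
  have [jm|jm] := leqP j m.
    have ni1 : i != j.+1 :> nat by rewrite -(vS j jm).
    have h1 : dist e p (c j) <= (dist e p (c i)).+1.
      by apply: dist_step; rewrite /e /restr Eij !cS0.
    have h2 : dist e p (c i) <= (dist e p (c j)).+1.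
      by apply: dist_step; rewrite /e /restr symE Eij !cS0.
    rewrite !dc // in h1 h2; have nij' : i != j :> nat by [].
    by clear -h1 h2 nij' ni1 nj1; lia.
  rewrite (cq j jm) symE in Eij.
  have i0 : 0 < i.
    rewrite lt0n; apply/eqP => i0; move: nij1.
    by rewrite -val_eqE vSm //= i0.
  have Sci : S (c i).
    have := cS0 i im; rewrite /S0 => /orP [/eqP ci|//].
    by have := dc i im; rewrite ci distxx => i00; rewrite -i00 in i0.
  (* A chord from [q] makes [c i] a candidate for [y0]; minimality leaves only [i = m], the
     neighbour of [q] on the cycle. *)
  have := miny0 (c i); rewrite /ok Eij Sci -dist_connect dc //.
  have -> : i < #|T| by apply: leq_ltn_trans mT.
  move=> /(_ isT) mi; have eim : i = m :> nat by apply/eqP; rewrite eqn_leq im.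
  by move: nji1; rewrite -val_eqE vS //= eim; have := ltn_ord j; clear -jm; lia.
have [i [j [nij nji1 nij1 Eij]]] := chE m.+2 c ltac:(by rewrite !ltnS) cyc.
have [im|im] := leqP i m; first exact: (nochord i j Eij).
have [jm|jm] := leqP j m.
  by apply: (nochord j i) => //; rewrite 1?symE // eq_sym.
by move: nij; rewrite -val_eqE /=; have := ltn_ord i; have := ltn_ord j; clear -im jm; lia.
Qed.

Definition clawless (T : finType) (E : rel T) : Prop :=
  forall c x y z, E c x -> E c y -> E c z ->
    x != y -> x != z -> y != z -> [|| E x y, E x z | E y z].

Lemma claw_free_clawless (T : finType) (E : rel T) :
  symmetric E -> irreflexive E -> claw_free (as_graph E) -> clawless E.
Proof.
move=> symE irrE cf c x y z Ecx Ecy Ecz nxy nxz nyz.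
case: (boolP [|| _, _ | _]) => //; rewrite !negb_or => /and3P [Nxy Nxz Nyz].
exfalso; pose leaf (i : 'I_3) := nth x [:: x; y; z] i.
pose A (v : as_graph E) := v = c \/ exists i, v = leaf i.
have ncx : c != x by apply/eqP => h; rewrite h irrE in Ecx.
have ncy : c != y by apply/eqP => h; rewrite h irrE in Ecy.
have ncz : c != z by apply/eqP => h; rewrite h irrE in Ecz.
have uni : uniq [:: x; y; z] by rewrite /= !inE negb_or nxy nxz nyz.
have leaf_inj : injective leaf.
  move=> i j /eqP; rewrite /leaf nth_uniq //= => /eqP; exact: val_inj.
have cleaf i : c <> leaf i.
  by case: i => -[|[|[|//]]] ? /eqP; rewrite /leaf /= ?(negbTE ncx) ?(negbTE ncy) ?(negbTE ncz).
have Ecleaf i : E c (leaf i) by case: i => -[|[|[|//]]].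
have Eleaf i j : E (leaf i) (leaf j) = false.
  by case: i j => -[|[|[|//]]] ? [[|[|[|//]]] ?]; rewrite /leaf /= ?irrE //;
     rewrite 1?[E _ x]symE 1?[E _ y]symE ?(negbTE Nxy) ?(negbTE Nxz) ?(negbTE Nyz) // symE
       ?(negbTE Nxy) ?(negbTE Nxz) ?(negbTE Nyz).
pose h (w : 'I_1 + 'I_3) : {v | A v} :=
  match w with
  | inl _ => exist _ c (or_introl erefl)
  | inr i => exist _ (leaf i) (or_intror (ex_intro _ i erefl))
  end.
have hinj : injective h.
  move=> [i|i] [j|j] /(congr1 (@proj1_sig _ _)) /= hij.
  - by rewrite (ord1 i) (ord1 j).
  - by case: (cleaf j).
  - by case: (cleaf i).
  - by rewrite (leaf_inj _ _ hij).
have hsurj v : exists w, h w = v.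
  case: v => v Av; have [vc|[i vi]] := Av.
  - by exists (inl ord0); apply: eq_exist; rewrite /= vc.
  - by exists (inr i); apply: eq_exist; rewrite /= vi.
have [g gK] := choice hsurj.
apply: (cf A); exists g.
  by exists h => // w; apply: hinj; rewrite gK.
move=> u v; rewrite -{1}(gK u) -{1}(gK v).
case: (g u) (g v) => [i|i] [j|j] /=; rewrite ?irrE ?Ecleaf ?Eleaf //.
by rewrite symE Ecleaf.
Qed.

Lemma connect_invariant (T : finType) (e : rel T) (P : pred T) x y :
  (forall a b, P a -> e a b -> P b) -> connect e x y -> P x -> P y.
Proof.
move=> stepP /connectP [p pe ->]; elim: p x pe => [|z p IH] x //=.
by case/andP=> exz /IH h Px; apply/h/(stepP x).
Qed.

(** * Separators and simplicial vertices of chordal graphs *)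

Section Chordal.
Variables (T : finType) (E : rel T).
Hypotheses (symE : symmetric E) (irrE : irreflexive E) (fillE : edge_filled E).

Lemma neq_adj x y : E x y -> x != y.
Proof. by move=> Exy; apply/eqP => xy; rewrite xy irrE in Exy. Qed.

(** Otherwise [S] would consist of private vertices of [p q], and the connection from [x] to [y]
    would violate [edge_filled]. The structural consequences of chordality below are drawn through
    this lemma. *)
Lemma common_nbr (S : pred T) p q x y : E p q -> ~~ S p -> ~~ S q ->
  E p x -> E q y -> S x -> S y -> connect (restr E S) x y ->
  exists z, [/\ S z, E p z & E q z].
Proof.
move=> Epq Sp Sq Epx Eqy Sx Sy cxy.
case: (boolP [exists z, [&& S z, E p z & E q z]]).
  by case/existsP=> z /and3P [? ? ?]; exists z.
rewrite negb_exists => /forallP noz.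
have sub : subpred S (private_nbr E p q).
  move=> z Sz; rewrite /private_nbr; apply/and3P; split.
  - by apply: contraNneq Sp => <-.
  - by apply: contraNneq Sq => <-.
  - by have := noz z; rewrite Sz.
have := fillE Epq Epx Eqy (sub x Sx) (sub y Sy).
by rewrite (connect_restr_sub sub cxy).
Qed.

Lemma square_chord a b c d : a != c -> b != d ->
  E a b -> E b c -> E c d -> E d a -> ~~ E a c -> E b d.
Proof.
move=> nac nbd Eab Ebc Ecd Eda Nac.
have [||||||||z []] := @common_nbr [pred z | (z == c) || (z == d)] a b d c => //=.
- by rewrite negb_or nac eq_sym neq_adj.
- by rewrite negb_or nbd neq_adj.
- by rewrite symE.
- by rewrite eqxx orbT.
- by rewrite eqxx.
- by apply: connect1; rewrite /restr symE Ecd /= !eqxx orbT.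
- by case/orP=> /eqP -> // h; rewrite h in Nac.
Qed.

Definition connected_in (S : pred T) :=
  forall x y, S x -> S y -> connect (restr E S) x y.

Lemma common_ends_adjacent (A B : pred T) y y' a a' b b' :
  connected_in A -> connected_in B ->
  (forall u v, A u -> B v -> ~~ E u v) -> (forall u, A u -> ~~ B u) ->
  ~~ A y -> ~~ A y' -> ~~ B y -> ~~ B y' ->
  A a -> E y a -> A a' -> E y' a' -> B b -> E y b -> B b' -> E y' b' ->
  y != y' -> E y y'.
Proof.
move=> cA cB NAB dAB Ay Ay' By By' Aa Eya Aa' Eya' Bb Eyb Bb' Eyb' nyy'.
apply/negPn/negP => Nyy'.
pose A2 : pred T := fun z => A z && ~~ E y z.
(* The piece of [A] around [a'] that avoids the neighbours of [y]. The wanted [u] is a neighbour of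
   [y] in [A] that touches this piece, or [y'] directly. If there were none, the piece would be
   closed in [A] and contain [a], a neighbour of [y]. *)
pose C : pred T := fun z => A2 z && connect (restr E A2) a' z.
suff [u [c [Au Eyu cC Euc]]] : exists u c,
    [/\ A u, E y u, c = y' \/ C c /\ A2 a' & E u c].
  pose S : pred T := fun z => [|| B z, z == y' | C z && A2 a'].
  have Sb'y' : connect (restr E S) b y'.
    apply: (@connect_trans _ _ b').
      by apply: connect_restr_sub (cB _ _ Bb Bb') => z Bz; rewrite /S Bz.
    by apply: connect1; rewrite /restr symE Eyb' /S Bb' eqxx orbT.
  have [||||||||z []] := @common_nbr S y u b c => //.
  - by rewrite /S (negbTE By) (negbTE nyy') /C /A2 (negbTE Ay).
  - have nuy' : u != y' by apply: contraNneq Ay' => <-.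
    rewrite /S (negbTE nuy') /C /A2 Eyu andbF /= orbF.
    exact: dAB.
  - by rewrite /S Bb.
  - by rewrite /S; case: cC => [->|[-> ->]]; rewrite ?eqxx !orbT.
  - case: cC => [->//|[Cc A2a']]; apply: (connect_trans Sb'y').
    apply: (@connect_trans _ _ a').
      apply: connect1; rewrite /restr Eya' /S eqxx orbT /C A2a' connect0.
      by rewrite !orbT.
    have /andP [_ h] := Cc.
    pose Q z := connect (restr E S) a' z && C z.
    have Q0 : Q a' by rewrite /Q connect0 /C A2a' connect0.
    suff /andP [] : Q c by [].
    apply: (connect_invariant _ h Q0) => v w /andP [h1 h2] /and3P [h3 h4 h5].
    have Cw : C w.
      case/andP: h2 => _ h2; rewrite /C h5 (connect_trans h2) //.
      by apply: connect1; rewrite /restr h3 h4.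
    rewrite /Q Cw (connect_trans h1) //; apply: connect1.
    by rewrite /restr h3 /S h2 Cw A2a' !orbT.
  - case/or3P=> [Bz|/eqP->|/andP [/andP [/andP [_ h] _] _]].
    + by rewrite (negbTE (NAB _ _ Au Bz)).
    + by move=> h; rewrite h in Nyy'.
    + by rewrite (negbTE h).
have [Eya'2|Nya'] := boolP (E y a').
  by exists a', y'; split=> //; [left | rewrite symE].
have A2a' : A2 a' by rewrite /A2 Aa' Nya'.
case: (boolP [exists u, exists c, [&& A u, E y u, C c & E u c]]).
  case/existsP=> u /existsP [c /and4P [? ? ? ?]].
  by exists u, c; split=> //; right.
rewrite negb_exists => /forallP noz; exfalso.
have Ca : C a.
  apply: (connect_invariant _ (cA _ _ Aa' Aa)); last by rewrite /C A2a' connect0.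
  move=> v w Cv /and3P [Evw Av Aw].
  have Nyw : ~~ E y w.
    apply/negP => Eyw; have := noz w; rewrite negb_exists => /forallP /(_ v).
    by rewrite Aw Eyw Cv symE Evw.
  have A2w : A2 w by rewrite /A2 Aw.
  case/andP: Cv => A2v cv; rewrite /C A2w (connect_trans cv) //.
  by apply: connect1; rewrite /restr Evw A2v.
by move: Ca; rewrite /C /A2 Eya andbF.
Qed.

Definition simplicial (r : T) :=
  forall x y, E r x -> E r y -> x != y -> E x y.

(** Induction on [W], any vertex being good if [W] is a clique. Otherwise choose a non-edge [a b]
    for which the component [K0] of [b] outside the closed neighbourhood of [a] is largest. The
    neighbours [S] of [a] that touch [K0] form a clique, and maximality makes every vertex of the
    rest [R] adjacent to all of [S]. So a simplicial vertex of [R] stays simplicial in [W]. *)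
Lemma simplicial_in (W : {set T}) w : w \in W ->
  exists2 r, r \in W & {in W &, forall x y, E r x -> E r y -> x != y -> E x y}.
Proof.
have [n] := ubnP #|W|; elim: n W w => // n IH W w ltWn Ww.
case: (boolP [exists p : T * T,
    [&& p.1 \in W, p.2 \in W, p.1 != p.2 & ~~ E p.1 p.2]]); last first.
  rewrite negb_exists => /forallP h; exists w => // x y Wx Wy _ _ nxy.
  by have := h (x, y); rewrite /= Wx Wy nxy /= negbK.
case/existsP=> p0 p0P.
pose far a : pred T := fun z => [&& z \in W, z != a & ~~ E a z].
pose K (p : T * T) : {set T} :=
  [set z | far p.1 z && connect (restr E (far p.1)) p.2 z].
case: (@arg_maxnP _ p0 (fun p => [&& p.1 \in W, p.2 \in W, p.1 != p.2 & ~~ E p.1 p.2])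
  (fun p => #|K p|) p0P) => -[a b] /and4P [/= Wa Wb nab Nab] maxK.
set K0 := K (a, b) in maxK.
have farb : far a b by rewrite /far Wb eq_sym nab.
have K0b : b \in K0 by rewrite inE /= farb connect0.
have K0far z : z \in K0 -> far a z by rewrite inE => /andP [].
have K0cl x y : x \in K0 -> E x y -> far a y -> y \in K0.
  rewrite !inE /= => /andP [fx cx] Exy fy; rewrite fy (connect_trans cx) //.
  by apply: connect1; rewrite /restr Exy fx.
pose S := [set s in W | E a s && [exists k in K0, E s k]].
pose R := W :\: (K0 :|: S).
have Ra : a \in R.
  rewrite !inE Wa irrE /= andbT; apply/negP => /orP [/andP [/and3P [_]]|].
    by rewrite eqxx.
  by [].
have cK0 : connected_in (mem K0).
  have cb z : z \in K0 -> connect (restr E (mem K0)) b z.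
    move=> K0z; have /andP [_ cz] : far a z && connect (restr E (far a)) b z.
      by move: K0z; rewrite inE.
    pose Q z := connect (restr E (mem K0)) b z && (z \in K0).
    suff /andP [] : Q z by [].
    apply: (connect_invariant _ cz); last by rewrite /Q connect0.
    move=> u v /andP [cu K0u] /and3P [Euv _ fv].
    have K0v := K0cl _ _ K0u Euv fv.
    rewrite /Q K0v (connect_trans cu) //; apply: connect1.
    by rewrite /restr /= Euv K0u.
  move=> x y K0x K0y; apply: (connect_trans _ (cb y K0y)).
  by rewrite (connect_restr_sym symE) cb.
have Sclique : {in S &, forall x y, x != y -> E x y}.
  move=> x y; rewrite !inE => /and3P [Wx Eax /exists_inP [k Kk Exk]].
  case/and3P=> Wy Eay /exists_inP [l Kl Eyl] nxy.
  apply: (@common_ends_adjacent (pred1 a) (mem K0) x y a a k l) => //=.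
  - by move=> u v /eqP -> /eqP ->; apply: connect0.
  - by move=> u v /eqP -> /K0far /and3P [].
  - by move=> u /eqP ->; apply/negP => /K0far; rewrite /far eqxx andbF.
  - by rewrite eq_sym neq_adj.
  - by rewrite eq_sym neq_adj.
  - by apply/negP => /K0far; rewrite /far Eax !andbF.
  - by apply/negP => /K0far; rewrite /far Eay !andbF.
  - by rewrite symE.
  - by rewrite symE.
have NK0R t k : t \in R -> k \in K0 -> ~~ E t k.
  rewrite in_setD in_setU negb_or => /andP [/andP [NK NS] Wt] Kk.
  apply/negP => Etk.
  have Eat : ~~ E a t.
    apply/negP => Eat; move: NS; rewrite inE Wt Eat /= => /negP; apply.
    by apply/exists_inP; exists k.
  have nta : t != a.
    by apply/eqP => ta; have /and3P [_ _] := K0far k Kk; rewrite -ta Etk.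
  have : t \in K0 by apply: (K0cl k) => //; rewrite 1?symE // /far Wt nta Eat.
  by rewrite (negbTE NK).
(* If [t] missed [s], the component for the pair [(t, s)] would contain [K0] and also [s], exceeding
   the maximum. *)
have SR s t : s \in S -> t \in R -> E t s.
  move=> Ss Rt; apply/negPn/negP => Nts.
  have nts : t != s.
    by apply: contraTneq Rt => ->; rewrite !in_setD in_setU Ss orbT.
  have Wt : t \in W by move: Rt; rewrite inE => /andP [].
  have Ws : s \in W by move: Ss; rewrite inE => /andP [].
  have K0ne k : k \in K0 -> k != t.
    by move=> Kk; apply: contraTneq Rt => <-; rewrite !in_setD in_setU Kk.
  have fs : far t s by rewrite /far Ws eq_sym nts.
  have fk k : k \in K0 -> far t k.
    move=> Kk; rewrite /far K0ne // NK0R // !andbT.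
    by have /and3P [] := K0far k Kk.
  have [k Kk Esk] : exists2 k, k \in K0 & E s k.
    by move: Ss; rewrite inE => /and3P [_ _ /exists_inP].
  have sub : s |: K0 \subset K (t, s).
    apply/subsetP => z /setU1P [->|Kz]; first by rewrite inE /= fs connect0.
    rewrite inE /= fk //; apply: (@connect_trans _ _ k).
      by apply: connect1; rewrite /restr Esk fs fk.
    by apply: connect_restr_sub (cK0 k z Kk Kz).
  have Ks : s \notin K0.
    apply/negP => /K0far /and3P [_ _]; move: Ss; rewrite inE.
    by case/and3P=> _ ->.
  have := maxK (t, s); rewrite /= Wt Ws nts Nts => /(_ isT).
  move=> h; have := leq_trans (subset_leq_card sub) h.
  by rewrite cardsU1 Ks ltnn.
have ltRn : #|R| < n.
  rewrite -ltnS; apply: leq_trans ltWn; rewrite ltnS; apply: proper_card.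
  apply/properP; split; first exact: subsetDl.
  by exists b; rewrite // in_setD in_setU K0b.
have [r Rr rP] := IH R a ltRn Ra.
exists r => [|x y Wx Wy Erx Ery nxy]; first by move: Rr; rewrite inE => /andP [].
have nbr z : z \in W -> E r z -> z \in R \/ z \in S.
  move=> Wz Erz; case: (boolP (z \in S)) => [|NS]; first by right.
  left; rewrite in_setD in_setU negb_or NS Wz !andbT.
  by apply: contraTN Erz; apply: NK0R.
have [[Rx|Sx] [Ry|Sy]] := (nbr x Wx Erx, nbr y Wy Ery).
- exact: rP.
- exact: SR.
- by rewrite symE; apply: SR.
- exact: Sclique.
Qed.

End Chordal.

(** * Layers of a rooted chordal claw-free graph *)

Section RootedDefs.
Variables (T : finType) (E : rel T) (r : T).

Definition depth (x : T) : nat := dist E r x.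
Definition ch (w : T) : {set T} := [set c | E w c && (depth c == (depth w).+1)].
Definition par (x : T) : {set T} := [set p | E p x && (depth x == (depth p).+1)].
Definition up (x : T) : nat := #|par x|.

Definition below (i : nat) : pred T := fun x => i < depth x.

(** In a rooted graph this is a single component of the deeper layers, because the children of [w]
    form a clique ([ch_clique]); it is empty when [w] has no child. *)
Definition descent (w : T) : {set T} :=
  [set x | [exists c in ch w, connect (restr E (below (depth w))) c x]].

(** The disjunct [y == w] keeps a childless [w] in its own rim. *)
Definition rim (w : T) : {set T} :=
  [set y | (depth y == depth w) && ((y == w) || [exists c in ch y, c \in descent w])].

Definition bush (w : T) : {set T} := rim w :|: descent w.

Definition top (w : T) : {set T} := [set x in descent w | depth x == (depth w).+1].

Definition cnt (u y : T) : nat := #|[set z in rim u | E y z]|.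

Definition entry (u : T) : {set T} :=
  [set y | ((depth y).+1 == depth u) && (0 < cnt u y)].

(** Where neighbourhoods are nested, this is the threshold that [chain_edge] compares with the
    degree of the other end. [cin_rank] and [cout_rank] do the same between a rim and the tops below
    it. *)
Definition entry_rank (u : T) (t : nat) : nat := #|[set y in entry u | t < cnt u y]|.

Definition cin (w y : T) : nat := #|ch y :&: ch w|.
Definition cout (w y : T) : nat := #|ch y :\: ch w|.
Definition cin_rank (w : T) (t : nat) : nat := #|[set y in rim w | t < cin w y]|.
Definition cout_rank (w : T) (t : nat) : nat := #|[set y in rim w | t < cout w y]|.

(** A rim vertex with the most children decides the edges between its children and the other tops
    ([mixed_edge]), and its adjacency is constant on each rim of a top ([rim_uniform]). *)
Definition widest (w : T) : bool := [forall q in rim w, #|ch q| <= #|ch w|].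

End RootedDefs.

(* In a bipartite graph without induced pair of disjoint edges, neighbourhoods
   are nested, so an edge is recognized from the degrees of its ends. *)
Lemma chain_edge (T : finType) (E : rel T) (A B : {set T}) a b :
  (forall x x' y y', x \in A -> x' \in A -> y \in B -> y' \in B ->
     E x y -> E x' y' -> ~~ E x y' -> ~~ E x' y -> False) ->
  a \in A -> b \in B ->
  E a b = (#|[set x in A | #|[set y in B | E a y]| < #|[set y in B | E x y]| ]|
             < #|[set x in A | E x b]|).
Proof.
move=> chain Aa Bb; pose N x := [set y in B | E x y].
have nested x x' : x \in A -> x' \in A -> (N x \subset N x') || (N x' \subset N x).
  move=> Ax Ax'; case: (boolP (N x \subset N x')) => //= /subsetPn [y].
  rewrite !inE => /andP [By Exy]; rewrite By => /= Nx'y.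
  apply/subsetP => y'; rewrite !inE => /andP [By' Ex'y']; rewrite By' /=.
  by apply/negPn/negP => Nxy'; apply: (chain x x' y y').
have [Eab|Nab] := boolP (E a b).
  apply/esym/proper_card/properP; split.
    apply/subsetP => x; rewrite !inE => /andP [Ax lt_ax]; rewrite Ax /=.
    have [/orP [/subsetP sub|/subset_leq_card]] := nested a x Aa Ax; last first.
      by rewrite leqNgt lt_ax.
    by have := sub b; rewrite !inE Bb Eab => /(_ isT).
  by exists a; rewrite !inE Aa ?Eab // ltnn.
apply/esym/negbTE; rewrite -leqNgt; apply: subset_leq_card.
apply/subsetP => x; rewrite !inE => /andP [Ax Exb]; rewrite Ax /=.
have Nxb : b \in N x by rewrite inE Bb.
have Nab' : b \notin N a by rewrite inE Bb.
apply: proper_card; apply/properP; split; last by exists b.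
have [/orP [//|/subsetP /(_ b Nxb)]] := nested a x Aa Ax.
by rewrite (negbTE Nab').
Qed.

(** Chordality and claw-freeness enter in their restated forms, since the second graph acquires them
    only through the game. Simpliciality of [r] makes up for the missing parent of the root in
    [ch_clique]. *)
Record rooted (T : finType) (E : rel T) (r : T) : Prop := Rooted {
  rooted_sym : symmetric E;
  rooted_irr : irreflexive E;
  rooted_fill : edge_filled E;
  rooted_claw : clawless E;
  rooted_simplicial : simplicial E r }.

(** * Components of the deeper layers and their rims *)

Section Rooted.
Variables (T : finType) (E : rel T) (r : T).
Hypothesis R : rooted E r.
Local Notation symE := (rooted_sym R).
Local Notation irrE := (rooted_irr R).
Local Notation fillE := (rooted_fill R).
Local Notation clawE := (rooted_claw R).
Local Notation simpr := (rooted_simplicial R).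
Local Notation depth := (depth E r).
Local Notation ch := (ch E r).
Local Notation par := (par E r).
Local Notation up := (up E r).
Local Notation K := (descent E r).
Local Notation Q := (rim E r).
Local Notation J := (bush E r).
Local Notation X := (top E r).
Local Notation cnt := (cnt E r).

Lemma depth0 x : depth x = 0 -> x = r.
Proof. by move=> /dist_eq0. Qed.

Lemma depth_adj x y : E x y -> depth y <= (depth x).+1.
Proof. exact: dist_step. Qed.

Lemma chP w c : c \in ch w -> E w c /\ depth c = (depth w).+1.
Proof. by rewrite inE => /andP [? /eqP]. Qed.

Lemma mem_ch w c : E w c -> depth c = (depth w).+1 -> c \in ch w.
Proof. by rewrite inE => -> ->; rewrite eqxx. Qed.

Lemma parP x p : p \in par x -> E p x /\ depth x = (depth p).+1.
Proof. by rewrite inE => /andP [? /eqP]. Qed.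

Lemma mem_par x p : (p \in par x) = (x \in ch p).
Proof. by rewrite !inE. Qed.

Lemma par_ex x : 0 < depth x < #|T| -> exists p, p \in par x.
Proof.
by move=> /dist_pred [p Epx dp]; exists p; rewrite inE Epx; apply/eqP.
Qed.

Lemma claw_false c x y z : E c x -> E c y -> E c z -> x != y -> x != z ->
  y != z -> ~~ E x y -> ~~ E x z -> ~~ E y z -> False.
Proof.
move=> h1 h2 h3 h4 h5 h6 h7 h8 h9; have := clawE h1 h2 h3 h4 h5 h6.
by rewrite (negbTE h7) (negbTE h8) (negbTE h9).
Qed.

Lemma far_nonadj x y : (depth x).+1 < depth y -> ~~ E x y.
Proof. by move=> lt_xy; apply: contraL lt_xy => /depth_adj; rewrite -leqNgt. Qed.

Lemma neq_depth x y : depth x != depth y -> x != y.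
Proof. by apply: contraNneq => ->. Qed.

Lemma ch_reach w c : c \in ch w -> depth w < #|T|.
Proof. by move=> /chP [_ dc]; rewrite -dc; apply: dist_max. Qed.

(** Two non-adjacent children and a parent of [w] would be the leaves of a claw at [w]; the root,
    which has no parent, is simplicial instead. *)
Lemma ch_clique w x y : x \in ch w -> y \in ch w -> x != y -> E x y.
Proof.
move=> cx cy nxy; have [Ewx dx] := chP cx; have [Ewy dy] := chP cy.
have [d0|d0] := posnP (depth w).
  by rewrite (depth0 d0) in Ewx Ewy; apply: simpr.
have [|p /parP [Epw dp]] := @par_ex w; first by rewrite d0 (ch_reach cx).
apply/negPn/negP => Nxy.
apply: (@claw_false w x y p) => //; first by rewrite symE.
- by apply: neq_depth; rewrite dx dp; clear; lia.
- by apply: neq_depth; rewrite dy dp; clear; lia.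
- by rewrite symE far_nonadj // dx dp.
- by rewrite symE far_nonadj // dy dp.
Qed.

Lemma descentP w x :
  reflect (exists2 c, c \in ch w & connect (restr E (below E r (depth w))) c x) (x \in K w).
Proof. by rewrite inE; apply: exists_inP. Qed.

Lemma K_depth w x : x \in K w -> depth w < depth x.
Proof.
case/descentP=> c /chP [_ dc] cx; apply: (connect_restr_in cx).
by rewrite /below dc.
Qed.

Lemma ch_K w c : c \in ch w -> c \in K w.
Proof. by move=> cw; apply/descentP; exists c. Qed.

Lemma K_closed w x y : x \in K w -> E x y -> depth w < depth y -> y \in K w.
Proof.
move=> Kx Exy dy; have dx := K_depth Kx; case/descentP: Kx => c cw cx.
apply/descentP; exists c => //; apply: (connect_trans cx).
by apply: connect1; rewrite /restr Exy /below dx.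
Qed.

Lemma K_connect w x y : x \in K w -> y \in K w ->
  connect (restr E (below E r (depth w))) x y.
Proof.
case/descentP=> c cw cx /descentP [c' cw' cy].
apply: (@connect_trans _ _ c); first by rewrite (connect_restr_sym symE).
apply: (connect_trans _ cy); have [->|nc] := eqVneq c c'; first exact: connect0.
apply: connect1; rewrite /restr (ch_clique cw cw' nc) /below.
by have [_ ->] := chP cw; have [_ ->] := chP cw'; rewrite ltnSn.
Qed.

Lemma K_connected w : connected_in E (mem (K w)).
Proof.
move=> x y /= Kx Ky; have cxy := K_connect Kx Ky.
pose P z := connect (restr E (mem (K w))) x z && (z \in K w).
suff /andP [] : P y by [].
apply: (connect_invariant _ cxy); last by rewrite /P connect0.
move=> u v /andP [cu Ku] /and3P [Euv _ dv].
have Kv := K_closed Ku Euv dv; rewrite /P Kv andbT (connect_trans cu) //.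
by apply: connect1; rewrite /restr /= Euv Ku.
Qed.

Lemma K_component w x y : x \in K w ->
  connect (restr E (below E r (depth w))) x y -> y \in K w.
Proof.
move=> Kx cxy; apply: (connect_invariant (P := mem (K w)) _ cxy Kx).
by move=> u v /= Ku /and3P [Euv _ dv]; apply: (K_closed Ku Euv dv).
Qed.

Lemma K_reach w x : x \in K w -> depth x < #|T|.
Proof.
case/descentP=> c cw cx; rewrite dist_connect.
have : connect E r w by rewrite -dist_connect; apply: ch_reach cw.
move=> /connect_trans; apply; have [Ewc _] := chP cw.
apply: (connect_trans (connect1 Ewc)).
by apply: connect_sub cx => u v /and3P [? _ _]; apply: connect1.
Qed.

Lemma Q_depth w y : y \in Q w -> depth y = depth w.
Proof. by rewrite inE => /andP [/eqP]. Qed.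

Lemma Q_refl w : w \in Q w.
Proof. by rewrite inE !eqxx. Qed.

Lemma mem_Q w y c : depth y = depth w -> c \in ch y -> c \in K w -> y \in Q w.
Proof.
move=> dy cy Kc; rewrite inE dy eqxx /=; apply/orP; right.
by apply/exists_inP; exists c.
Qed.

Lemma Q_ch w y : y \in Q w -> y = w \/ exists2 c, c \in ch y & c \in K w.
Proof. by rewrite inE => /andP [_ /orP [/eqP|/exists_inP]]; [left|right]. Qed.

Lemma K_nbr w x y : x \in K w -> E x y -> y \notin K w -> y \in Q w /\ x \in ch y.
Proof.
move=> Kx Exy NKy; have dx := K_depth Kx.
have dy : depth y <= depth w by rewrite leqNgt; apply: contra NKy; apply: K_closed Exy.
have dxy : depth x <= (depth y).+1 by apply: depth_adj; rewrite symE.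
have e1 : depth y = depth w by clear -dx dy dxy; lia.
have cx : x \in ch y.
  by apply: mem_ch; rewrite 1?symE //; clear -dx dy dxy; lia.
by split=> //; apply: mem_Q Kx.
Qed.

Lemma Q_K w y : y \in Q w -> K y = K w.
Proof.
move=> Qy; have dy := Q_depth Qy; have [->//|[c cy Kc]] := Q_ch Qy.
have Kyc := ch_K cy.
apply/setP => x; apply/idP/idP => Kx.
  by apply: (K_component Kc); rewrite -dy; apply: K_connect.
by apply: (K_component Kyc); rewrite dy; apply: K_connect.
Qed.

Lemma K_meet w z x : x \in K w -> x \in K z -> depth w = depth z -> z \in Q w.
Proof.
move=> Kw Kz dwz; case/descentP: (Kz) => c cz cx.
apply: (@mem_Q w z c) => //; apply: (K_component Kw); rewrite dwz.
by rewrite (connect_restr_sym symE).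
Qed.

Lemma Q_sym w y : y \in Q w -> w \in Q y.
Proof.
move=> Qy; have [->|[c cy Kc]] := Q_ch Qy; first exact: Q_refl.
by apply: (@K_meet _ _ c) => //; [apply: ch_K | apply: Q_depth].
Qed.

Lemma Q_eq w y : y \in Q w -> Q y = Q w.
Proof.
move=> Qy; have dy := Q_depth Qy; have KK := Q_K Qy.
apply/setP => z; apply/idP/idP => Qz; have dz := Q_depth Qz.
  have [->//|[c cz]] := Q_ch Qz; rewrite KK; apply: mem_Q => //.
  by rewrite dz.
have [->|[c cz Kc]] := Q_ch Qz; first exact: Q_sym.
by apply: (mem_Q _ cz); rewrite ?KK // dy.
Qed.

Lemma J_eq w y : y \in Q w -> J y = J w.
Proof. by move=> Qy; rewrite /bush (Q_eq Qy) (Q_K Qy). Qed.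

Lemma J_refl w : w \in J w.
Proof. by rewrite inE Q_refl. Qed.

Lemma J_depth w x : x \in J w -> depth w <= depth x.
Proof. by case/setUP=> [/Q_depth->|/K_depth/ltnW]. Qed.

Lemma J_rim w x : x \in J w -> depth x = depth w -> x \in Q w.
Proof. by case/setUP=> [//|/K_depth h e]; rewrite e ltnn in h. Qed.

Lemma J_descent w x : x \in J w -> depth w < depth x -> x \in K w.
Proof. by case/setUP=> [/Q_depth->|//]; rewrite ltnn. Qed.

Lemma upper_connected i : i < #|T| -> connected_in E (fun x => depth x < i).
Proof.
move=> ltiT.
have cr x : depth x < i -> connect (restr E (fun x => depth x < i)) r x.
  have [n] := ubnP (depth x); elim: n x => // n IH x ltn ltxi.
  have [d0|d0] := posnP (depth x); first by rewrite (depth0 d0) connect0.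
  have [|p /parP [Epx dp]] := @par_ex x; first by rewrite d0 (ltn_trans ltxi).
  have dpi : depth p < i by rewrite dp in ltxi; apply: ltnW.
  apply: (@connect_trans _ _ p).
    by apply: IH => //; rewrite dp in ltn.
  by apply: connect1; rewrite /restr Epx dpi ltxi.
move=> x y hx hy; apply: (connect_trans _ (cr y hy)).
by rewrite (connect_restr_sym symE) cr.
Qed.

(** Two distinct rim vertices both have neighbours in the descent and in the layers above the rim.
    These two sets are connected with no edge between them, so [common_ends_adjacent] applies. *)
Lemma Q_clique w x y : x \in Q w -> y \in Q w -> x != y -> E x y.
Proof.
move=> Qx Qy nxy; have dx := Q_depth Qx; have dy := Q_depth Qy.
have [c cx Kc] : exists2 c, c \in ch x & c \in K w.
  have [xw|//] := Q_ch Qx; have [yw|[c cy Kc]] := Q_ch Qy.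
    by rewrite xw yw eqxx in nxy.
  have := Q_sym Qy => /Q_ch [wy|[c' cw Kc']]; first by rewrite xw wy eqxx in nxy.
  by exists c'; [rewrite xw | apply: ch_K].
have [c' cy Kc'] : exists2 c, c \in ch y & c \in K w.
  have [yw|//] := Q_ch Qy; have := Q_sym Qx => /Q_ch [wx|[c' cw Kc']].
    by rewrite yw wx eqxx in nxy.
  by exists c'; [rewrite yw | apply: ch_K].
have [d0|d0] := posnP (depth w).
  by rewrite (depth0 (etrans dx d0)) (depth0 (etrans dy d0)) eqxx in nxy.
have wT : depth w < #|T| by rewrite -dx; apply: ch_reach cx.
have [|p /parP [Epx dp]] := @par_ex x; first by rewrite dx d0.
have [|q /parP [Eqy dq]] := @par_ex y; first by rewrite dy d0.
have [Exc _] := chP cx; have [Eyc' _] := chP cy.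
apply: (@common_ends_adjacent _ _ symE fillE
          (fun x => depth x < depth w) (mem (K w)) x y p q c c') => //.
- exact: upper_connected.
- exact: K_connected.
- move=> u v du /= Kv; apply/negP => Euv.
  have dv := K_depth Kv; have := depth_adj Euv; clear -du dv; lia.
- by move=> u du /=; apply/negP => /K_depth; rewrite ltnNge ltnW.
- by rewrite dx ltnn.
- by rewrite dy ltnn.
- by apply/negP => /= /K_depth; rewrite dx ltnn.
- by apply/negP => /= /K_depth; rewrite dy ltnn.
- by rewrite -dx dp.
- by rewrite symE.
- by rewrite -dy dq.
- by rewrite symE.
Qed.

(** [common_nbr] for the edge [x y] and the connected descent gives a common neighbour there, which
    can only lie one layer down. *)
Lemma Q_child w x y : x \in Q w -> y \in Q w -> x != y ->
  exists c, c \in ch x /\ c \in ch y.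
Proof.
move=> Qx Qy nxy; have Exy := Q_clique Qx Qy nxy.
have dx := Q_depth Qx; have dy := Q_depth Qy.
have : y \in Q x by rewrite (Q_eq Qx).
case/Q_ch=> [yx|[c' cy Kc']]; first by rewrite yx eqxx in nxy.
have : x \in Q y by rewrite (Q_eq Qy).
case/Q_ch=> [xy|[c cx Kc]]; first by rewrite xy eqxx in nxy.
have KK : K x = K y by rewrite (Q_K Qx) (Q_K Qy).
have [Exc _] := chP cx; have [Eyc' _] := chP cy.
have [|||||z [/= Kz Exz Eyz]] :=
    @common_nbr _ _ fillE (mem (K x)) x y c c' Exy _ _ Exc Eyc'.
- by apply/negP => /= /K_depth; rewrite ltnn.
- by apply/negP => /= /K_depth; rewrite dx dy ltnn.
- by rewrite /= KK.
- by [].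
- by apply: K_connected => //=; rewrite KK.
have dz : depth z = (depth x).+1.
  by have := K_depth Kz; have := depth_adj Exz; clear; lia.
by exists z; split; apply: mem_ch => //; rewrite dz dx dy.
Qed.

Lemma common_parent x y : E x y -> depth x = depth y -> 0 < depth x < #|T| ->
  exists p, p \in par x /\ p \in par y.
Proof.
move=> Exy dxy dx; have [p /parP [Epx dp]] := par_ex dx.
have [q /parP [Eqy dq]] : exists q, q \in par y by apply: par_ex; rewrite -dxy.
have [|||||||z [/= dz Exz Eyz]] :=
    @common_nbr _ _ fillE (fun z => depth z < depth x) x y p q Exy.
- by rewrite ltnn.
- by rewrite dxy ltnn.
- by rewrite symE.
- by rewrite symE.
- by rewrite dp.
- by rewrite dxy dq.
- by apply: upper_connected; [case/andP: dx | rewrite /= dp | rewrite /= dxy dq].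
have h : depth x = (depth z).+1.
  have : depth x <= (depth z).+1 by apply: depth_adj; rewrite symE.
  by clear -dz; lia.
by exists z; rewrite !inE ![E z _]symE Exz Eyz -dxy h eqxx.
Qed.

End Rooted.

(** * Edges at the rim of a bush and among its tops *)

Section Split.
Variables (T : finType) (E : rel T) (r : T).
Hypothesis R : rooted E r.
Local Notation symE := (rooted_sym R).
Local Notation irrE := (rooted_irr R).
Local Notation fillE := (rooted_fill R).
Local Notation depth := (depth E r).
Local Notation ch := (ch E r).
Local Notation par := (par E r).
Local Notation up := (up E r).
Local Notation K := (descent E r).
Local Notation Q := (rim E r).
Local Notation J := (bush E r).
Local Notation X := (top E r).
Local Notation cnt := (cnt E r).
Local Notation widest := (widest E r).

(** [z] and [z'] have a common child and a common parent [p0]. To avoid a claw at [z] with leaves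
    [y], the child and [p0], the vertex [y] must be adjacent to [p0]; then [y] and [z'] are both
    children of [p0]. *)
Lemma same_layer_uniform w z z' y : z \in Q w -> z' \in Q w -> y \notin Q w ->
  depth y = depth w -> E y z -> E y z'.
Proof.
move=> Qz Qz' NQy dy Eyz; have [<-//|nzz'] := eqVneq z z'.
have dz := Q_depth Qz; have dz' := Q_depth Qz'.
have Ezz' := Q_clique R Qz Qz' nzz'.
have [c [cz cz']] := Q_child R Qz Qz' nzz'.
have Kc : c \in K w by rewrite -(Q_K R Qz); apply: ch_K.
have [Ezc dc] := chP cz.
have nyz' : y != z' by apply: contraNneq NQy => ->.
have Nyc : ~~ E y c.
  apply/negP => Eyc; case/negP: NQy; apply: (@mem_Q _ _ _ w y c) => //.
  by apply: mem_ch; rewrite // dc dz dy.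
have [d0|d0] := posnP (depth w).
  have yz : y = z by rewrite (depth0 (etrans dy d0)) -(depth0 (etrans dz d0)).
  by rewrite yz Qz in NQy.
have wT : depth w < #|T| by rewrite -dz (ch_reach cz).
have [||p0 [p0z p0z']] := @common_parent _ _ _ R z z' Ezz'.
- by rewrite dz dz'.
- by rewrite dz d0.
have [Ep0z dp0] := parP p0z.
have Eyp0 : E y p0.
  apply/negPn/negP => Nyp0; apply: (claw_false R (c := z) (x := c) (y := y) (z := p0)) => //.
  - by rewrite (symE z).
  - by rewrite (symE z).
  - by apply: (@neq_depth _ E r); rewrite dc dz dy; clear; lia.
  - by apply: (@neq_depth _ E r); rewrite dc dp0; clear; lia.
  - by apply: (@neq_depth _ E r); rewrite dy -dz dp0; clear; lia.
  - by rewrite (symE c).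
  - by rewrite (symE c); apply: (@far_nonadj _ E r); rewrite dc dp0.
have cp0y : y \in ch p0 by apply: mem_ch; rewrite 1?symE // dy -dz.
by apply: (ch_clique R cp0y) => //; rewrite -mem_par.
Qed.

Lemma cnt_gt0 w x : x \notin Q w -> depth x = depth w ->
  forall z, z \in Q w -> E x z = (0 < cnt w x).
Proof.
move=> NQx dx z Qz; apply/idP/card_gt0P => [Exz|[z']].
  by exists z; rewrite inE Qz.
by rewrite inE => /andP [Qz' Exz']; apply: (same_layer_uniform Qz' Qz NQx dx Exz').
Qed.

Lemma entry_clique w x y : x \in entry E r w -> y \in entry E r w -> x != y -> E x y.
Proof.
rewrite !inE => /andP [/eqP dx /card_gt0P [z]]; rewrite inE => /andP [Qz Exz].
case/andP=> /eqP dy /card_gt0P [z']; rewrite inE => /andP [Qz' Eyz'] nxy.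
have dz := Q_depth Qz; have dz' := Q_depth Qz'.
have cz : z \in ch x by apply: mem_ch; rewrite // dz dx.
have cz' : z' \in ch y by apply: mem_ch; rewrite // dz' dy.
apply: (Q_clique R (Q_refl E r x) _ nxy).
have dyx : depth y = depth x by clear -dx dy; lia.
apply: (mem_Q dyx cz').
have [<-|nzz'] := eqVneq z z'; first exact: ch_K.
apply: (K_closed (ch_K cz) (Q_clique R Qz Qz' nzz')).
by rewrite dz' -dx.
Qed.

Lemma squareF a b c d : E a b -> E b c -> E c d -> E d a -> a != c -> b != d ->
  ~~ E a c -> ~~ E b d -> False.
Proof.
by move=> h1 h2 h3 h4 h5 h6 h7; rewrite (square_chord symE irrE fillE h5 h6 h1 h2 h3 h4 h7).
Qed.

(** Entries and rim are cliques, so two disjoint edges inducing a matching between them would close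
    to a chordless square. This is the hypothesis of [chain_edge]. *)
Lemma entry_edge w x z : z \in Q w -> x \in entry E r w ->
  E x z = (entry_rank E r w (cnt w x) < up z).
Proof.
move=> Qz Ax; have dz := Q_depth Qz.
rewrite (chain_edge (A := entry E r w) (B := Q w) _ Ax Qz) //; last first.
  move=> u u' y y' Au Au' By By' Euy Eu'y' Nuy' Nu'y.
  have nuu' : u != u' by apply: contraNneq Nu'y => <-.
  have nyy' : y != y' by apply: contraNneq Nu'y => ->.
  have du := Au; have du' := Au'; rewrite !inE in du du'.
  have dn : (depth u == depth w) = false.
    by case/andP: du => /eqP <- _; rewrite ltn_eqF.
  have dn' : (depth u' == depth w) = false.
    by case/andP: du' => /eqP <- _; rewrite ltn_eqF.
  apply: (@squareF u y y' u') => //.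
  - by apply: (Q_clique R (w := w)).
  - by rewrite symE.
  - by rewrite symE; apply: (entry_clique (w := w)).
  - by apply: (@neq_depth _ E r); rewrite (Q_depth By') dn.
  - by apply: (@neq_depth _ E r); rewrite (Q_depth By) eq_sym dn'.
  - by rewrite symE.
suff -> : #|[set p in entry E r w | E p z]| = up z by [].
apply: eq_card => p; rewrite in_set.
apply/idP/idP => [/andP [Ap Epz]|/parP [Epz dp]].
  by rewrite inE Epz dz eq_sym; move: Ap; rewrite inE => /andP [].
rewrite Epz !inE -dz dp eqxx /= andbT; apply/card_gt0P.
by exists z; rewrite inE Qz.
Qed.

(* The adjacency between the bush of [w] and the rest of the graph, in terms of
   data that a partial isomorphism preserves. *)
Definition cross (w x y : T) : bool :=
  (depth y == depth w) &&
  (if depth x == depth w then 0 < cnt w x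
   else [&& (depth x).+1 == depth w, 0 < cnt w x
          & entry_rank E r w (cnt w x) < up y]).

(** Only rim vertices have neighbours outside the bush. An outside vertex at the depth of the rim
    sees all of it or nothing; one layer up the entry ranks decide; one layer down a neighbour of
    the rim would belong to the bush. *)
Lemma bush_edge w x y : x \notin J w -> y \in J w -> E x y = cross w x y.
Proof.
rewrite in_setU negb_or => /andP [NQx NKx] Jy; rewrite /cross.
have [/J_rim - /(_ Jy) Qy | /eqP ndy] := altP (depth y =P depth w); last first.
  have Ky : y \in K w.
    by apply: (J_descent Jy); have := J_depth Jy; rewrite leq_eqVlt eq_sym; case: eqP.
  apply/negbTE/negP; rewrite symE => Eyx.
  by have [] := K_nbr R Ky Eyx NKx; rewrite (negbTE NQx).
have dy := Q_depth Qy.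
have [dx|/eqP ndx] := altP (depth x =P depth w); first exact: cnt_gt0.
have [dx|/eqP ndx'] := altP ((depth x).+1 =P depth w).
  rewrite /=; have [c0|c0] := posnP (cnt w x).
    apply/negbTE/negP => Exy; have := c0; rewrite /cnt => /eqP.
    by rewrite cards_eq0 => /eqP/setP/(_ y); rewrite !inE in Qy *; rewrite Exy; rewrite Qy.
  by apply: entry_edge; rewrite // !inE dx eqxx.
apply/negbTE/negP => /= Exy; have d1 := depth_adj r Exy.
have : depth x <= (depth y).+1 by apply: depth_adj; rewrite symE.
rewrite dy leq_eqVlt ltnS => /orP [/eqP dx|dx2].
  case/negP: NKx; rewrite -(Q_K R Qy); apply: ch_K; apply: mem_ch; rewrite 1?symE //.
  by rewrite dx dy.
by move: d1 dx2 ndx ndx'; rewrite dy; clear; lia.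
Qed.

Lemma K_nbr_bush w x y : x \in K w -> E x y -> y \in J w.
Proof.
move=> Kx Exy; rewrite in_setU orbC; have [//|NKy] := boolP (y \in K w).
by have [->] := K_nbr R Kx Exy NKy.
Qed.

Lemma bush_sub w z : z \in J w -> J z \subset J w.
Proof.
have [Qz _|NQz] := boolP (z \in Q w); first by rewrite (J_eq R Qz).
rewrite in_setU (negbTE NQz) /= => Kz; have dz := K_depth Kz.
apply/subsetP => x Jx.
suff : x \in K w by rewrite in_setU => ->; rewrite orbT.
have KK c : c \in K z -> c \in K w.
  case/descentP=> c' cz' cc; have [Ezc' dc'] := chP cz'.
  have Kc' : c' \in K w.
    by apply: (K_closed Kz Ezc'); rewrite dc' ltnS ltnW.
  apply: (K_component Kc'); apply: connect_restr_sub cc => u.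
  exact: ltn_trans.
case/setUP: Jx => [Qx|]; last exact: KK.
have [->//|[c cx Kc]] := Q_ch Qx; have [Exc dc] := chP cx.
apply: (K_closed (KK c Kc)); first by rewrite symE.
by rewrite (Q_depth Qx).
Qed.

Lemma bush_sub_descent w z : z \in K w -> J z \subset K w.
Proof.
move=> Kz; apply/subsetP => x Jx; have dz := K_depth Kz.
have Jw : z \in J w by rewrite in_setU Kz orbT.
apply: J_descent (subsetP (bush_sub Jw) x Jx) _.
exact: leq_trans (J_depth Jx).
Qed.

Lemma topP w x : x \in X w -> x \in K w /\ depth x = (depth w).+1.
Proof. by rewrite inE => /andP [? /eqP]. Qed.

Lemma top_bush w z : z \in X w -> z \in J w.
Proof. by case/topP=> Kz _; rewrite in_setU Kz orbT. Qed.

Lemma descent_top w x : x \in K w -> exists2 z, z \in X w & x \in J z.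
Proof.
have [n] := ubnP (depth x); elim: n x => // n IH x ltn Kx.
have dwx := K_depth Kx; have xT := K_reach Kx.
have [dx|/eqP ndx] := altP (depth x =P (depth w).+1).
  by exists x; rewrite ?J_refl // inE Kx dx eqxx.
have [|p /parP [Epx dp]] := @par_ex _ E r x; first by rewrite xT (leq_ltn_trans _ dwx).
have dwp : depth w < depth p by clear -dp dwx ndx; lia.
have Kp : p \in K w by apply: (K_closed Kx) => //; rewrite symE.
have [|z Xz Jp] := IH p _ Kp; first by clear -dp ltn; lia.
exists z => //; have cx : x \in ch p by apply: mem_ch.
have [Qp|NQp] := boolP (p \in Q z).
  by rewrite in_setU -(Q_K R Qp) ch_K ?orbT.
have Kzp : p \in K z by move: Jp; rewrite in_setU (negbTE NQp).
rewrite in_setU (K_closed Kzp Epx) ?orbT // dp ltnS.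
exact/ltnW/K_depth.
Qed.

Lemma bush_meet z z' x : depth z = depth z' -> x \in J z -> x \in J z' -> J z = J z'.
Proof.
move=> dz Jx Jx'; have [dx|/eqP ndx] := altP (depth x =P depth z).
  rewrite -(J_eq R (J_rim Jx dx)) -(J_eq R (J_rim Jx' _)) //.
  by rewrite dx.
have lt_zx : depth z < depth x.
  by have := J_depth Jx; rewrite leq_eqVlt eq_sym; case: eqP.
apply/esym/(J_eq R); apply: (@K_meet _ _ _ R z z' x) => //; first exact: J_descent.
by apply: J_descent => //; rewrite -dz.
Qed.

Lemma par_rim w x : x \in X w -> par x \subset Q w.
Proof.
case/topP=> Kx dx; apply/subsetP => p /parP [Epx dp].
apply: (@mem_Q _ _ _ w p x) => //; last exact: mem_ch.
by clear -dx dp; lia.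
Qed.

Lemma top_par w x : x \in X w -> exists2 q, q \in Q w & x \in ch q.
Proof.
move=> Xx; have [Kx dx] := topP Xx.
have [|p px] := @par_ex _ E r x; first by rewrite dx (leq_ltn_trans _ (K_reach Kx)) ?dx.
by exists p; rewrite -?mem_par // (subsetP (par_rim Xx)).
Qed.

Lemma ch_top w q c : q \in Q w -> c \in ch q -> c \in X w.
Proof.
move=> Qq cq; rewrite inE -(Q_K R Qq) ch_K //=.
by have [_ ->] := chP cq; rewrite (Q_depth Qq).
Qed.

Lemma edge_ch w q x : q \in Q w -> x \in X w -> E q x = (x \in ch q).
Proof. by move=> Qq /topP [_ dx]; rewrite inE dx (Q_depth Qq) eqxx andbT. Qed.

(* Two tops outside the neighbourhood of [w], with parents [q] and [q'], would
   otherwise force a square on [q], [q'] and common children with [w]. *)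
Lemma top_out_clique w x y : x \in X w -> y \in X w -> ~~ E w x -> ~~ E w y ->
  x != y -> E x y.
Proof.
move=> Xx Xy Nwx Nwy nxy; apply/negPn/negP => Nxy.
have [q Qq cqx] := top_par Xx; have [q' Qq' cqy] := top_par Xy.
have [Eqx dx] := chP cqx; have [Eqy dy] := chP cqy.
have Nqy : ~~ E q y.
  by rewrite (edge_ch Qq Xy); apply: contra Nxy => cy; apply: (ch_clique R cqx).
have Nqx : ~~ E q' x.
  by rewrite (edge_ch Qq' Xx); apply: contra Nxy => cy; apply: (ch_clique R cy).
have nqq : q != q' by apply: contraNneq Nqy => ->.
have nqw : q != w by apply: contraNneq Nwx => <-.
have nqw' : q' != w by apply: contraNneq Nwy => <-.
have Qw := Q_refl E r w.
have [z1 [c1q c1w]] := Q_child R Qq Qw nqw.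
have [z2 [c2q c2w]] := Q_child R Qq' Qw nqw'.
have claw_z z : z \in ch w -> z \in ch q -> z \in ch q' -> False.
  move=> cw cq cq'; have [Ewz dz] := chP cw.
  have nz1 : z != x by apply: contraNneq Nwx => <-.
  have nz2 : z != y by apply: contraNneq Nwy => <-.
  apply: (claw_false R (c := z) (x := x) (y := y) (z := w)) => //.
  - exact: (ch_clique R cq).
  - exact: (ch_clique R cq').
  - by rewrite symE.
  - by apply: (@neq_depth _ E r); rewrite dx (Q_depth Qq); clear; lia.
  - by apply: (@neq_depth _ E r); rewrite dy (Q_depth Qq'); clear; lia.
  - by rewrite symE.
  - by rewrite symE.
have N1 : z1 \notin ch q' by apply/negP => h; apply: (claw_z z1).
have N2 : z2 \notin ch q by apply/negP => h; apply: (claw_z z2).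
have X1 := ch_top Qw c1w; have X2 := ch_top Qw c2w.
have n12 : z1 != z2 by apply: contraNneq N1 => ->.
have [_ d1] := topP X1; have [_ d2] := topP X2.
have [Eq1 _] := chP c1q; have [Eq2 _] := chP c2q.
apply: (@squareF q q' z2 z1) => //.
- exact: (Q_clique R Qq Qq').
- by rewrite symE; apply: (ch_clique R c1w).
- by rewrite symE.
- by apply: (@neq_depth _ E r); rewrite d2 (Q_depth Qq); clear; lia.
- by apply: (@neq_depth _ E r); rewrite d1 (Q_depth Qq'); clear; lia.
- by rewrite (edge_ch Qq X2).
- by rewrite (edge_ch Qq' X1).
Qed.

(** The children of [w] are not all children of [q], since [q] would then have more of them because
    of [y]. A child of [w] that [q] misses cannot be adjacent to [y]: it would form a chordless
    square with [y], [q] and [w]. *)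
Lemma widest_private w x y : widest w -> x \in X w -> y \in X w -> E w x ->
  ~~ E w y -> E x y -> forall q, q \in Q w -> y \in ch q ->
  exists x0, [/\ x0 \in ch w, x0 \notin ch q, ~~ E x0 y & x0 != y].
Proof.
move=> ww Xx Xy Ewx Nwy Exy q Qq cy; have Qw := Q_refl E r w.
have NS : ~~ (ch w \subset ch q).
  apply/negP => sub; have : ch w \proper ch q.
    by apply/properP; split=> //; exists y; rewrite // -(edge_ch Qw Xy).
  by move/proper_card; have := forall_inP ww q Qq; rewrite leqNgt => /negbTE ->.
have [x0 cw0 Nq0] := subsetPn NS; exists x0.
have X0 := ch_top Qw cw0; have [Ew0 d0] := chP cw0.
have n0y : x0 != y by apply: contraNneq Nwy => <-.
have nqw : q != w by apply: contraNneq Nwy => <-; case: (chP cy).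
split=> //; apply/negP => E0y; have [Eqy dy] := chP cy.
apply: (@squareF x0 y q w) => //.
- by rewrite symE.
- by apply: (Q_clique R (w := w)).
- by apply: (@neq_depth _ E r); rewrite d0 (Q_depth Qq); clear; lia.
- by apply: (@neq_depth _ E r); rewrite dy (Q_depth Qq); clear; lia.
- by rewrite symE (edge_ch Qq X0).
- by rewrite symE.
Qed.

(** If [x] is adjacent to the whole rim, it shares a parent with [y], and siblings are adjacent.
    Conversely, if [x y] is an edge and some [q] in the rim misses [x], the vertex [x0] of
    [widest_private] leads to a chordless square or, by [top_out_clique] at [q], to the excluded
    edge [x0 y]. *)
Lemma mixed_edge w x y : widest w -> x \in X w -> y \in X w -> E w x -> ~~ E w y ->
  E x y = (up x == #|Q w|).
Proof.
move=> ww Xx Xy Ewx Nwy; have Qw := Q_refl E r w.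
have nxy : x != y by apply: contraTneq Ewx => ->.
have -> : (up x == #|Q w|) = (par x == Q w).
  rewrite eqEcard par_rim //=; apply/eqP/idP => [/esym/eq_leq //|h].
  by apply/eqP; rewrite eqn_leq h subset_leq_card ?par_rim.
have [q0 Qq0 cy0] := top_par Xy.
apply/idP/eqP => [Exy|parQ]; last first.
  have cx0 : x \in ch q0 by rewrite -mem_par parQ.
  exact: (ch_clique R cx0).
have [x0 [cw0 Nq0 N0y n0y]] := widest_private ww Xx Xy Ewx Nwy Exy Qq0 cy0.
have X0 := ch_top Qw cw0; have [Ew0 d0] := chP cw0.
have [_ dx] := topP Xx; have [Eq0y dy] := chP cy0.
have dq0 := Q_depth Qq0.
have cwx : x \in ch w by rewrite -(edge_ch Qw Xx).
have nq0w : q0 != w by apply: contraNneq Nwy => <-.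
have cx0 : x \in ch q0.
  apply/negPn/negP => Ncx; apply: (@squareF x y q0 w) => //.
  - by rewrite symE.
  - by apply: (Q_clique R (w := w)).
  - by apply: (@neq_depth _ E r); rewrite dx dq0; clear; lia.
  - by apply: (@neq_depth _ E r); rewrite dy dq0; clear; lia.
  - by rewrite symE (edge_ch Qq0 Xx).
  - by rewrite symE.
apply/eqP; rewrite eqEsubset par_rim //=; apply/subsetP => q Qq.
rewrite mem_par; apply/negPn/negP => Nqx; have dq := Q_depth Qq.
have nx0x : x0 != x by apply: contraNneq Nq0 => ->.
have nqq0 : q != q0 by apply: contraNneq Nqx => ->.
have [Eq0x _] := chP cx0.
have [cq0|Nqx0] := boolP (x0 \in ch q).
  apply: (@squareF q x0 x q0) => //.
  - by case: (chP cq0).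
  - exact: (ch_clique R cw0).
  - by rewrite symE.
  - by rewrite symE; apply: (Q_clique R (w := w)).
  - by apply: (@neq_depth _ E r); rewrite dx dq; clear; lia.
  - by apply: (@neq_depth _ E r); rewrite d0 dq0; clear; lia.
  - by rewrite (edge_ch Qq Xx).
  - by rewrite symE (edge_ch Qq0 X0).
have [cqy|Nqy] := boolP (y \in ch q).
  have nqw : q != w by apply: contraNneq Nqx => ->.
  apply: (@squareF q y x w) => //.
  - by case: (chP cqy).
  - by rewrite symE.
  - by rewrite symE.
  - by rewrite symE; apply: (Q_clique R (w := w)).
  - by apply: (@neq_depth _ E r); rewrite dx dq; clear; lia.
  - by apply: (@neq_depth _ E r); rewrite dy dq0; clear; lia.
  - by rewrite (edge_ch Qq Xx).
  - by rewrite symE.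
case/negP: N0y.
have XwE : X q = X w by rewrite /top (Q_K R Qq) dq.
apply: (@top_out_clique q) => //; rewrite ?XwE // ?(edge_ch Qq) //.
Qed.

(** If [u] is a child of [w] and [v] in the rim of [u] is not, [mixed_edge] makes every vertex of
    [rim w] a parent of [u]. A common child of [u] and [v], the vertex [x0] of [widest_private] and
    a parent [q0] of [v] are then the leaves of a claw at [u]. *)
Lemma rim_uniform w x z : widest w -> x \in X w -> z \in Q x -> E w x = E w z.
Proof.
move=> ww; suff main u v : u \in X w -> v \in Q u -> E w u -> ~~ E w v -> False.
  move=> Xx Qz; have [Kx dx] := topP Xx.
  have Xz : z \in X w.
    have Jz : z \in J x by rewrite in_setU Qz.
    by rewrite inE (subsetP (bush_sub_descent Kx)) // (Q_depth Qz) dx eqxx.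
  apply/idP/idP => h; apply/negPn/negP => Nh; [exact: (main x z)|].
  exact: (main z x Xz (Q_sym R Qz) h Nh).
move=> Xu Qv Ewu Nwv; have Qw := Q_refl E r w.
have [Ku du] := topP Xu; have dv := Q_depth Qv.
have nuv : u != v by apply: contraTneq Ewu => ->.
have Xv : v \in X w.
  have Jv : v \in J u by rewrite in_setU Qv.
  by rewrite inE (subsetP (bush_sub_descent Ku)) // dv du eqxx.
have Euv := Q_clique R (Q_refl E r u) Qv nuv.
have parQ : par u = Q w.
  by apply/eqP; rewrite eqEcard par_rim //= -(eqP (_ : up u == #|Q w|)) // -(mixed_edge ww Xu Xv).
have [q0 Qq0 cv0] := top_par Xv; have dq0 := Q_depth Qq0.
have [x0 [cw0 Nq0 N0v n0v]] := widest_private ww Xu Xv Ewu Nwv Euv Qq0 cv0.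
have X0 := ch_top Qw cw0; have [Ew0 d0] := chP cw0.
have cu0 : u \in ch q0 by rewrite -mem_par parQ.
have [Equ0 _] := chP cu0.
have cuw : u \in ch w by rewrite -(edge_ch Qw Xu).
have n0u : x0 != u by apply: contraNneq Nq0 => ->.
have E0u : E x0 u by apply: (ch_clique R cw0).
have [c [cu cv]] := Q_child R (Q_refl E r u) Qv nuv.
have [Euc dc] := chP cu; have [Evc _] := chP cv.
have NE0c : ~~ E x0 c.
  apply/negP => E0c; case/negP: N0v.
  apply: (Q_clique R _ Qv n0v); apply: (@mem_Q _ _ _ u x0 c).
  - by rewrite d0 du.
  - by apply: mem_ch => //; rewrite dc d0 du.
  - exact: ch_K.
apply: (claw_false R (c := u) (x := c) (y := x0) (z := q0)) => //.
- by rewrite symE.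
- by rewrite symE.
- by apply: (@neq_depth _ E r); rewrite dc d0 du; clear; lia.
- by apply: (@neq_depth _ E r); rewrite dc du dq0; clear; lia.
- by apply: (@neq_depth _ E r); rewrite d0 dq0; clear; lia.
- by rewrite symE.
- by rewrite symE (@far_nonadj _ E r) // dc du dq0.
- by rewrite symE (edge_ch Qq0 X0).
Qed.

(** The tops adjacent to [w] and the remaining tops are two cliques. [chain_edge] applies between
    the rim and each of them separately, hence the two kinds of rank. *)
Lemma rim_top_edge w q x : q \in Q w -> x \in X w ->
  E q x = if E w x then cin_rank E r w (cin E r w q) < up x
          else cout_rank E r w (cout E r w q) < up x.
Proof.
move=> Qq Xx; have Qw := Q_refl E r w.
have upE : up x = #|[set p in Q w | E p x]|.
  apply: eq_card => p; rewrite [RHS]inE; apply/idP/andP => [px|[Qp Epx]].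
    by rewrite (subsetP (par_rim Xx) p px); split=> //; case/parP: px.
  by rewrite mem_par -(edge_ch Qp Xx).
have chain (B : {set T}) : B \subset X w ->
    {in B &, forall y y', y != y' -> E y y'} ->
    forall u u' y y', u \in Q w -> u' \in Q w -> y \in B -> y' \in B ->
     E u y -> E u' y' -> ~~ E u y' -> ~~ E u' y -> False.
  move=> /subsetP BX Bcl u u' y y' Qu Qu' By By' Euy Euy' Nuy' Nuy.
  have nyy' : y != y' by apply: contraNneq Nuy => ->.
  have nuu' : u != u' by apply: contraNneq Nuy => <-.
  have [_ dy] := topP (BX y By); have [_ dy'] := topP (BX y' By').
  apply: (@squareF u y y' u') => //.
  - exact: Bcl.
  - by rewrite symE.
  - by rewrite symE; apply: (Q_clique R (w := w)).
  - by apply: (@neq_depth _ E r); rewrite (Q_depth Qu) dy'; clear; lia.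
  - by apply: (@neq_depth _ E r); rewrite (Q_depth Qu') dy; clear; lia.
  - by rewrite symE.
have [Ewx|Nwx] := boolP (E w x).
  have cx : x \in ch w by rewrite -(edge_ch Qw Xx).
  have cinE u : u \in Q w -> cin E r w u = #|[set y in ch w | E u y]|.
    move=> Qu; apply: eq_card => y; rewrite !inE (Q_depth Qu).
    by case: (E w y); case: (E u y); case: (_ == _).
  rewrite (chain_edge (A := Q w) (B := ch w) (chain _ _ _) Qq cx) -?upE.
  - congr (leq _.+1 _); apply: eq_card => u; rewrite [LHS]in_set [RHS]in_set.
    by have [Qu|//] := boolP (u \in Q w); rewrite !cinE.
  - by apply/subsetP => y; apply: ch_top.
  - exact: (ch_clique R (w := w)).
pose B := [set y in X w | ~~ E w y].
have Bx : x \in B by rewrite inE Xx.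
have coutE u : u \in Q w -> cout E r w u = #|[set y in B | E u y]|.
  move=> Qu; apply: eq_card => y; rewrite in_setD [RHS]in_set.
  have [Xy|NXy] := boolP (y \in X w).
    by rewrite [y \in B]in_set Xy -(edge_ch Qw Xy) -(edge_ch Qu Xy).
  rewrite [y \in B]in_set (negbTE NXy) /=; apply/negbTE; rewrite negb_and orbC.
  by apply/orP; left; apply: contra NXy; apply: ch_top.
rewrite (chain_edge (A := Q w) (B := B) (chain _ _ _) Qq Bx) -?upE.
- congr (leq _.+1 _); apply: eq_card => u; rewrite [LHS]in_set [RHS]in_set.
  by have [Qu|//] := boolP (u \in Q w); rewrite !coutE.
- by apply/subsetP => y; rewrite inE => /andP [].
- move=> y y'; rewrite ![_ \in B]inE => /andP [? ?] /andP [? ?].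
  by apply: (top_out_clique (w := w)).
Qed.

(** Separate bushes touch only if their rims lie at the same depth, and then the rims are completely
    joined. So a part that loses the lower boundary [u] still has a known count towards [rim u]. *)
Lemma sibling_cnt u z y : u \notin J z -> depth z <= depth u -> y \in J z ->
  cnt u y = if (depth y == depth z) && E z u then #|Q u| else 0.
Proof.
move=> NJu dzu Jy.
have sepQ t : t \in Q u -> t \notin J z.
  move=> Qt; apply: contra NJu => Jt; apply: (subsetP (bush_sub Jt)).
  by rewrite (J_eq R Qt) J_refl.
have edge t : t \in Q u -> E y t = (depth y == depth z) && E z u.
  move=> Qt; have NJt := sepQ t Qt; have dt := Q_depth Qt.
  have NQt : t \notin Q z by apply: contra NJt; rewrite in_setU => ->.
  apply/idP/andP => [Eyt|[/eqP dy Ezu]].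
    have Qy : y \in Q z.
      have /setUP [//|Ky] := Jy.
      by case/negP: NJt; exact: (K_nbr_bush Ky Eyt).
    have dy := Q_depth Qy; have dyt := depth_adj r Eyt.
    have dtz : depth t = depth z.
      have le_zt : depth z <= depth t by rewrite dt.
      have [//|/eqP ne] := altP (depth t =P depth z).
      have e : depth t = (depth y).+1 by clear -dyt dy le_zt ne; lia.
      case/negP: NJt; rewrite in_setU -(Q_K R Qy) ch_K ?orbT //.
      exact: mem_ch.
    have Etz : E t z.
      apply: (same_layer_uniform Qy (Q_refl E r z) NQt dtz); by rewrite symE.
    split; first by rewrite dy.
    have NQz : z \notin Q u.
      by apply: contra NJu => Qz; rewrite in_setU (Q_sym R Qz).
    apply: (same_layer_uniform Qt (Q_refl E r u) NQz); first by rewrite -dt dtz.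
    by rewrite symE.
  have Qy := J_rim Jy dy.
  have duz : depth u = depth z.
    apply/eqP; rewrite eqn_leq dzu andbT leqNgt; apply/negP => lt_zu.
    case/negP: NJu; rewrite in_setU ch_K ?orbT // mem_ch //.
    by have := depth_adj r Ezu; clear -lt_zu; lia.
  have NQz : z \notin Q u.
    by apply: contra NJu => Qz; rewrite in_setU (Q_sym R Qz).
  have Ezt : E z t.
    by apply: (same_layer_uniform (Q_refl E r u) Qt NQz) => //; rewrite duz.
  rewrite symE; apply: (same_layer_uniform (Q_refl E r z) Qy NQt).
    by rewrite dt duz.
  by rewrite symE.
rewrite /cnt; case: ifP => h; last first.
  by apply: eq_card0 => t; rewrite inE; apply/negbTE/negP => /andP [Qt]; rewrite edge // h.
by apply: eq_card => t; rewrite inE andb_idr // => Qt; rewrite edge.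
Qed.

End Split.

(** * Gluing partial isomorphisms *)

Section PartialIso.
Variables (T : finType) (E E' : rel T) (C : Type) (c c' : T -> C).

(** Only the restriction of [phi] to [A] matters; equal cardinalities make it onto [A'], so no
    inverse is carried along. *)
Definition piso (A A' : {set T}) : Prop := exists phi : T -> T,
  [/\ {in A, forall x, phi x \in A'}, {in A &, injective phi}, #|A| = #|A'|,
      {in A &, forall x y, E x y = E' (phi x) (phi y)}
    & {in A, forall x, c' (phi x) = c x}].

Lemma inj_onto (A A' : {set T}) (phi : T -> T) :
  {in A, forall x, phi x \in A'} -> {in A &, injective phi} -> #|A'| <= #|A| ->
  forall y, y \in A' -> exists2 x, x \in A & phi x = y.
Proof.
move=> im inj le y Ay; have e : phi @: A = A'.
  apply/eqP; rewrite eqEcard (card_in_imset inj) le andbT.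
  by apply/subsetP => _ /imsetP [x Ax ->]; apply: im.
by move: Ay; rewrite -e => /imsetP [x Ax ->]; exists x.
Qed.

(** The middle map is inverted. In this way isomorphism types are compared using maps from the first
    graph to the second only. *)
Lemma piso_zigzag A B D F : piso A B -> piso D B -> piso D F -> piso A F.
Proof.
case=> [p1 [m1 i1 k1 e1 c1]] [p2 [m2 i2 k2 e2 c2]] [p3 [m3 i3 k3 e3 c3]].
pose q x := if [pick d in D | p2 d == p1 x] is Some d then d else x.
have qP x : x \in A -> q x \in D /\ p2 (q x) = p1 x.
  move=> Ax; rewrite /q; case: pickP => [d /andP [Dd /eqP pd] //|no].
  have [d Dd pd] := inj_onto m2 i2 (eq_leq (esym k2)) (m1 x Ax).
  by have := no d; rewrite Dd pd eqxx.
exists (p3 \o q); split.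
- by move=> x /qP [Dq _]; apply: m3.
- move=> x y Ax Ay /=; have [Dx ex] := qP x Ax; have [Dy ey] := qP y Ay.
  by move/(i3 _ _ Dx Dy) => qq; apply: i1 => //; rewrite -ex -ey qq.
- by rewrite k1 -k2 k3.
- move=> x y Ax Ay /=; have [Dx ex] := qP x Ax; have [Dy ey] := qP y Ay.
  by rewrite -e3 // [RHS]e2 // ex ey e1.
- move=> x Ax /=; have [Dx ex] := qP x Ax.
  by rewrite c3 // -c2 // ex c1.
Qed.

Variables (P P' : T -> {set T}).

(** [f] matches vertices with isomorphic parts but may tear a part apart. Being a bijection, it
    shows that both sides have equally many vertices in parts of each isomorphism type, hence
    equally many such parts. The induction removes [P x0] and [P' (f x0)] and repairs [f] on the
    rest. *)
Lemma glue_parts (S S' : {set T}) (f : T -> T) :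
  {in S, forall x, x \in P x} -> {in S, forall x, P x \subset S} ->
  {in S, forall x y, y \in P x -> P y = P x} ->
  {in S', forall x, x \in P' x} -> {in S', forall x, P' x \subset S'} ->
  {in S', forall x y, y \in P' x -> P' y = P' x} ->
  {in S, forall x, f x \in S'} -> {in S &, injective f} -> #|S| = #|S'| ->
  {in S, forall x, piso (P x) (P' (f x))} ->
  exists phi : T -> T,
    [/\ {in S, forall x, phi x \in S'}, {in S &, injective phi},
        {in S, forall x, c' (phi x) = c x},
        {in S, forall x y, y \in P x -> E x y = E' (phi x) (phi y)}
      & {in S &, forall x y, (y \in P x) = (phi y \in P' (phi x))}].
Proof.
have [n] := ubnP #|S|; elim: n S S' f => // n IH S S' f ltSn.
move=> refl sub cls refl' sub' cls' mf inf cS iso.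
have [S0|[x0 Sx0]] := set_0Vmem S.
  by exists id; split=> x; rewrite S0 inE.
set A := P x0; set A' := P' (f x0).
have [psi [mp ip kp ep cp]] : piso A A' := iso x0 Sx0.
have AS : A \subset S := sub x0 Sx0.
have Sfx0 := mf x0 Sx0.
have AS' : A' \subset S' := sub' _ Sfx0.
have Ax0 : x0 \in A := refl x0 Sx0.
(* The vertices whose part has the type of [A']. Only here does [f] need repair: [h] is an arbitrary
   bijection from [U :\: A] onto [U' :\: A']. *)
pose U := [set x in S | `[< piso (P x) A' >]].
have UP x : x \in S -> (x \in U) <-> piso (P x) A'.
  by move=> Sx; rewrite inE Sx /=; split=> [/asboolP|?]; last exact/asboolP.
have US : U \subset S by apply/subsetP => x; rewrite inE => /andP [].
have AU : A \subset U.
  apply/subsetP => x Ax; apply/UP; first exact: (subsetP AS).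
  by rewrite (cls x0 Sx0 x Ax); apply: iso.
pose U' := f @: U.
have infU : {in U &, injective f}.
  by move=> x y Ux Uy; apply: inf; apply: (subsetP US).
have A'U' : A' \subset U'.
  apply/subsetP => x' Ax'.
  have [y Sy fy] := inj_onto mf inf (eq_leq (esym cS)) (subsetP AS' x' Ax').
  apply/imsetP; exists y => //; apply/UP => //.
  by have := iso y Sy; rewrite fy (cls' _ Sfx0 x' Ax').
have kUA : #|U :\: A| = #|U' :\: A'|.
  by rewrite !cardsD (setIidPr AU) (setIidPr A'U') card_in_imset // kp.
pose h x := nth x0 (enum (U' :\: A')) (index x (enum (U :\: A))).
have idx x : x \in U :\: A -> index x (enum (U :\: A)) < size (enum (U' :\: A')).
  by move=> Ux; rewrite -cardE -kUA cardE index_mem mem_enum.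
have hm x : x \in U :\: A -> h x \in U' :\: A'.
  by move=> Ux; rewrite -mem_enum mem_nth // idx.
have hi : {in U :\: A &, injective h}.
  move=> x y Ux Uy /eqP; rewrite nth_uniq ?idx ?enum_uniq // => /eqP e.
  by rewrite -(nth_index x (_ : x \in enum (U :\: A))) ?mem_enum // e nth_index ?mem_enum.
pose f1 x := if x \in U then h x else f x.
have f1U x : x \in S :\: A -> x \in U -> x \in U :\: A.
  by rewrite !in_setD => /andP [-> _] ->.
have fN x : x \in S -> x \notin U -> f x \notin U'.
  move=> Sx; apply: contra => /imsetP [y Uy fxy].
  by rewrite (inf x y Sx (subsetP US y Uy) fxy).
have [|||||||||||phi1 [mph iph cph eph pph]] := IH (S :\: A) (S' :\: A') f1.
- rewrite -ltnS; apply: leq_trans ltSn; rewrite ltnS; apply: proper_card.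
  apply/properP; split; first exact: subsetDl.
  by exists x0; rewrite // in_setD Ax0.
- by move=> x /setDP [Sx _]; apply: refl.
- move=> x /setDP [Sx NAx]; apply/subsetP => y Py.
  rewrite in_setD (subsetP (sub x Sx) y Py) andbT.
  by apply: contra NAx => Ay; rewrite /A -(cls x0 Sx0 y Ay) (cls x Sx y Py) refl.
- by move=> x /setDP [Sx _]; apply: cls.
- by move=> x /setDP [Sx _]; apply: refl'.
- move=> x /setDP [Sx NAx]; apply/subsetP => y Py.
  rewrite in_setD (subsetP (sub' x Sx) y Py) andbT.
  by apply: contra NAx => Ay; rewrite /A' -(cls' _ Sfx0 y Ay) (cls' x Sx y Py) refl'.
- by move=> x /setDP [Sx _]; apply: cls'.
- move=> x SAx; rewrite /f1; case: (boolP (x \in U)) => Ux.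
    have /setDP [+ NA] := hm x (f1U x SAx Ux); rewrite in_setD NA => /imsetP [y Uy ->].
    by rewrite mf // (subsetP US).
  have Sx : x \in S by case/setDP: SAx.
  by rewrite in_setD mf // andbT; apply: contra (fN x Sx Ux); apply: (subsetP A'U').
- move=> x y SAx SAy; have /setDP [Sx _] := SAx; have /setDP [Sy _] := SAy.
  rewrite /f1; case: ifPn => Ux; case: ifPn => Uy.
  + by apply: hi; apply: f1U.
  + move=> e; case/negP: (fN y Sy Uy); rewrite -e.
    by case/setDP: (hm x (f1U x SAx Ux)).
  + move=> e; case/negP: (fN x Sx Ux); rewrite e.
    by case/setDP: (hm y (f1U y SAy Uy)).
  + exact: inf.
- by rewrite !cardsD (setIidPr AS) (setIidPr AS') cS kp.
- move=> x SAx; have /setDP [Sx _] := SAx; rewrite /f1; case: ifPn => Ux; last exact: iso.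
  have /setDP [/imsetP [y Uy hy] _] := hm x (f1U x SAx Ux).
  have Sy := subsetP US y Uy.
  (* [h x] is [f y] for some [y] in [U]; the parts of [x] and [y] are both isomorphic to [A'], and
     the part of [y] to that of [f y]. *)
  apply: (piso_zigzag (B := A') (D := P y)); first exact/(UP x Sx).
    exact/(UP y Sy).
  by rewrite hy; apply: iso.
pose phi x := if x \in A then psi x else phi1 x.
have phiA x : x \in A -> phi x = psi x by rewrite /phi => ->.
have phiN x : x \notin A -> phi x = phi1 x by rewrite /phi => /negbTE ->.
have inD x : x \in S -> x \notin A -> x \in S :\: A by rewrite in_setD => -> ->.
have PA x : x \in S -> x \notin A -> forall y, y \in P x -> y \notin A.
  move=> Sx NAx y Py; apply: contra NAx => Ay.
  by rewrite /A -(cls x0 Sx0 y Ay) (cls x Sx y Py) refl.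
exists phi; split.
- move=> x Sx; case: (boolP (x \in A)) => Ax.
    by rewrite phiA // (subsetP AS') // mp.
  by rewrite phiN //; case/setDP: (mph x (inD x Sx Ax)).
- move=> x y Sx Sy; case: (boolP (x \in A)) => Ax; case: (boolP (y \in A)) => Ay.
  + by rewrite (phiA x) // (phiA y) //; apply: ip.
  + rewrite (phiA x) // (phiN y) // => e; case/setDP: (mph y (inD y Sy Ay)) => _.
    by rewrite -e mp.
  + rewrite (phiN x) // (phiA y) // => e; case/setDP: (mph x (inD x Sx Ax)) => _.
    by rewrite e mp.
  + by rewrite (phiN x) // (phiN y) //; apply: iph; apply: inD.
- move=> x Sx; case: (boolP (x \in A)) => Ax; first by rewrite phiA // cp.
  by rewrite phiN // cph // inD.
- move=> x Sx y Py; case: (boolP (x \in A)) => Ax.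
    have Ay : y \in A by rewrite /A -(cls x0 Sx0 x Ax).
    by rewrite (phiA x) // (phiA y) // ep.
  have Ay := PA x Sx Ax y Py; rewrite (phiN x) // (phiN y) //.
  by apply: eph => //; apply: inD.
- move=> x y Sx Sy; case: (boolP (x \in A)) => Ax; case: (boolP (y \in A)) => Ay.
  + rewrite (phiA x) // (phiA y) // (cls x0 Sx0 x Ax) -/A Ay.
    by rewrite (cls' _ Sfx0 _ (mp x Ax)) -/A' mp.
  + rewrite (phiA x) // (phiN y) // (cls x0 Sx0 x Ax) -/A (negbTE Ay).
    rewrite (cls' _ Sfx0 _ (mp x Ax)) -/A'.
    by case/setDP: (mph y (inD y Sy Ay)) => _ /negbTE ->.
  + rewrite (phiN x) // (phiA y) //.
    have -> : (y \in P x) = false by apply: contraTF Ay; apply: PA.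
    case/setDP: (mph x (inD x Sx Ax)) => Sx1 Nx1; apply/esym/negbTE.
    apply: contra Nx1 => hx; rewrite /A' -(cls' _ Sfx0 _ (mp y Ay)).
    by rewrite (cls' _ Sx1 _ hx) refl'.
  + by rewrite (phiN x) // (phiN y) // pph // inD.
Qed.

End PartialIso.

(** * Regions and their partition at a rim *)

Section Regions.
Variables (T : finType) (E : rel T) (r : T).
Implicit Types (ou : option T).

Definition region (q : T) ou : {set T} :=
  bush E r q :\: (if ou is Some u then bush E r u else set0).

Definition ocnt ou (y : T) : nat := if ou is Some u then cnt E r u y else 0.

(** What an isomorphism must preserve for gluing: [depth] and [up] decide edges that enter the
    region from above, [ocnt] those to the bush cut off below. *)
Definition color ou (x : T) : nat * nat * nat := (depth E r x, up E r x, ocnt ou x).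

Definition inside ou (w : T) : bool := if ou is Some u then u \in descent E r w else true.

Definition narrow ou (z : T) : option T :=
  if ou is Some u then if u \in descent E r z then Some u else None else None.

Definition split_color (w : T) ou (x : T) :=
  (color ou x, E w x,
   if depth E r x == depth E r w then (cin E r w x, cout E r w x) else (0, 0)).

Definition part (w : T) ou (x : T) : {set T} :=
  if depth E r x == depth E r w then [set x]
  else [set y in region w ou |
         [exists z in top E r w, (x \in bush E r z) && (y \in bush E r z)]].

Definition rim_top_rule (w q x : T) : bool :=
  if E w x then cin_rank E r w (cin E r w q) < up E r x
  else cout_rank E r w (cout E r w q) < up E r x.

(** A table of the edges between different parts, read off from split colors. The entries [true]
    come from cliques: the rim, the children of [w], and the tops not adjacent to [w]. *)
Definition part_rule (w x y : T) : bool :=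
  if depth E r x == depth E r w then
    if depth E r y == depth E r w then true
    else if depth E r y == (depth E r w).+1 then rim_top_rule w x y else false
  else if depth E r y == depth E r w then
    if depth E r x == (depth E r w).+1 then rim_top_rule w y x else false
  else if (depth E r x == (depth E r w).+1) && (depth E r y == (depth E r w).+1)
  then if E w x then if E w y then true else up E r x == #|rim E r w|
       else if E w y then up E r y == #|rim E r w| else true
  else false.

Hypothesis R : rooted E r.
Local Notation symE := (rooted_sym R).
Local Notation depth := (depth E r).
Local Notation K := (descent E r).
Local Notation Q := (rim E r).
Local Notation J := (bush E r).
Local Notation X := (top E r).

Lemma region_bush q ou : region q ou \subset J q.
Proof. exact: subsetDl. Qed.

Lemma cnt_outside w u x : u \in K w -> x \notin J w -> cnt E r u x = 0.
Proof.
move=> Ku NJx; apply: eq_card0 => t; rewrite inE; apply/negbTE/negP => /andP [Qt Ext].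
case/negP: NJx; have Kt : t \in K w.
  by apply: (subsetP (bush_sub_descent R Ku)); rewrite in_setU Qt.
by apply: (K_nbr_bush R Kt); rewrite symE.
Qed.

Lemma region_split q w ou : w \in K q -> inside ou w ->
  region q ou = region q (Some w) :|: region w ou.
Proof.
move=> Kw iw; have sub : J w \subset J q.
  by apply: (bush_sub R); rewrite in_setU Kw orbT.
apply/setP => x; rewrite in_setU !in_setD.
have [Jw|NJw] := boolP (x \in J w); first by rewrite (subsetP sub x Jw).
rewrite /= andbF orbF; case: ou iw => [u|_]; last by rewrite inE.
move=> /= Ku; rewrite (contra _ NJw) //; apply: subsetP.
by apply: (bush_sub R); rewrite in_setU Ku orbT.
Qed.

Section OneLevel.
Variables (w : T) (ou : option T).
Hypothesis iw : inside ou w.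

Lemma narrow_disjoint z x u : ou = Some u -> z \in X w -> x \in J z ->
  x \in region w ou -> u \notin K z -> u \notin J z /\ [disjoint J z & J u].
Proof.
move=> eu Xz Jx; have := iw; rewrite eu in_setD => Ku /andP [NJx _] NKu.
have NJu : u \notin J z.
  rewrite in_setU negb_or NKu andbT; apply: contra NJx => Qu.
  by rewrite (J_eq R Qu).
split=> //; apply/pred0P => y /=; apply/negbTE/negP => /andP [Jy Juy].
have [z2 Xz2 Jz2] := descent_top R Ku.
have Jz2y : y \in J z2 by rewrite (subsetP (bush_sub R Jz2)).
have [_ dz] := topP Xz; have [_ dz2] := topP Xz2.
by case/negP: NJu; rewrite (bush_meet R _ Jy Jz2y) // dz dz2.
Qed.

Lemma region_top z x : z \in X w -> x \in J z -> x \in region w ou ->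
  region z (narrow ou z) = region w ou :&: J z.
Proof.
move=> Xz Jx Rx; have sub := bush_sub R (top_bush Xz).
apply/setP => y; rewrite in_setI !in_setD.
have [Jy|NJy] := boolP (y \in J z); last by rewrite !andbF.
rewrite (subsetP sub y Jy) !andbT /narrow.
case eu : ou => [u|//]; have [//|NKu] := boolP (u \in K z).
have [_ dis] := narrow_disjoint eu Xz Jx Rx NKu.
by rewrite inE (disjointFr dis Jy).
Qed.

Lemma part_top z x : z \in X w -> x \in J z -> x \in region w ou ->
  part w ou x = region z (narrow ou z).
Proof.
move=> Xz Jx Rx; rewrite (region_top Xz Jx Rx) /part.
have [_ dz] := topP Xz; have dx := J_depth Jx.
rewrite gtn_eqF; last by rewrite -dz.
apply/setP => y; rewrite inE in_setI; congr andb.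
apply/exists_inP/idP => [[z' Xz' /andP [Jz'x Jz'y]]|Jy]; last by exists z; rewrite ?Jx.
by have [_ dz'] := topP Xz'; rewrite (bush_meet R _ Jx Jz'x) // dz dz'.
Qed.

Lemma region_cases x : x \in region w ou ->
  (depth x = depth w /\ x \in Q w) \/ (depth x != depth w /\
   exists z, [/\ z \in X w, x \in J z & part w ou x = region z (narrow ou z)]).
Proof.
move=> Rx; have Jx := subsetP (region_bush w ou) x Rx.
have [dx|dx] := eqVneq (depth x) (depth w); first by left; rewrite (J_rim Jx dx).
right; split=> //; have Kx : x \in K w.
  by apply: (J_descent Jx); rewrite ltn_neqAle eq_sym dx (J_depth Jx).
have [z Xz Jz] := descent_top R Kx; exists z; split=> //.
exact: part_top.
Qed.

Lemma part_rim x : depth x = depth w -> part w ou x = [set x].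
Proof. by rewrite /part => ->; rewrite eqxx. Qed.

Lemma part_refl : {in region w ou, forall x, x \in part w ou x}.
Proof.
move=> x Rx; have [[dx _]|[_ [z [Xz Jz ->]]]] := region_cases Rx.
  by rewrite part_rim // inE.
by rewrite (region_top Xz Jz Rx) in_setI Rx.
Qed.

Lemma part_sub : {in region w ou, forall x, part w ou x \subset region w ou}.
Proof.
move=> x Rx; have [[dx _]|[_ [z [Xz Jz ->]]]] := region_cases Rx.
  by rewrite part_rim // sub1set.
by rewrite (region_top Xz Jz Rx) subsetIl.
Qed.

Lemma part_eq : {in region w ou, forall x y, y \in part w ou x -> part w ou y = part w ou x}.
Proof.
move=> x Rx y; have [[dx _]|[_ [z [Xz Jz ->]]]] := region_cases Rx.
  by rewrite part_rim // inE => /eqP ->; rewrite part_rim.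
rewrite (region_top Xz Jz Rx) in_setI => /andP [Ry Jy].
by rewrite (part_top Xz Jy Ry) (region_top Xz Jz Rx).
Qed.

(** Inside a part the split color follows from the color for the narrowed boundary and from data of
    the top [z]: adjacency to [w] is constant on [rim z] by [rim_uniform], and a boundary [u] not
    below [z] is handled by [sibling_cnt]. *)
Lemma part_color z y : widest E r w -> z \in X w -> y \in region w ou ->
  y \in J z ->
  split_color w ou y =
  (depth y, up E r y,
   (if narrow ou z is Some u then cnt E r u y
    else if ou is Some u then
      if (depth y == depth z) && E z u then #|Q u| else 0 else 0),
   (depth y == (depth w).+1) && E w z, (0, 0)).
Proof.
move=> ww Xz Ry Jy; have [Kz dz] := topP Xz; have dy := J_depth Jy.
rewrite /split_color /color gtn_eqF -?dz //; congr (_, _, _, _, _).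
  rewrite /ocnt /narrow; case eu : ou => [u|//].
  have [//|NKu] := boolP (u \in K z).
  have [NJu _] := narrow_disjoint eu Xz Jy Ry NKu.
  apply: sibling_cnt => //; rewrite dz; apply: K_depth.
  by have := iw; rewrite eu.
have [dyz|ndy] := eqVneq (depth y) (depth z).
  by rewrite (rim_uniform R ww Xz (J_rim Jy dyz)).
apply/negbTE/(far_nonadj (r := r)); rewrite -dz ltn_neqAle eq_sym ndy.
exact: J_depth.
Qed.

(** An edge with an end deeper than the tops stays inside a part, unless its other end is in the
    rim, where the depths exclude it. The remaining pairs are covered by the lemmas on rims and
    tops. *)
Lemma part_edge x y : widest E r w -> x \in region w ou -> y \in region w ou ->
  y \notin part w ou x -> E x y = part_rule w x y.
Proof.
move=> ww Rx Ry Npy; have nxy : x != y by apply: contraNneq Npy => <-; apply: part_refl.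
have Qw := Q_refl E r w.
have deep a b : a \in region w ou -> b \in region w ou -> b \notin part w ou a ->
    (depth w).+1 < depth a \/ (depth w).+1 < depth b -> depth a != depth w ->
    E a b = false.
  move=> Ra Rb Npb dd da; apply/negbTE; apply: contra Npb => Eab.
  have [[/eqP]|[_ [z [Xz Jz ->]]]] := region_cases Ra; first by rewrite (negbTE da).
  have [Kz dz] := topP Xz.
  rewrite (region_top Xz Jz Ra) in_setI Rb /=.
  case: dd => [da2|db2].
    by apply: (K_nbr_bush R) Eab; apply: (J_descent Jz); rewrite dz.
  have [Kaz|NKaz] := boolP (a \in K z); first exact: (K_nbr_bush R Kaz).
  have Qaz : a \in Q z by move: Jz; rewrite in_setU (negbTE NKaz) orbF.
  rewrite in_setU -(Q_K R Qaz) ch_K ?orbT // mem_ch //.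
  by have := depth_adj r Eab; rewrite (Q_depth Qaz) dz; clear -db2; lia.
have inX a : a \in region w ou -> depth a = (depth w).+1 -> a \in X w.
  move=> Ra da; rewrite inE da eqxx andbT; apply: J_descent; last by rewrite da.
  exact: (subsetP (region_bush w ou)).
have deepN a : a \in region w ou -> depth a != depth w -> depth a != (depth w).+1 ->
    (depth w).+1 < depth a.
  move=> Ra; have := J_depth (subsetP (region_bush w ou) a Ra).
  by clear; lia.
rewrite /part_rule; case: (eqVneq (depth x) (depth w)) => dx.
  have Qx : x \in Q w by apply: J_rim dx; apply: (subsetP (region_bush w ou)).
  case: (eqVneq (depth y) (depth w)) => dy.
    apply: (Q_clique R (w := w)) => //; apply: J_rim dy.
    exact: (subsetP (region_bush w ou)).
  case: (eqVneq (depth y) (depth w).+1) => dy1.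
    by rewrite (rim_top_edge R Qx (inX y Ry dy1)).
  by apply/negbTE/(far_nonadj (r := r)); rewrite dx; apply: deepN.
have Npx : x \notin part w ou y.
  by apply: contra Npy => px; rewrite (part_eq Ry px) part_refl.
case: (eqVneq (depth y) (depth w)) => dy.
  have Qy : y \in Q w by apply: J_rim dy; apply: (subsetP (region_bush w ou)).
  case: (eqVneq (depth x) (depth w).+1) => dx1.
    by rewrite symE (rim_top_edge R Qy (inX x Rx dx1)).
  by rewrite symE; apply/negbTE/(far_nonadj (r := r)); rewrite dy; apply: deepN.
case: (eqVneq (depth x) (depth w).+1) => dx1 /=; last first.
  by apply: deep => //; left; apply: deepN.
case: (eqVneq (depth y) (depth w).+1) => dy1 /=; last first.
  by apply: deep => //; right; apply: deepN.
have Xx := inX x Rx dx1; have Xy := inX y Ry dy1.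
case: ifPn => Ewx; case: ifPn => Ewy.
- by apply: (ch_clique R (w := w)); rewrite // -(edge_ch Qw).
- exact: (mixed_edge R (w := w)).
- by rewrite symE; apply: (mixed_edge R (w := w)).
- exact: (top_out_clique R (w := w)).
Qed.

End OneLevel.
End Regions.

(** * Isomorphisms between regions of two graphs *)

Section TwoGraphs.
Variables (T : finType) (E E' : rel T) (r r' : T).
Hypotheses (R : rooted E r) (R' : rooted E' r').

Definition riso q ou q' ou' : Prop :=
  piso E E' (color E r ou) (color E' r' ou') (region E r q ou) (region E' r' q' ou').

(** [bush_edge] determines the edges across the cut at [w]: the upper piece has [w] as its lower
    boundary, so its color records the count towards [rim w], and the color of the lower piece
    records [up]. *)
Lemma riso_chain q w ou q' w' ou' :
  w \in descent E r q -> w' \in descent E' r' q' ->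
  inside E r ou w -> inside E' r' ou' w' -> isSome ou = isSome ou' ->
  depth E r w = depth E' r' w' ->
  (forall t, entry_rank E r w t = entry_rank E' r' w' t) ->
  riso q (Some w) q' (Some w') -> riso w ou w' ou' -> riso q ou q' ou'.
Proof.
move=> Kw Kw' iw iw' so dw rank [p1 [m1 i1 k1 e1 c1]] [p2 [m2 i2 k2 e2 c2]].
pose J := bush E r w; pose J' := bush E' r' w'.
pose phi x := if x \in J then p2 x else p1 x.
have s1 x : x \in region E r q (Some w) -> x \notin J by case/setDP.
have s2 x : x \in region E r w ou -> x \in J.
  exact: (subsetP (region_bush _ _ _ _)).
have s1' x : x \in region E' r' q' (Some w') -> x \notin J' by case/setDP.
have s2' x : x \in region E' r' w' ou' -> x \in J'.
  exact: (subsetP (region_bush _ _ _ _)).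
have phi1 x : x \in region E r q (Some w) -> phi x = p1 x.
  by move=> /s1; rewrite /phi => /negbTE ->.
have phi2 x : x \in region E r w ou -> phi x = p2 x by move=> /s2; rewrite /phi => ->.
have sp := region_split R Kw iw; have sp' := region_split R' Kw' iw'.
have crossE x y : x \in region E r q (Some w) -> y \in region E r w ou ->
    E x y = E' (p1 x) (p2 y).
  move=> Rx Ry; rewrite (bush_edge R (s1 x Rx) (s2 y Ry)).
  rewrite (bush_edge R' (s1' _ (m1 x Rx)) (s2' _ (m2 y Ry))) /cross.
  have [dx _ cx] := c1 x Rx; have [dy uy _] := c2 y Ry.
  by rewrite dx dy uy dw; rewrite /= in cx; rewrite cx rank.
have dis (A B B0 : {set T}) : (forall x, x \in A -> x \notin B0) ->
    (forall x, x \in B -> x \in B0) -> #|A :|: B| = #|A| + #|B|.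
  move=> h1 h2; rewrite cardsU (_ : A :&: B = set0) ?cards0 ?subn0 //.
  by apply/setP => x; rewrite !inE; apply/negbTE/negP => /andP [/h1 /negP h /h2].
rewrite /riso sp sp'; exists phi; split.
- move=> x /setUP [Rx|Rx]; rewrite in_setU; first by rewrite phi1 // m1.
  by rewrite phi2 // m2 ?orbT.
- move=> x y /setUP [Rx|Rx] /setUP [Ry|Ry].
  + by rewrite !phi1 //; apply: i1.
  + rewrite phi1 // phi2 // => e; have := s1' _ (m1 x Rx).
    by rewrite e (s2' _ (m2 y Ry)).
  + rewrite phi2 // phi1 // => e; have := s1' _ (m1 y Ry).
    by rewrite -e (s2' _ (m2 x Rx)).
  + by rewrite !phi2 //; apply: i2.
- by rewrite (dis _ _ J s1 s2) (dis _ _ J' s1' s2') k1 k2.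
- move=> x y /setUP [Rx|Rx] /setUP [Ry|Ry].
  + by rewrite !phi1 // e1.
  + by rewrite phi1 // phi2 // crossE.
  + by rewrite phi2 // phi1 // (rooted_sym R) (rooted_sym R') crossE.
  + by rewrite !phi2 // e2.
- move=> x /setUP [Rx|Rx]; last by rewrite phi2 // c2.
  rewrite phi1 //; have [dx ux _] := c1 x Rx; rewrite /color dx ux; congr (_, _, _).
  (* For the old boundary [u] below [w], vertices outside the bush of [w] have no neighbour in
     [rim u]. *)
  rewrite /ocnt; case: ou ou' so iw iw' {m2 i2 k2 e2 c2 s2 s2' phi2 sp sp' crossE}
    => [u|] [u'|] //= _ Ku Ku'.
  by rewrite (cnt_outside R Ku (s1 x Rx)) (cnt_outside R' Ku' (s1' _ (m1 x Rx))).
Qed.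

Lemma riso_rim q w ou q' w' ou' : w \in rim E r q -> w' \in rim E' r' q' ->
  riso w ou w' ou' -> riso q ou q' ou'.
Proof. by move=> Qw Qw'; rewrite /riso /region (J_eq R Qw) (J_eq R' Qw'). Qed.

(** In its use, [f] is the duplicator's answer to a single move. Parts need to be isomorphic only
    with respect to their narrowed boundaries: [part_color] recovers the split colors that
    [glue_parts] preserves, and [part_edge] the edges between parts. *)
Lemma riso_split w ou w' ou' (f : T -> T) :
  widest E r w -> widest E' r' w' -> inside E r ou w -> inside E' r' ou' w' ->
  isSome ou = isSome ou' -> depth E r w = depth E' r' w' ->
  #|rim E r w| = #|rim E' r' w'| ->
  (forall t, cin_rank E r w t = cin_rank E' r' w' t) ->
  (forall t, cout_rank E r w t = cout_rank E' r' w' t) ->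
  (forall u u', ou = Some u -> ou' = Some u' -> #|rim E r u| = #|rim E' r' u'|) ->
  injective f -> (forall x, (x \in region E r w ou) = (f x \in region E' r' w' ou')) ->
  (forall x, x \in region E r w ou -> depth E r x = depth E r w ->
     split_color E' r' w' ou' (f x) = split_color E r w ou x) ->
  (forall x, x \in region E r w ou -> depth E r x != depth E r w -> exists z z',
     [/\ z \in top E r w, z' \in top E' r' w', x \in bush E r z, f x \in bush E' r' z' &
     [/\ riso z (narrow E r ou z) z' (narrow E' r' ou' z'), E w z = E' w' z' &
        forall u u', ou = Some u -> ou' = Some u' ->
          (u \in descent E r z) = (u' \in descent E' r' z') /\ E z u = E' z' u']]) ->
  riso w ou w' ou'.
Proof.
move=> ww ww' iw iw' so dw Qw cinw coutw Qu injf regf rimf topf.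
have [|||||||||| phi [mp ip cp ep pp]] := @glue_parts T E E' _
    (split_color E r w ou) (split_color E' r' w' ou') (part E r w ou)
    (part E' r' w' ou') (region E r w ou) (region E' r' w' ou') f.
- exact: part_refl.
- exact: part_sub.
- exact: part_eq.
- exact: part_refl.
- exact: part_sub.
- exact: part_eq.
- by move=> x; rewrite regf.
- by move=> x y _ _; apply: injf.
- have <- : f @^-1: region E' r' w' ou' = region E r w ou.
    by apply/setP => x; rewrite inE regf.
  rewrite on_card_preimset //; apply: onW_bij; exact: injF_bij.
- move=> x Rx; have Rfx : f x \in region E' r' w' ou' by rewrite -regf.
  have [dx|ndx] := eqVneq (depth E r x) (depth E r w).
    have dfx : depth E' r' (f x) = depth E' r' w'.
      by have [-> _ _] := rimf x Rx dx; rewrite dx dw.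
    rewrite part_rim // part_rim //; exists f; split.
    + by move=> y /set1P ->; rewrite inE.
    + by move=> y z _ _; apply: injf.
    + by rewrite !cards1.
    + by move=> y z /set1P -> /set1P ->; rewrite (rooted_irr R) (rooted_irr R').
    + by move=> y /set1P ->; apply: rimf.
  have [z [z' [Xz Xz' Jz Jz' [iso wz uz]]]] := topf x Rx ndx.
  rewrite (part_top R iw Xz Jz Rx) (part_top R' iw' Xz' Jz' Rfx).
  case: iso => p [m i k e c]; exists p.
  split; [exact: m | exact: i | exact: k | exact: e | move=> y Ry].
  have sub : region E r z (narrow E r ou z) \subset region E r w ou.
    by rewrite (region_top R iw Xz Jz Rx) subsetIl.
  have sub' : region E' r' z' (narrow E' r' ou' z') \subset region E' r' w' ou'.
    by rewrite (region_top R' iw' Xz' Jz' Rfx) subsetIl.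
  have Jy := subsetP (region_bush E r z _) y Ry.
  have Jy' := subsetP (region_bush E' r' z' _) _ (m y Ry).
  rewrite (part_color R iw ww Xz (subsetP sub y Ry) Jy).
  rewrite (part_color R' iw' ww' Xz' (subsetP sub' _ (m y Ry)) Jy').
  have [dy uy oc] := c y Ry; have [_ dz] := topP Xz; have [_ dz'] := topP Xz'.
  rewrite dy uy dz dz' dw wz; congr (_, _, _, _, _).
  move: so Qu uz oc; clear.
  case: ou ou' => [u|] [u'|]; [move=> _ Qu uz | by [] | by [] | by []].
  rewrite /narrow; have [-> Euz] := uz u u' erefl erefl.
  by case: ifP => _; [exact | rewrite Euz (Qu u u')].
exists phi; split; [exact: mp | exact: ip | | |].
- have <- : f @^-1: region E' r' w' ou' = region E r w ou.
    by apply/setP => x; rewrite inE regf.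
  rewrite on_card_preimset //; apply: onW_bij; exact: injF_bij.
- move=> x y Rx Ry; have [py|npy] := boolP (y \in part E r w ou x); first exact: ep.
  have npy' : phi y \notin part E' r' w' ou' (phi x) by rewrite -pp.
  rewrite (part_edge R iw ww Rx Ry npy).
  rewrite (part_edge R' iw' ww' (mp x Rx) (mp y Ry) npy').
  have [dx ux _ wx cx] := cp x Rx; have [dy uy _ wy cy] := cp y Ry.
  rewrite /part_rule /rim_top_rule dx ux wx dy uy wy -Qw -dw in cx cy *.
  have cinx : depth E r x = depth E r w ->
     cin_rank E' r' w' (cin E' r' w' (phi x)) = cin_rank E r w (cin E r w x) /\
     cout_rank E' r' w' (cout E' r' w' (phi x)) = cout_rank E r w (cout E r w x).
    by move=> e; move: cx; rewrite e eqxx => -[-> ->]; rewrite cinw coutw.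
  have ciny : depth E r y = depth E r w ->
     cin_rank E' r' w' (cin E' r' w' (phi y)) = cin_rank E r w (cin E r w y) /\
     cout_rank E' r' w' (cout E' r' w' (phi y)) = cout_rank E r w (cout E r w y).
    by move=> e; move: cy; rewrite e eqxx => -[-> ->]; rewrite cinw coutw.
  case: (eqVneq (depth E r x)) => ex; last case: (eqVneq (depth E r y)) => ey //.
  + by have [-> ->] := cinx ex.
  + by have [-> ->] := ciny ey.
- by move=> x Rx; have [] := cp x Rx; rewrite /color => -> -> ->.
Qed.

End TwoGraphs.

(** * Counting formulas and the bijective pebble game *)

Lemma equal_fibers (T : finType) (L : Type) (a b : T -> L) :
  (forall v, #|[set w | `[< a w = a v >]]| = #|[set w | `[< b w = a v >]]|) ->
  exists2 f : T -> T, injective f & forall v, b (f v) = a v.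
Proof.
move=> fib; pose A v := enum [set w | `[< a w = a v >]].
pose B v := enum [set w | `[< b w = a v >]].
have Av v : v \in A v by rewrite mem_enum inE; apply/asboolP.
pose f v := nth v (B v) (index v (A v)).
have idx v : index v (A v) < size (B v) by rewrite -cardE -fib cardE index_mem Av.
have bf v : b (f v) = a v.
  by have := mem_nth v (idx v); rewrite mem_enum inE => /asboolP.
exists f => // v w fvw; have avw : a v = a w by rewrite -!bf fvw.
have AA : A v = A w by rewrite /A avw.
have BB : B v = B w by rewrite /B avw.
move: fvw; rewrite /f (set_nth_default v) ?idx // -BB => /eqP.
rewrite nth_uniq ?enum_uniq ?idx // -?AA; last by rewrite BB AA idx.
by move=> /eqP e; rewrite -(nth_index v (Av v)) e nth_index // AA Av.
Qed.

Lemma injection_card (T : finType) (A : T -> Prop) m :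
  (exists2 g : 'I_m -> T, injective g & forall a, A (g a)) <->
  m <= #|[set v | `[< A v >]]|.
Proof.
split=> [[g injg Ag]|le_m].
  rewrite -[m]card_ord -(card_imset _ injg); apply: subset_leq_card.
  by apply/subsetP => _ /imsetP [i _ ->]; rewrite inE; apply/asboolP.
exists (fun i => enum_val (widen_ord le_m i)).
  by move=> i j /enum_val_inj /(congr1 val) /= ij; apply: val_inj.
by move=> i; have := enum_valP (widen_ord le_m i); rewrite inE => /asboolP.
Qed.

Section Separation.
Variables (T : finType) (F : formula -> Prop) (ev1 ev2 : T -> formula -> Prop).
Variable (truth : formula).
Hypotheses (FN : forall phi, F phi -> F (FNot phi)).
Hypotheses (FA : forall phi psi, F phi -> F psi -> F (FAnd phi psi)).
Hypotheses (ev1N : forall v phi, ev1 v (FNot phi) <-> ~ ev1 v phi).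
Hypotheses (ev2N : forall v phi, ev2 v (FNot phi) <-> ~ ev2 v phi).
Hypotheses (ev1A : forall v phi psi, ev1 v (FAnd phi psi) <-> ev1 v phi /\ ev1 v psi).
Hypotheses (ev2A : forall v phi psi, ev2 v (FAnd phi psi) <-> ev2 v phi /\ ev2 v psi).
Hypotheses (Ftruth : F truth) (ev1t : forall v, ev1 v truth) (ev2t : forall v, ev2 v truth).
Hypothesis (count : forall phi, F phi ->
  #|[set v | `[< ev1 v phi >]]| = #|[set v | `[< ev2 v phi >]]|).

(* A vertex is isolated, up to equivalence, by the conjunction of finitely many
   formulas, one against each inequivalent vertex of either graph. *)
Lemma counting_bijection :
  exists2 f : T -> T, injective f & forall v phi, F phi -> ev1 v phi <-> ev2 (f v) phi.
Proof.
pose a v phi := F phi /\ ev1 v phi; pose b v phi := F phi /\ ev2 v phi.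
pose ev (p : T * bool) := if p.2 then ev1 p.1 else ev2 p.1.
pose lab (p : T * bool) phi := F phi /\ ev p phi.
have evN p phi : ev p (FNot phi) <-> ~ ev p phi by rewrite /ev; case: p.2.
have evA p phi psi : ev p (FAnd phi psi) <-> ev p phi /\ ev p psi.
  by rewrite /ev; case: p.2.
have evt p : ev p truth by rewrite /ev; case: p.2.
have sepP v p : exists psi, [/\ F psi, ev (v, true) psi
                              & lab p <> lab (v, true) -> ~ ev p psi].
  have [eq|ne] := pselect (lab p = lab (v, true)); first by exists truth.
  apply: contra_notP ne => nopsi; apply/funext => phi; apply/propext.
  have h psi : F psi -> ev (v, true) psi -> ev p psi.
    move=> Fpsi vpsi; apply: contra_notP nopsi => npsi.
    by exists psi; split.
  split=> -[Fphi]; last by move=> vphi; split=> //; apply: h.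
  move=> pphi; split=> //; apply: contrapT => /evN/(h _ (FN Fphi)).
  by move=> /evN.
have [f injf fP] : exists2 f : T -> T, injective f & forall v, b (f v) = a v.
  apply: equal_fibers => v; have [psi psiP] := choice (sepP v).
  pose theta := foldr (fun p th => FAnd (psi p) th) truth (enum {: T * bool}).
  have Ftheta : F theta.
    rewrite /theta; elim: (enum _) => [|p s IH] //=.
    by apply: FA => //; have [] := psiP p.
  have theta_ev q : ev q theta <-> forall p, ev q (psi p).
    have : ev q theta <-> forall p, p \in enum {: T * bool} -> ev q (psi p).
      rewrite /theta; elim: (enum _) => [|p s IH] /=; first by split.
      rewrite evA IH; split=> [[h1 h2] x|h].
        by rewrite inE => /orP [/eqP ->|/h2].
      split; first by apply: h; rewrite inE eqxx.
      by move=> x xs; apply: h; rewrite inE xs orbT.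
    by case=> h1 h2; split=> [/h1 h p|h]; [apply: h; rewrite mem_enum|apply: h2].
  have iso q : ev q theta <-> lab q = lab (v, true).
    split=> [/theta_ev h|eq].
      have [//|ne] := pselect (lab q = lab (v, true)).
      by have [_ _ /(_ ne)] := psiP q; case.
    apply/theta_ev => p; have [Fp vp _] := psiP p.
    have : lab (v, true) (psi p) by split.
    by rewrite -eq => -[].
  have := count Ftheta.
  have -> : [set w | `[< ev1 w theta >]] = [set w | `[< a w = a v >]].
    apply/setP => w; rewrite !inE; apply/asboolP/asboolP; 
      [exact: (proj1 (iso (w, true))) | exact: (proj2 (iso (w, true)))].
  have -> // : [set w | `[< ev2 w theta >]] = [set w | `[< b w = a v >]].
  apply/setP => w; rewrite !inE; apply/asboolP/asboolP; 
      [exact: (proj1 (iso (w, false))) | exact: (proj2 (iso (w, false)))].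
exists f => // v phi Fphi; have := congr1 (fun l => l phi) (fP v).
rewrite /a /b => e; split=> h.
  by have [] : F phi /\ ev2 (f v) phi by rewrite e.
by have [] : F phi /\ ev1 v phi by rewrite -e.
Qed.

End Separation.

Definition upd (T : Type) (s : nat -> T) (i : nat) (v : T) : nat -> T :=
  fun j => if j == i then v else s j.

Section Game.
Variables (T : finType) (E1 E2 : rel T) (k : nat).

(** The duplicator wins [m] rounds of the bijective [k]-pebble game: [f] is fixed before the spoiler
    picks [v]. All pebbles are always on the board, so [s] and [t] are total. The conjunct
    [eqv m' s t] makes the relation monotone ([eqv_leq]). *)
Fixpoint eqv (m : nat) (s t : nat -> T) : Prop :=
  if m is m'.+1 then
    eqv m' s t /\ forall i, i < k ->
      exists2 f : T -> T, injective f & forall v, eqv m' (upd s i v) (upd t i (f v))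
  else forall i j, i < k -> j < k ->
      ((s i == s j) = (t i == t j)) /\ E1 (s i) (s j) = E2 (t i) (t j).

Definition total (G : graph) (s : nat -> G) : assignment G := fun i => Some (s i).

Lemma update_total (G : graph) (s : nat -> G) i v :
  update (total s) i v = total (upd s i v).
Proof. by apply/funext => j; rewrite /update /total /upd; case: eqP. Qed.

(** The quantifiers [FExGe c i phi] for all [c] fix the number of values satisfying [phi];
    [counting_bijection] turns these equal numbers into a move of the duplicator. *)
Lemma eqv_formulas m s t :
  (forall phi, in_C k phi -> qdepth phi <= m ->
     sat (G := as_graph E1) (total s) phi <-> sat (G := as_graph E2) (total t) phi) ->
  eqv m s t.
Proof.
elim: m s t => [|m IH] s t H.
  move=> i j ik jk; split.
    have := H (FEq i j); rewrite /= ik jk => /(_ isT isT) h.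
    apply/eqP/eqP => e.
      have /h [u [v [[<-] [<-] ->]]] // : exists u v : T,
        [/\ total (G := as_graph E1) s i = Some u, total (G := as_graph E1) s j = Some v & u = v].
      by exists (s i), (s j).
    have /h [u [v [[<-] [<-] ->]]] // : exists u v : T,
        [/\ total (G := as_graph E2) t i = Some u, total (G := as_graph E2) t j = Some v & u = v].
    by exists (t i), (t j).
  have := H (FEdge i j); rewrite /= ik jk => /(_ isT isT) h.
  apply/idP/idP => e.
    have /h [u [v [[<-] [<-] //]]] : exists u v : T,
      [/\ total (G := as_graph E1) s i = Some u, total (G := as_graph E1) s j = Some v & E1 u v].
    by exists (s i), (s j).
  have /h [u [v [[<-] [<-] //]]] : exists u v : T,
      [/\ total (G := as_graph E2) t i = Some u, total (G := as_graph E2) t j = Some v & E2 u v].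
  by exists (t i), (t j).
split; first by apply: IH => phi kphi /leqW; apply: H.
move=> i ik; pose F phi := in_C k phi /\ qdepth phi <= m.
pose a := FEq i i; pose truth := FNot (FAnd a (FNot a)).
have [||||||||||f injf fP] := @counting_bijection T F
   (fun v phi => sat (G := as_graph E1) (total (upd s i v)) phi)
   (fun v phi => sat (G := as_graph E2) (total (upd t i v)) phi) truth => //.
- by move=> phi psi [h1 h2] [h3 h4]; split; rewrite /= ?h1 // geq_max h2.
- by split; rewrite //= ik.
- by move=> v /=; tauto.
- by move=> v /=; tauto.
- move=> phi [kphi dphi]; apply/eqP; rewrite eqn_leq.
  have iff c : sat (G := as_graph E1) (total s) (FExGe c i phi) <->
      sat (G := as_graph E2) (total t) (FExGe c i phi) by apply: H; rewrite /= ?ik.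
  have e1 c : sat (G := as_graph E1) (total s) (FExGe c i phi) <->
      c <= #|[set v | `[< sat (G := as_graph E1) (total (upd s i v)) phi >]]|.
    rewrite -injection_card /=; split=> -[g h1 h2]; exists g => // x; have := h2 x;
      by rewrite update_total.
  have e2 c : sat (G := as_graph E2) (total t) (FExGe c i phi) <->
      c <= #|[set v | `[< sat (G := as_graph E2) (total (upd t i v)) phi >]]|.
    rewrite -injection_card /=; split=> -[g h1 h2]; exists g => // x; have := h2 x;
      by rewrite update_total.
  by rewrite -(rwP andP); split; [apply/e2/iff/e1 | apply/e1/iff/e2].
exists f => // v; apply: IH => phi kphi dphi; exact: fP.
Qed.

Lemma sat_local (G : graph) (s t : assignment G) phi :
  in_C k phi -> (forall i, i < k -> s i = t i) -> sat s phi <-> sat t phi.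
Proof.
elim: phi s t => [i j|i j|phi IH|phi IH psi IH'|phi IH psi IH'|i phi IH|i phi IH|c i phi IH]
  s t /=.
- by case/andP=> ik jk e; rewrite !e.
- by case/andP=> ik jk e; rewrite !e.
- by move=> kp e; rewrite (IH s t).
- by case/andP=> kp kq e; rewrite (IH s t) // (IH' s t).
- by case/andP=> kp kq e; rewrite (IH s t) // (IH' s t).
- case/andP=> ik kp e; have h v := IH (update s i v) (update t i v) kp.
  by split=> -[v hv]; exists v; apply/h => // j jk; rewrite /update e.
- case/andP=> ik kp e; have h v := IH (update s i v) (update t i v) kp.
  by split=> hv v; apply/h => // j jk; rewrite /update e.
- case/andP=> ik kp e; have h v := IH (update s i v) (update t i v) kp.
  by split=> -[g injg hg]; exists g => // x; apply/h => // j jk; rewrite /update e.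
Qed.

(* Gives the variables [x_2, ..., x_(n+1)] the value of [x_1]. *)
Fixpoint diagonal (n : nat) (phi : formula) : formula :=
  if n is n'.+1 then FEx n (FAnd (FEq n 0) (diagonal n' phi)) else phi.

Lemma diagonal_sat (G : graph) n (s : assignment G) v phi : s 0 = Some v ->
  sat s (diagonal n phi) <-> sat (fun i => if 0 < i <= n then Some v else s i) phi.
Proof.
elim: n s => [|n IH] s s0 /=.
  by rewrite (_ : (fun i => _) = s) //; apply/funext => -[].
have u0 : update s n.+1 v 0 = Some v by [].
have e : (fun i => if 0 < i <= n then Some v else update s n.+1 v i) =
         (fun i => if 0 < i <= n.+1 then Some v else s i).
  apply/funext => i; rewrite /update; have [->|ne] := eqVneq i n.+1.
    by rewrite ltnn andbF leqnn.
  by rewrite [i <= n.+1]leq_eqVlt (negbTE ne).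
split=> [[w [[x [y [+ + exy]] h]]]|h].
  rewrite /update eqxx /= s0 => -[ex] -[ey].
  have ewv : w = v by rewrite ex exy ey.
  by rewrite -e -(IH _ u0); rewrite ewv in h.
exists v; split; first by exists v, v; rewrite /update eqxx /= s0.
by rewrite (IH _ u0) e.
Qed.

Lemma diagonal_in_C n phi : n < k -> in_C k phi -> in_C k (diagonal n phi).
Proof.
by move=> + kp; elim: n => [|n IH] nk //=; rewrite nk IH ?(ltnW nk) // (leq_ltn_trans _ nk).
Qed.

Lemma diagonal_qdepth n phi : qdepth (diagonal n phi) = n + qdepth phi.
Proof. by elim: n => [|n IH] //=; rewrite max0n IH. Qed.

Lemma in_C_free phi : in_C k phi -> all (fun j => j < k) (free_vars phi).
Proof.
elim: phi => [i j|i j|phi IH|phi IH psi IH'|phi IH psi IH'|i phi IH|i phi IH|c i phi IH] //=.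
- by rewrite andbT.
- by rewrite andbT.
- by rewrite all_cat => /andP [/IH -> /IH' ->].
- by rewrite all_cat => /andP [/IH -> /IH' ->].
- by case/andP=> _ /IH h; rewrite all_filter; apply: sub_all h => j /= ->; rewrite implybT.
- by case/andP=> _ /IH h; rewrite all_filter; apply: sub_all h => j /= ->; rewrite implybT.
- by case/andP=> _ /IH h; rewrite all_filter; apply: sub_all h => j /= ->; rewrite implybT.
Qed.

Lemma diagonal_free n phi : in_C k phi ->
  all (fun j => (j == 0) || (n < j < k)) (free_vars (diagonal n phi)).
Proof.
move=> kp; elim: n => [|n IH] /=.
  apply: sub_all (in_C_free kp) => j jk /=.
  by case: j jk => //= j ->.
rewrite eqxx /=; apply/allP => j; rewrite mem_filter => /andP [nj jf].
have := allP IH j jf; case/orP=> [->//|/andP [h1 ->]].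
by rewrite andbT [_ < j]ltn_neqAle [_.+1 == j]eq_sym nj h1 orbT.
Qed.

(** The game starts with all pebbles on one vertex, a sentence with no variable assigned. One
    counting quantifier chooses the vertex and [diagonal] copies it to the other variables, which
    costs [k] quantifiers in all. *)
Lemma eqv_sentences m : 0 < k ->
  (forall phi, sentence phi -> in_C k phi -> qdepth phi <= m + k ->
     models (as_graph E1) phi <-> models (as_graph E2) phi) ->
  exists2 f : T -> T, injective f & forall v, eqv m (fun=> v) (fun=> f v).
Proof.
move=> k0 H; pose F phi := in_C k phi /\ qdepth phi <= m.
pose a := FEq 0 0; pose truth := FNot (FAnd a (FNot a)).
have [||||||||||f injf fP] := @counting_bijection T F
   (fun v phi => sat (G := as_graph E1) (fun=> Some v) phi)
   (fun v phi => sat (G := as_graph E2) (fun=> Some v) phi) truth => //.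
- by move=> phi psi [h1 h2] [h3 h4]; split; rewrite /= ?h1 // geq_max h2.
- by split; rewrite //= k0.
- by move=> v /=; tauto.
- by move=> v /=; tauto.
- move=> phi [kphi dphi]; apply/eqP; rewrite eqn_leq.
  pose chi c := FExGe c 0 (diagonal k.-1 phi).
  have iff c : models (as_graph E1) (chi c) <-> models (as_graph E2) (chi c).
    apply: H.
    - rewrite /sentence /=; apply/eqP; rewrite -size_eq0 size_filter -leqn0 leqNgt -has_count.
      apply/hasPn => j /(allP (diagonal_free k.-1 kphi)).
      by rewrite prednK // ltnNge; case: leqP => //= _; rewrite orbF negbK.
    - by rewrite /= k0 diagonal_in_C // prednK.
    - by rewrite /= diagonal_qdepth -addSn prednK // addnC leq_add2r.
  have e (E : rel T) c : models (as_graph E) (chi c) <->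
      c <= #|[set v | `[< sat (G := as_graph E) (fun=> Some v) phi >]]|.
    rewrite -injection_card /models /=.
    have h v : sat (G := as_graph E) (update (fun=> None) 0 v) (diagonal k.-1 phi) <->
        sat (G := as_graph E) (fun=> Some v) phi.
      rewrite (@diagonal_sat _ _ _ v) //; apply: sat_local => // i ik.
      by rewrite /total /update; case: i ik => //= i ik; rewrite -ltnS prednK // ik.
    by split=> -[g h1 h2]; exists g => // x; apply/h.
  by rewrite -(rwP andP); split; [apply/e/iff/e | apply/e/iff/e].
exists f => // v; apply: eqv_formulas => phi kphi dphi; exact: fP.
Qed.

Lemma eqv_leq m n s t : m <= n -> eqv n s t -> eqv m s t.
Proof. by move/subnK <-; elim: (n - m) => [|d IH] //= [/IH]. Qed.

(** A position seen as two lists of pebbled vertices. The variables behind them may be repeated or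
    left out, so lists can be permuted, duplicated and shortened ([sim_pick]), and fewer than [k]
    entries leave a variable free for the next move. *)
Definition sim (m : nat) (xs ys : seq T) : Prop :=
  exists s t, exists2 idx : seq nat, all (fun i => i < k) idx
    & [/\ xs = map s idx, ys = map t idx & eqv m s t].

Lemma sim_leq m n xs ys : m <= n -> sim n xs ys -> sim m xs ys.
Proof.
move=> le [s [t [idx h [h1 h2 /(eqv_leq le) h3]]]].
by exists s, t, idx.
Qed.

Lemma sim_pick x0 m xs ys (ids : seq nat) : sim m xs ys ->
  all (fun i => i < size xs) ids ->
  sim m [seq nth x0 xs i | i <- ids] [seq nth x0 ys i | i <- ids].
Proof.
case=> [s [t [idx kidx [-> -> st]]]]; rewrite size_map => /allP ids_lt.
exists s, t, [seq nth 0 idx i | i <- ids].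
  apply/allP => _ /mapP [i /ids_lt i_lt ->].
  exact/(allP kidx)/mem_nth.
by rewrite -!map_comp; split=> //; apply/eq_in_map => i /ids_lt i_lt /=;
   rewrite (nth_map 0).
Qed.

Lemma sim_extend m xs ys : sim m.+1 xs ys -> size xs < k ->
  exists2 f : T -> T, injective f & forall v, sim m (v :: xs) (f v :: ys).
Proof.
case=> [s [t [idx kidx [-> -> [_ st]]]]]; rewrite size_map => szk.
have [i ik Ni] : exists2 i, i < k & i \notin idx.
  have [/allP sub|/allPn [i]] := boolP (all (mem idx) (iota 0 k)).
    have := uniq_leq_size (iota_uniq 0 k) sub.
    by rewrite size_iota leqNgt szk.
  by rewrite mem_iota => ik Ni; exists i.
have [f injf fP] := st i ik; exists f => // v.
exists (upd s i v), (upd t i (f v)), (i :: idx); first by rewrite /= ik.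
have updN (u : nat -> T) w : map (upd u i w) idx = map u idx.
  by apply/eq_in_map => j jidx; rewrite /upd; case: eqP jidx Ni => // -> ->.
by split; [| |exact: fP]; rewrite /= updN; congr cons; rewrite /upd eqxx.
Qed.

Lemma sim_extend_back m xs ys v' : sim m.+1 xs ys -> size xs < k ->
  exists v, sim m (v :: xs) (v' :: ys).
Proof.
move=> h sz; have [f injf fP] := sim_extend h sz.
by exists (invF injf v'); have := fP (invF injf v'); rewrite f_invF.
Qed.

Lemma sim_edge m x y xs x' y' ys : sim m [:: x, y & xs] [:: x', y' & ys] ->
  E1 x y = E2 x' y'.
Proof.
move=> /(sim_leq (leq0n m)) [s [t [idx + [+ + st]]]].
case: idx => [|i [|j idx]] //= /and3P [ik jk _] [-> -> _] [-> -> _].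
by case: (st i j ik jk).
Qed.

Lemma sim_eq m x y xs x' y' ys : sim m [:: x, y & xs] [:: x', y' & ys] ->
  (x == y) = (x' == y').
Proof.
move=> /(sim_leq (leq0n m)) [s [t [idx + [+ + st]]]].
case: idx => [|i [|j idx]] //= /and3P [ik jk _] [-> -> _] [-> -> _].
by case: (st i j ik jk).
Qed.

Lemma sim_first_third m x y z xs x' y' z' ys :
  sim m [:: x, y, z & xs] [:: x', y', z' & ys] -> sim m [:: x, z & xs] [:: x', z' & ys].
Proof.
case=> s [t [idx + [+ + st]]]; case: idx => [|i [|j [|l idx]]] //=.
case/and4P=> [ik _ lk h] [-> _ -> ->] [-> _ -> ->].
by exists s, t, [:: i, l & idx]; rewrite //= ik lk.
Qed.

Lemma sim_second_first m x y z xs x' y' z' ys :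
  sim m [:: x, y, z & xs] [:: x', y', z' & ys] -> sim m [:: y, x & xs] [:: y', x' & ys].
Proof.
case=> s [t [idx + [+ + st]]]; case: idx => [|i [|j [|l idx]]] //=.
case/and4P=> [ik jk _ h] [-> -> _ ->] [-> -> _ ->].
by exists s, t, [:: j, i & idx]; rewrite //= ik jk.
Qed.

Lemma sim_card m xs ys (p p' : pred T) : sim m.+1 xs ys -> size xs < k ->
  (forall v v', sim m (v :: xs) (v' :: ys) -> p v = p' v') ->
  #|[set v | p v]| = #|[set v | p' v]|.
Proof.
move=> h sz pp; have [f injf fP] := sim_extend h sz.
have <- : f @^-1: [set v | p' v] = [set v | p v].
  by apply/setP => v; rewrite !inE (pp v (f v)).
rewrite on_card_preimset //; apply: onW_bij; exact: injF_bij.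
Qed.

Lemma sim_exists m xs ys (p p' : pred T) : sim m.+1 xs ys -> size xs < k ->
  (forall v v', sim m (v :: xs) (v' :: ys) -> p v = p' v') ->
  [exists v, p v] = [exists v, p' v].
Proof.
move=> h sz pp; have := sim_card h sz pp.
rewrite !cardsE => e; apply/idP/idP => /existsP [v pv].
  have /card_gt0P [w pw] : 0 < #|p'| by rewrite -e; apply/card_gt0P; exists v.
  by apply/existsP; exists w.
have /card_gt0P [w pw] : 0 < #|p| by rewrite e; apply/card_gt0P; exists v.
by apply/existsP; exists w.
Qed.

Lemma sim_sub x0 n m L xs ys ids xs' ys' : sim (m + L) xs ys -> n <= m ->
  all (fun i => i < size xs) ids ->
  [seq nth x0 xs i | i <- ids] = xs' -> [seq nth x0 ys i | i <- ids] = ys' ->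
  sim (n + L) xs' ys'.
Proof.
move=> h nm al <- <-; apply: sim_pick => //.
by apply: sim_leq h; rewrite leq_add2r.
Qed.

End Game.

Arguments sim_sub {T E1 E2 k} x0 {n m L xs ys} ids {xs' ys'}.

(** * Rounds needed to define layers, bushes and degrees *)

Section Invariance.
Variables (T : finType) (E E' : rel T) (l : nat).
Hypothesis card_l : #|T| <= 2 ^ l.
Local Notation k := 8.
Local Notation sim := (sim E E' k).

(** Walks of length at most [2 ^ j] are tested in [j] rounds by guessing a midpoint. Each half
    forgets one of the old ends, so three pebbles besides the parameters [ps] suffice at every
    level. *)
Lemma sim_walk (e e' : rel T) ps ps' m0 j m x y x' y' : size ps + 3 <= k ->
  (forall a b a' b', sim m0 [:: a, b & ps] [:: a', b' & ps'] -> e a b = e' a' b') ->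
  m <= 2 ^ j -> sim (j + m0) [:: x, y & ps] [:: x', y' & ps'] ->
  walk e m x y = walk e' m x' y'.
Proof.
move=> szps ee'; elim: j m x y x' y' => [|j IH] m x y x' y' mj h.
  have Exy := ee' _ _ _ _ h; have xy := sim_eq h.
  case: m mj => [|[|m]] // _; rewrite /= xy //; congr orb.
  apply/existsP/existsP => -[z /andP [ez /eqP zy]].
    by exists y'; rewrite -Exy -zy ez eqxx.
  by exists y; rewrite Exy -zy ez eqxx.
have -> : m = m./2 + (m - m./2) by clear; lia.
rewrite !walk_add; apply: (sim_exists h) => [|z z' hz]; first by clear -szps; rewrite /=; lia.
rewrite expnS in mj; congr andb.
  apply: IH; first by clear -mj; lia.
  exact: sim_second_first hz.
apply: IH; first by clear -mj; lia.
exact: sim_first_third hz.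
Qed.

Lemma connect_walkE (e : rel T) x y : connect e x y = walk e #|T|.-1 x y.
Proof. by apply/idP/idP => [/connect_walk|/walk_connect]. Qed.

Lemma sim_connect (e e' : rel T) ps ps' m0 x y x' y' : size ps + 3 <= k ->
  (forall a b a' b', sim m0 [:: a, b & ps] [:: a', b' & ps'] -> e a b = e' a' b') ->
  sim (l + m0) [:: x, y & ps] [:: x', y' & ps'] ->
  connect e x y = connect e' x' y'.
Proof.
move=> szps ee' h; rewrite !connect_walkE; apply: sim_walk h => //.
exact: leq_trans (leq_pred _) card_l.
Qed.

Variables (r r' : T).
(** One [l] pays for the depths that delimit the lower layers, the other for reachability inside
    them ([sim_below]). *)
Local Notation L := (l + l).

Lemma sim_depth0 x x' : sim l [:: x; r] [:: x'; r'] -> depth E r x = depth E' r' x'.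
Proof.
move=> h; apply: eq_in_find => m; rewrite mem_iota add0n => mT.
apply: (sim_walk (ps := [::]) (ps' := [::]) (m0 := 0) (j := l)) => //.
- by move=> a b a' b' /sim_edge.
- exact: leq_trans (ltnW mT) card_l.
- by rewrite addn0; apply: (sim_pick r (ids := [:: 1; 0])) h _.
Qed.

Lemma sim_depth n x x' : sim (n + L) [:: x; r] [:: x'; r'] ->
  depth E r x = depth E' r' x'.
Proof. by move=> h; apply/sim_depth0/(sim_leq _ h); clear; lia. Qed.

Lemma sim_ch n w c w' c' : sim (n + L) [:: c; w; r] [:: c'; w'; r'] ->
  (c \in ch E r w) = (c' \in ch E' r' w').
Proof.
move=> h; rewrite !inE.
rewrite (@sim_depth 0 c c') ?(@sim_depth 0 w w').
- by congr andb; apply: (@sim_edge _ _ _ k (0 + L) _ _ [::] _ _ [::]); apply: (sim_sub r [:: 1; 0] h).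
- by apply: (sim_sub r [:: 1; 2] h).
- by apply: (sim_sub r [:: 0; 2] h).
Qed.

Lemma sim_below x y w x' y' w' : sim (0 + L) [:: x; y; w; r] [:: x'; y'; w'; r'] ->
  connect (restr E (below E r (depth E r w))) x y =
  connect (restr E' (below E' r' (depth E' r' w'))) x' y'.
Proof.
apply: (sim_connect (ps := [:: w; r]) (ps' := [:: w'; r'])) => // a b a' b' h.
have h0 : sim (0 + l) [:: a; b; w; r] [:: a'; b'; w'; r'] by [].
rewrite /restr /below (sim_edge h) (@sim_depth0 w w') ?(@sim_depth0 a a') ?(@sim_depth0 b b') //.
- by apply: (sim_sub (n := 0) r [:: 1; 3] h0).
- by apply: (sim_sub (n := 0) r [:: 0; 3] h0).
- by apply: (sim_sub (n := 0) r [:: 2; 3] h0).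
Qed.

Lemma sim_descent n x w x' w' : sim (n.+1 + L) [:: x; w; r] [:: x'; w'; r'] ->
  (x \in descent E r w) = (x' \in descent E' r' w').
Proof.
move=> h; rewrite !inE; apply: (@sim_exists _ _ _ k (n + L) _ _ _ _ h) => // c c' hc.
congr andb; first by apply: (@sim_ch 0); apply: (sim_sub r [:: 0; 2; 3] hc).
by apply: sim_below; apply: (sim_sub r [:: 0; 1; 2; 3] hc).
Qed.

Lemma sim_rim n y w y' w' : sim (n.+2 + L) [:: y; w; r] [:: y'; w'; r'] ->
  (y \in rim E r w) = (y' \in rim E' r' w').
Proof.
move=> h; rewrite !inE; rewrite (@sim_depth 0 y y') ?(@sim_depth 0 w w').
- congr andb; congr orb.
    apply: (@sim_eq _ _ _ k (0 + L) _ _ [::] _ _ [::]).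
    by apply: (sim_sub r [:: 0; 1] h).
  apply: (@sim_exists _ _ _ k (n.+1 + L) _ _ _ _ h) => // c c' hc.
  congr andb; first by apply: (@sim_ch 0); apply: (sim_sub r [:: 0; 1; 3] hc).
  by apply: (@sim_descent 0); apply: (sim_sub r [:: 0; 2; 3] hc).
- by apply: (sim_sub r [:: 1; 2] h).
- by apply: (sim_sub r [:: 0; 2] h).
Qed.

Lemma sim_bush n y w y' w' : sim (n.+2 + L) [:: y; w; r] [:: y'; w'; r'] ->
  (y \in bush E r w) = (y' \in bush E' r' w').
Proof.
by move=> h; rewrite !in_setU (sim_rim h) (@sim_descent n.+1 y w y' w').
Qed.

Lemma sim_top n y w y' w' : sim (n.+1 + L) [:: y; w; r] [:: y'; w'; r'] ->
  (y \in top E r w) = (y' \in top E' r' w').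
Proof.
move=> h; rewrite [LHS]in_set [RHS]in_set (sim_descent h) (@sim_depth 0 y y') ?(@sim_depth 0 w w') //.
- by apply: (sim_sub r [:: 1; 2] h).
- by apply: (sim_sub r [:: 0; 2] h).
Qed.

Lemma sim_up n x x' : sim (n.+1 + L) [:: x; r] [:: x'; r'] -> up E r x = up E' r' x'.
Proof.
move=> h; apply: (@sim_card _ _ _ k (n + L) _ _ _ _ h) => // p p' hp.
have := @sim_ch n p x p' x'; rewrite !inE; apply.
by apply: (sim_sub r [:: 1; 0; 2] hp).
Qed.

Lemma sim_card_ch n w w' : sim (n.+1 + L) [:: w; r] [:: w'; r'] ->
  #|ch E r w| = #|ch E' r' w'|.
Proof.
move=> h; apply: (@sim_card _ _ _ k (n + L) _ _ _ _ h) => // p p' hp.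
by have := @sim_ch n w p w' p'; rewrite !inE; apply.
Qed.

Lemma sim_cnt n u y u' y' : sim (n.+3 + L) [:: y; u; r] [:: y'; u'; r'] ->
  cnt E r u y = cnt E' r' u' y'.
Proof.
move=> h; apply: (@sim_card _ _ _ k (n.+2 + L) _ _ _ _ h) => // z z' hz.
congr andb; first by apply: (@sim_rim 0); apply: (sim_sub r [:: 0; 2; 3] hz).
apply: (@sim_edge _ _ _ k (0 + L) _ _ [::] _ _ [::]).
by apply: (sim_sub r [:: 1; 0] hz).
Qed.

Lemma sim_entry_rank n u u' t : sim (n.+4 + L) [:: u; r] [:: u'; r'] ->
  entry_rank E r u t = entry_rank E' r' u' t.
Proof.
move=> h; apply: (@sim_card _ _ _ k (n.+3 + L) _ _ _ _ h) => // z z' hz.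
rewrite !inE (sim_cnt hz) (@sim_depth 0 z z') ?(@sim_depth 0 u u') //.
- by apply: (sim_sub r [:: 1; 2] hz).
- by apply: (sim_sub r [:: 0; 2] hz).
Qed.

Lemma sim_card_rim n w w' : sim (n.+3 + L) [:: w; r] [:: w'; r'] ->
  #|rim E r w| = #|rim E' r' w'|.
Proof.
move=> h; rewrite -(cardsE (mem (rim E r w))) -(cardsE (mem (rim E' r' w'))).
apply: (@sim_card _ _ _ k (n.+2 + L) _ _ _ _ h) => [//|p p' hp].
exact: (sim_rim hp).
Qed.

Lemma sim_cin n w y w' y' : sim (n.+1 + L) [:: y; w; r] [:: y'; w'; r'] ->
  cin E r w y = cin E' r' w' y' /\ cout E r w y = cout E' r' w' y'.
Proof.
move=> h; have aux z z' : sim (n + L) [:: z; y; w; r] [:: z'; y'; w'; r'] ->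
    (z \in ch E r y) = (z' \in ch E' r' y') /\ (z \in ch E r w) = (z' \in ch E' r' w').
  move=> hz; split; apply: (@sim_ch 0).
    by apply: (sim_sub r [:: 0; 1; 3] hz).
  by apply: (sim_sub r [:: 0; 2; 3] hz).
split.
  by apply: (@sim_card _ _ _ k (n + L) _ _ _ _ h) => // z z' /aux [-> ->].
by apply: (@sim_card _ _ _ k (n + L) _ _ _ _ h) => // z z' /aux [-> ->].
Qed.

Lemma sim_cin_rank n w w' t : sim (n.+3 + L) [:: w; r] [:: w'; r'] ->
  cin_rank E r w t = cin_rank E' r' w' t /\ cout_rank E r w t = cout_rank E' r' w' t.
Proof.
move=> h; have aux z z' : sim (n.+2 + L) [:: z; w; r] [:: z'; w'; r'] ->
    [/\ (z \in rim E r w) = (z' \in rim E' r' w'), cin E r w z = cin E' r' w' z'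
      & cout E r w z = cout E' r' w' z'].
  by move=> hz; have [? ?] := sim_cin hz; rewrite (sim_rim hz).
split.
  by apply: (@sim_card _ _ _ k (n.+2 + L) _ _ _ _ h) => // z z' /aux [-> -> _].
by apply: (@sim_card _ _ _ k (n.+2 + L) _ _ _ _ h) => // z z' /aux [-> _ ->].
Qed.

Lemma sim_widest n w w' : sim (n.+3 + L) [:: w; r] [:: w'; r'] ->
  widest E r w = widest E' r' w'.
Proof.
move=> h; rewrite /widest -[LHS]negbK -[RHS]negbK !negb_forall; congr negb.
apply: (@sim_exists _ _ _ k (n.+2 + L) _ _ _ _ h) => // z z' hz.
rewrite (sim_rim hz) (@sim_card_ch 0 z z') ?(@sim_card_ch 0 w w') //.
- by apply: (sim_sub r [:: 1; 2] hz).
- by apply: (sim_sub r [:: 0; 2] hz).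
Qed.

Lemma sim_reach n x y x' y' : sim (n + L) [:: x; y] [:: x'; y'] ->
  connect E x y = connect E' x' y'.
Proof.
move=> h; apply: (sim_connect (ps := [::]) (ps' := [::]) (m0 := 0)) => //.
  by move=> a b a' b' /sim_edge.
by apply: sim_leq h; clear; lia.
Qed.

(** Vertices of the second graph that might violate a condition are pulled back by the duplicator's
    bijections; at most four are needed besides the root. [edge_filled] takes one more reachability
    test, with the ends of the edge as parameters. *)
Lemma sim_rooted n : rooted E r -> sim (n + 4 + L) [:: r] [:: r'] -> rooted E' r'.
Proof.
move=> R h.
have back m xs ys v' : sim (m.+1 + L) xs ys -> size xs < k ->
    exists v, sim (m + L) (v :: xs) (v' :: ys).
  exact: sim_extend_back.
have edge m xs ys i j : sim (m + L) xs ys -> i < size xs -> j < size xs ->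
    E (nth r xs i) (nth r xs j) = E' (nth r ys i) (nth r ys j).
  move=> hm hi hj; have := @sim_pick _ _ _ k r _ xs ys [:: i; j] hm.
  by rewrite /= hi hj => /(_ isT) /sim_edge.
have eqs m xs ys i j : sim (m + L) xs ys -> i < size xs -> j < size xs ->
    (nth r xs i == nth r xs j) = (nth r ys i == nth r ys j).
  move=> hm hi hj; have := @sim_pick _ _ _ k r _ xs ys [:: i; j] hm.
  by rewrite /= hi hj => /(_ isT) /sim_eq.
have h4 : sim (4 + L) [:: r] [:: r'] by apply: sim_leq h; clear; lia.
split.
- move=> x' y'; have [x hx] := back 3 _ _ x' h4 isT; have [y hy] := back 2 _ _ y' hx isT.
  rewrite -(edge 2 _ _ 1 0 hy isT isT) -(edge 2 _ _ 0 1 hy isT isT) /=.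
  exact: rooted_sym R _ _.
- move=> x'; have [x hx] := back 3 _ _ x' h4 isT.
  by rewrite -(edge 3 _ _ 0 0 hx isT isT) /= (rooted_irr R).
- move=> p' q' x' y'.
  have [p hp] := back 3 _ _ p' h4 isT; have [q hq] := back 2 _ _ q' hp isT.
  have [x hx] := back 1 _ _ x' hq isT; have [y hy] := back 0 _ _ y' hx isT.
  rewrite -(edge 0 _ _ 3 2 hy isT isT) -(edge 0 _ _ 3 1 hy isT isT) -(edge 0 _ _ 2 0 hy isT isT) /=.
  have priv a a' m : sim (0 + m) [:: a; p; q] [:: a'; p'; q'] ->
      private_nbr E p q a = private_nbr E' p' q' a'.
    move=> ha; rewrite /private_nbr (sim_eq ha).
    have h2 := sim_sub (n := 0) (m := 0) (L := m) r [:: 0; 2] ha isT isT erefl erefl.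
    have h3 := sim_sub (n := 0) (m := 0) (L := m) r [:: 1; 0] ha isT isT erefl erefl.
    have h5 := sim_sub (n := 0) (m := 0) (L := m) r [:: 2; 0] ha isT isT erefl erefl.
    by rewrite (sim_eq h2) (sim_edge h3) (sim_edge h5).
  have hxy := sim_sub (n := 0) (m := 0) (L := L) r [:: 1; 0; 3; 2] hy isT isT erefl erefl.
  rewrite -(priv x x' L (sim_sub r [:: 0; 2; 3] hxy _ _ _ _)) //.
  rewrite -(priv y y' L (sim_sub r [:: 1; 2; 3] hxy _ _ _ _)) //.
  suff <- : connect (restr E (private_nbr E p q)) x y =
            connect (restr E' (private_nbr E' p' q')) x' y' by exact: rooted_fill R _ _ _ _.
  apply: (sim_connect (ps := [:: p; q]) (ps' := [:: p'; q']) (m0 := 0)) => //.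
    move=> a b a' b' hab; have hab0 : sim (0 + 0) [:: a; b; p; q] [:: a'; b'; p'; q'] by [].
    rewrite /restr (sim_edge hab) (priv a a' 0) ?(priv b b' 0) //.
      by apply: (sim_sub r [:: 1; 2; 3] hab0).
    by apply: (sim_sub r [:: 0; 2; 3] hab0).
  apply: (sim_leq (n := 0 + L)); first by clear; lia.
  by apply: (sim_sub r [:: 0; 1; 2; 3] hxy).
- move=> c' x' y' z'.
  have [c hc] := back 3 _ _ c' h4 isT; have [x hx] := back 2 _ _ x' hc isT.
  have [y hy] := back 1 _ _ y' hx isT; have [z hz] := back 0 _ _ z' hy isT.
  have e i j := edge 0 _ _ i j hz; have q i j := eqs 0 _ _ i j hz.
  rewrite -(e 3 2 isT isT) -(e 3 1 isT isT) -(e 3 0 isT isT) -(e 2 1 isT isT).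
  rewrite -(e 2 0 isT isT) -(e 1 0 isT isT) -(q 2 1 isT isT) -(q 2 0 isT isT).
  by rewrite -(q 1 0 isT isT); apply: (rooted_claw R).
- move=> x' y'; have [x hx] := back 3 _ _ x' h4 isT; have [y hy] := back 2 _ _ y' hx isT.
  have e i j := edge 2 _ _ i j hy; have q i j := eqs 2 _ _ i j hy.
  rewrite -(e 2 1 isT isT) -(e 2 0 isT isT) -(e 1 0 isT isT) -(q 1 0 isT isT).
  by apply: (rooted_simplicial R).
Qed.

End Invariance.

(** * Halving regions *)

(** A deepest [w] whose region exceeds half of the whole is a balanced cut: less than half remains
    above it, and deeper regions with the same lower boundary have at most half. Its rim vertices
    share one bush, so [w] may be taken widest among them. *)
Lemma deepest_widest (T : finType) (E : rel T) (r : T) q ou :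
  rooted E r -> inside E r ou q -> 0 < #|region E r q ou| ->
  exists w, [/\ w \in bush E r q, inside E r ou w, widest E r w,
    #|region E r q ou| < (#|region E r w ou|).*2 &
    forall z, z \in bush E r q -> inside E r ou z -> depth E r w < depth E r z ->
      (#|region E r z ou|).*2 <= #|region E r q ou| ].
Proof.
move=> R iq N0; set N := #|region E r q ou| in N0 *.
pose cand w := [&& w \in bush E r q, inside E r ou w & N < (#|region E r w ou|).*2].
have candq : cand q by rewrite /cand J_refl iq -/N; clear -N0; lia.
case: (arg_maxnP (depth E r) candq) => w0 /and3P [Jw0 iw0 Nw0] maxw0.
have [|w Qw maxw] := @arg_maxnP _ w0 (mem (rim E r w0)) (fun w => #|ch E r w|).
  exact: Q_refl.
have JE := J_eq R Qw; have KE := Q_K R Qw.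
have insideE : inside E r ou w = inside E r ou w0 by rewrite /inside KE.
exists w; split.
- apply: (subsetP (bush_sub R Jw0)); rewrite -JE; exact: J_refl.
- by rewrite insideE.
- by apply/forall_inP => p; rewrite (Q_eq R Qw) => Qp; apply: maxw.
- by rewrite /region JE.
- move=> z Jz iz; rewrite (Q_depth Qw) => dz; rewrite leqNgt; apply/negP => Nz.
  by have := maxw0 z; rewrite /cand Jz iz Nz => /(_ isT) /(leq_trans dz); rewrite ltnn.
Qed.

Section Main.
Variables (T : finType) (E E' : rel T) (l : nat) (r r' : T).
Hypotheses (card_l : #|T| <= 2 ^ l) (R : rooted E r) (R' : rooted E' r').
Local Notation k := 8.
Local Notation sim := (sim E E' k).
Local Notation L := (l + l).

Lemma sim_inside n w u0 u0' ou w' ou' : isSome ou = isSome ou' ->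
  sim (n.+1 + L) [:: w; odflt u0 ou; r] [:: w'; odflt u0' ou'; r'] ->
  inside E r ou w = inside E' r' ou' w'.
Proof.
case: ou ou' => [u|] [u'|] //= _ h; apply: (@sim_descent _ E E' l card_l r r' n).
by apply: (sim_sub r [:: 1; 0; 2] h).
Qed.

Lemma sim_region n x w u0 u0' ou x' w' ou' : isSome ou = isSome ou' ->
  sim (n.+2 + L) [:: x; w; odflt u0 ou; r] [:: x'; w'; odflt u0' ou'; r'] ->
  (x \in region E r w ou) = (x' \in region E' r' w' ou').
Proof.
move=> so h; rewrite !in_setD (@sim_bush _ E E' l card_l r r' n x w x' w'); last first.
  by apply: (sim_sub r [:: 0; 1; 3] h).
case: ou ou' so h => [u|] [u'|] //= _ h; last by rewrite !inE.
congr (~~ _ && _); apply: (@sim_bush _ E E' l card_l r r' n).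
by apply: (sim_sub r [:: 0; 2; 3] h).
Qed.

Lemma sim_color n x u0 u0' ou x' ou' : isSome ou = isSome ou' ->
  sim (n.+3 + L) [:: x; odflt u0 ou; r] [:: x'; odflt u0' ou'; r'] ->
  color E r ou x = color E' r' ou' x'.
Proof.
move=> so h; have h2 : sim (n.+3 + L) [:: x; r] [:: x'; r'].
  by apply: (sim_sub r [:: 0; 2] h).
rewrite /color (@sim_depth _ E E' l card_l r r' _ _ _ h2) (@sim_up _ E E' l card_l r r' _ _ _ h2).
congr (_, _, _); case: ou ou' so h => [u|] [u'|] //= _ h.
exact: (@sim_cnt _ E E' l card_l r r' n).
Qed.

(* [b] counts the rounds left and [o] tells whether the region has a lower
   boundary; when it has none, [odflt] fills the slot with a dummy pebble. *)
Definition solved (b m : nat) (o : bool) : Prop := forall q ou q' ou',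
  isSome ou = o -> isSome ou' = o ->
  sim (10 + b + L) [:: q; odflt q ou; r] [:: q'; odflt q' ou'; r'] ->
  inside E r ou q -> #|region E r q ou| < 2 ^ m -> riso E E' r r' q ou q' ou'.

Lemma solved_leq b b' m o : b <= b' -> solved b m o -> solved b' m o.
Proof.
move=> bb' H q ou q' ou' so so' h; apply: H => //; apply: sim_leq h.
by rewrite leq_add2r leq_add2l.
Qed.

Lemma solved0 b o : solved b 0 o.
Proof.
move=> q ou q' ou' so so' h iq; rewrite ltnS leqn0 cards_eq0 => /eqP R0.
have R0' : region E' r' q' ou' = set0.
  apply/setP => x'; rewrite [RHS]inE.
  have [x hx] := @sim_extend_back _ E E' k (9 + b + L) _ _ x' h isT.
  by rewrite -(@sim_region (7 + b) x q q q' ou) ?so ?so' // R0 inE.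
exists id; rewrite R0 R0'; split=> // x; by rewrite inE.
Qed.

(** Three rounds are spent: on [w], on the bijection for [x], and on a top [z] with [x] in its bush.
    [HC] solves the piece above [w], of less than half the size, and [HA] a part at [z] that keeps
    the kind of lower boundary, of at most half. A part that loses the lower boundary may have
    nearly the full size, but [HB] covers it; this is why halving takes two steps. *)
Lemma solved_step b m o : solved b m o -> (o -> solved b m.+1 false) ->
  solved b m true -> solved b.+3 m.+1 o.
Proof.
move=> HA HB HC q ou q' ou' so so' h iq ltN.
have soo : isSome ou = isSome ou' by rewrite so.
have [N0|N0] := posnP #|region E r q ou|.
  by apply: (@solved0 b.+3 o) => //; rewrite N0.
have [w [Jw iw ww Nw deep]] := deepest_widest R iq N0.
have [f1 _ /(_ w)] := @sim_extend _ E E' k (12 + b + L) _ _ h isT.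
set w' := f1 w => h1.
have hw : sim (12 + b + L) [:: w; r] [:: w'; r'] by apply: (sim_sub r [:: 0; 3] h1).
have hwu : sim (12 + b + L) [:: w; odflt q ou; r] [:: w'; odflt q' ou'; r'].
  by apply: (sim_sub r [:: 0; 2; 3] h1).
have hwq : sim (12 + b + L) [:: w; q; r] [:: w'; q'; r'].
  by apply: (sim_sub r [:: 0; 1; 3] h1).
have iw' : inside E' r' ou' w' by rewrite -(@sim_inside (11 + b) w q q' ou).
have dw : depth E r w = depth E' r' w' := sim_depth card_l hw.
have isow : riso E E' r r' w ou w' ou'.
  have [f injf fP] := @sim_extend _ E E' k (11 + b + L) _ _ h1 isT.
  have hx x : sim (11 + b + L) [:: x; w; odflt q ou; r] [:: f x; w'; odflt q' ou'; r'].
    by apply: (sim_sub r [:: 0; 1; 3; 4] (fP x)).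
  have regf x : (x \in region E r w ou) = (f x \in region E' r' w' ou').
    exact: (sim_region (n := 9 + b)) (hx x).
  apply: (@riso_split _ _ _ _ _ R R' _ _ _ _ f) => //.
  - by rewrite -(@sim_widest _ _ _ _ card_l _ _ (9 + b) _ _ hw).
  - exact: (@sim_card_rim _ _ _ _ card_l _ _ (9 + b)).
  - by move=> t; case: (@sim_cin_rank _ _ _ _ card_l _ _ (9 + b) _ _ t hw).
  - by move=> t; case: (@sim_cin_rank _ _ _ _ card_l _ _ (9 + b) _ _ t hw).
  - move=> u u' eu eu'; rewrite eu eu' in hwu.
    apply: (@sim_card_rim _ _ _ _ card_l _ _ (9 + b)).
    by apply: (sim_sub r [:: 1; 2] hwu).
  - move=> x Rx dx; have hxw : sim (11 + b + L) [:: x; w; r] [:: f x; w'; r'].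
      by apply: (sim_sub r [:: 0; 1; 3] (hx x)).
    have hxu : sim (11 + b + L) [:: x; odflt q ou; r] [:: f x; odflt q' ou'; r'].
      by apply: (sim_sub r [:: 0; 2; 3] (hx x)).
    have hxr : sim (11 + b + L) [:: x; r] [:: f x; r'].
      by apply: (sim_sub r [:: 0; 3] (hx x)).
    have hwx : sim (11 + b + L) [:: w; x; r] [:: w'; f x; r'].
      by apply: (sim_sub r [:: 1; 0; 3] (hx x)).
    have [cin cout] := @sim_cin _ _ _ _ card_l _ _ (10 + b) _ _ _ _ hxw.
    rewrite /split_color -(sim_color (n := 8 + b) soo hxu) -dw (sim_edge hwx).
    by rewrite -(sim_depth card_l hxr) cin cout.
  - move=> x Rx dx.
    have [[e]|[_ [z [Xz Jz _]]]] := region_cases R iw Rx; first by rewrite e eqxx in dx.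
    have [f2 _ /(_ z) hz] := @sim_extend _ E E' k (10 + b + L) _ _ (fP x) isT.
    exists z, (f2 z); set z' := f2 z in hz *.
    have hzw : sim (10 + b + L) [:: z; w; r] [:: z'; w'; r'].
      by apply: (sim_sub r [:: 0; 2; 5] hz).
    have hwz : sim (10 + b + L) [:: w; z; r] [:: w'; z'; r'].
      by apply: (sim_sub r [:: 2; 0; 5] hz).
    have hxz : sim (10 + b + L) [:: x; z; r] [:: f x; z'; r'].
      by apply: (sim_sub r [:: 1; 0; 5] hz).
    have hzz : sim (10 + b + L) [:: z; z; r] [:: z'; z'; r'].
      by apply: (sim_sub r [:: 0; 0; 5] hz).
    have hzu : sim (10 + b + L) [:: z; odflt q ou; r] [:: z'; odflt q' ou'; r'].
      by apply: (sim_sub r [:: 0; 4; 5] hz).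
    have huz : sim (10 + b + L) [:: odflt q ou; z; r] [:: odflt q' ou'; z'; r'].
      by apply: (sim_sub r [:: 4; 0; 5] hz).
    have Xz' : z' \in top E' r' w'.
      by rewrite -(@sim_top _ _ _ _ card_l _ _ (9 + b) _ _ _ _ hzw).
    have Jz' : f x \in bush E' r' z'.
      by rewrite -(@sim_bush _ _ _ _ card_l _ _ (8 + b) _ _ _ _ hxz).
    have Jqz : z \in bush E r q := subsetP (bush_sub R Jw) z (top_bush Xz).
    have dwz : depth E r w < depth E r z by have [_ ->] := topP Xz.
    have half : inside E r ou z -> #|region E r z ou| < 2 ^ m.
      move=> iz; have := leq_ltn_trans (deep z Jqz iz dwz) ltN.
      by rewrite expnS; clear; lia.
    have subN : #|region E r z (narrow E r ou z)| < 2 ^ m.+1.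
      apply: leq_ltn_trans ltN; apply: subset_leq_card.
      apply: (@subset_trans _ _ (mem (region E r w ou))).
        by rewrite (region_top R iw Xz Jz Rx) subsetIl.
      by apply: setSD; apply: (bush_sub R).
    split=> //; split.
    + case: ou ou' so so' soo huz hzu half subN iw iw' {iq h ltN N0 Nw deep h1 hwu fP hx regf Rx hz}
        => [u|] [u'|] //= so so' _ huz hzu half subN iw iw'; last first.
          by apply: HA => //; apply: half.
      rewrite /narrow in subN *.
      rewrite -(@sim_descent _ _ _ _ card_l _ _ (9 + b) _ _ _ _ huz).
      case: ifP subN => uz subN; first by apply: HA => //; apply: half.
      by apply: HB; rewrite -?so.
    + exact: sim_edge hwz.
    + move=> u u' eu eu'; rewrite eu eu' in huz hzu.
      by rewrite (@sim_descent _ _ _ _ card_l _ _ (9 + b) _ _ _ _ huz) (sim_edge hzu).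
have [Qw|NQw] := boolP (w \in rim E r q).
  apply: (riso_rim R R' Qw _ isow).
  by rewrite -(@sim_rim _ _ _ _ card_l _ _ (10 + b) _ _ _ _ hwq).
have Kw : w \in descent E r q by move: Jw; rewrite in_setU (negbTE NQw).
have Kw' : w' \in descent E' r' q'.
  by rewrite -(@sim_descent _ _ _ _ card_l _ _ (11 + b) _ _ _ _ hwq).
apply: (riso_chain R R' Kw Kw' iw iw' soo dw _ _ isow).
  by move=> t; apply: (@sim_entry_rank _ _ _ _ card_l _ _ (8 + b)).
(* For the upper piece [w] replaces the old lower boundary, so the number of boundaries does not
   grow. *)
apply: HC => //; first by apply: (sim_sub r [:: 1; 0; 2] hwq); rewrite ?leq_add2r.
have dis : [disjoint region E r q (Some w) & region E r w ou].
  apply/pred0P => x /=; apply/negbTE/negP => /andP [/setDP [_ NJ] /setDP [J _]].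
  by rewrite J in NJ.
have := Nw; rewrite (region_split R Kw iw) cardsU (disjoint_setI0 dis) cards0 subn0.
have := ltN; rewrite (region_split R Kw iw) cardsU (disjoint_setI0 dis) cards0 subn0.
by rewrite expnS; clear; lia.
Qed.

(** Without a lower boundary three rounds halve a region, but a half may have acquired such a
    boundary and is then given [6 * m + 3] rounds. With a lower boundary three more rounds reduce to
    the previous case. Together this makes six rounds per halving. *)
Lemma solved_all m : solved (6 * m) m false /\ solved (6 * m + 3) m true.
Proof.
elim: m => [|m [IH1 IH2]]; first by split; apply: solved0.
have IH1' : solved (6 * m + 3) m false by apply: solved_leq IH1; apply: leq_addr.
have H : solved (6 * m + 3).+3 m.+1 false by apply: solved_step.
have e : 6 * m.+1 = (6 * m + 3).+3 by clear; lia.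
split; first by rewrite e.
apply: (@solved_leq (6 * m + 6).+3); first by clear; lia.
apply: solved_step.
- by apply: solved_leq IH2; clear; lia.
- by move=> _; apply: solved_leq H; clear; lia.
- by apply: solved_leq IH2; clear; lia.
Qed.

Lemma bush_root x : (x \in bush E r r) = connect E r x.
Proof.
have dr : depth E r r = 0 := distxx _ _.
apply/idP/idP => [/setUP [/Q_depth|/K_reach]|].
- by rewrite dr => /depth0 ->; apply: connect0.
- by rewrite dist_connect.
move=> c; apply: (connect_invariant (P := mem (bush E r r)) _ c); last exact: J_refl.
move=> u v /= /setUP [Qu|Ku] Euv; last exact: (K_nbr_bush R Ku Euv).
have ur : u = r by apply: (depth0 (E := E)); rewrite (Q_depth Qu) dr.
rewrite ur in Euv; have nvr : v != r by rewrite eq_sym (neq_adj (rooted_irr R)).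
have := depth_adj r Euv; rewrite dr leq_eqVlt ltnS leqn0 => /orP [/eqP dv|/eqP d0].
  by rewrite in_setU ch_K ?orbT // mem_ch // dr.
by rewrite (depth0 d0) eqxx in nvr.
Qed.

End Main.

(** * From the game to a defining sentence *)

Lemma isomorphic_sym G H : isomorphic G H -> isomorphic H G.
Proof.
case=> g [h gK hK] ge; exists h; first by exists g.
by move=> x y; rewrite -{1}(hK x) -{1}(hK y) -ge.
Qed.

Lemma isomorphic_trans G H I : isomorphic G H -> isomorphic H I -> isomorphic G I.
Proof.
case=> g bg ge [h bh he]; exists (h \o g); first exact: bij_comp.
by move=> x y; rewrite ge he.
Qed.

Lemma sat_isomorphic (G H : graph) (g : G -> H) (s : assignment G) phi :
  bijective g -> (forall x y, edge x y <-> edge (g x) (g y)) ->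
  sat s phi <-> sat (fun i => omap g (s i)) phi.
Proof.
case=> h gK hK ge.
have updg t i v : (fun j => omap g (update t i v j)) =
                  update (fun j => omap g (t j)) i (g v).
  by apply/funext => j; rewrite /update; case: eqP.
elim: phi s => [i j|i j|phi IH|phi IH psi IH'|phi IH psi IH'|i phi IH|i phi IH|c i phi IH]
  s /=.
- split=> [[u [v [-> -> ->]]]|[u [v []]]]; first by exists (g v), (g v).
  case: (s i) (s j) => [a|] [b|] //= [<-] [<-] /(congr1 h); rewrite !gK => ->.
  by exists b, b.
- split=> [[u [v [-> -> uv]]]|[u [v []]]]; first by exists (g u), (g v); split=> //; apply/ge.
  by case: (s i) (s j) => [a|] [b|] //= [<-] [<-] /ge ab; exists a, b.
- by rewrite IH.
- by rewrite IH IH'.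
- by rewrite IH IH'.
- split=> [[v]|[v]].
    by rewrite IH updg => hv; exists (g v).
  by rewrite -[v]hK -updg -IH => hv; exists (h v).
- split=> hv v; first by rewrite -[v]hK -updg -IH.
  by rewrite IH updg.
- split=> -[f injf hf].
    exists (g \o f) => [|a]; last by rewrite /= -updg -IH.
    by move=> a b /= /(congr1 h); rewrite !gK => /injf.
  exists (h \o f) => [|a]; last by rewrite IH updg /= hK.
  by move=> a b /= /(congr1 g); rewrite !hK => /injf.
Qed.

Lemma models_isomorphic G H phi : isomorphic G H -> models G phi <-> models H phi.
Proof. by case=> g bg ge; rewrite /models (sat_isomorphic _ phi bg ge). Qed.

Definition edge_rel (n : nat) (G : graph) (g : 'I_n -> G) : rel 'I_n :=
  fun a b => `[< edge (g a) (g b) >].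

Lemma edge_relP n (G : graph) (g : 'I_n -> G) a b :
  edge_rel g a b <-> edge (g a) (g b).
Proof. by split=> /asboolP. Qed.

Lemma edge_rel_isomorphic n (G : graph) (g : 'I_n -> G) : bijective g ->
  isomorphic (as_graph (edge_rel g)) G.
Proof. by move=> bg; exists g => // a b; apply: edge_relP. Qed.

Lemma chordal_isomorphic G H : isomorphic G H -> chordal H -> chordal G.
Proof.
case=> g /bij_inj injg ge chH m c m4 [injc cyc].
have [|i [j [h1 h2 h3 h4]]] := chH m (g \o c) m4.
  by split=> [|i]; [apply: inj_comp | apply/ge/cyc].
by exists i, j; split=> //; apply/ge.
Qed.

Lemma claw_free_isomorphic G H : isomorphic G H -> claw_free H -> claw_free G.
Proof.
case=> g [h gK hK] ge cf A iso; apply: (cf (fun y => A (h y))).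
apply: isomorphic_trans iso.
pose f (u : induced (fun y => A (h y))) : induced A := exist _ (h (proj1_sig u)) (proj2_sig u).
have fg (v : {x | A x}) : A (h (g (proj1_sig v))) by rewrite gK; apply: proj2_sig.
exists f.
  exists (fun v => exist _ (g (proj1_sig v)) (fg v)) => -[v Av]; apply: eq_exist => /=.
    exact: hK.
  exact: gK.
by move=> u v /=; rewrite ge !hK.
Qed.

Definition order_formula (n : nat) : formula :=
  FAnd (FExGe n 0 (FEq 0 0)) (FNot (FExGe n.+1 0 (FEq 0 0))).

Lemma models_at_least (G : graph) n :
  models G (FExGe n 0 (FEq 0 0)) <-> exists g : 'I_n -> G, injective g.
Proof.
by split=> [[g injg _]|[g injg]]; exists g => // a; exists (g a), (g a).
Qed.

Lemma order_formulaP (G : graph) n : models G (order_formula n) <-> has_order G n.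
Proof.
have -> : models G (order_formula n) <->
    (exists g : 'I_n -> G, injective g) /\ ~ (exists g : 'I_n.+1 -> G, injective g).
  by rewrite -!models_at_least.
split=> [[[g injg] no]|[g [h gK hK]]].
  have surj v : exists i, g i = v.
    apply: contra_notP no => nov.
    exists (fun i => if unlift ord_max i is Some j then g j else v) => i j.
    case: unliftP => [i' ->|->]; case: unliftP => [j' ->|->] //.
    - by move/injg->.
    - by move=> e; case: nov; exists i'.
    - by move=> e; case: nov; exists j'.
  have [h hK] := choice surj; exists g, h => // i.
  by apply: injg; rewrite hK.
split; first by exists g; apply: can_inj gK.
case=> f injf; have := leq_card (h \o f) (inj_comp (can_inj hK) injf).
by rewrite !card_ord ltnn.
Qed.

(** Here the components are the parts. One round pebbles a simplicial vertex in the component of [v]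
    as root, [solved_all] makes this component isomorphic to that of [f v], and [glue_parts] with
    trivial colors matches the components. *)
Lemma global_isomorphism (n l : nat) (E E' : rel 'I_n) (f : 'I_n -> 'I_n) :
  symmetric E -> irreflexive E -> edge_filled E -> clawless E -> n < 2 ^ l ->
  injective f -> (forall v, sim E E' 8 (11 + 6 * l + (l + l)) [:: v] [:: f v]) ->
  isomorphic (as_graph E) (as_graph E').
Proof.
move=> symE irrE fillE clawE nl injf simf.
have card_l : #|'I_n| <= 2 ^ l by rewrite card_ord ltnW.
pose L := l + l.
have rootP v : exists r r', [/\ connect E v r, rooted E r, rooted E' r'
    & sim E E' 8 (10 + 6 * l + L) [:: r; v] [:: r'; f v]].
  have Wv : v \in [set y | connect E v y] by rewrite inE connect0.
  have [r + sr] := simplicial_in symE irrE fillE Wv; rewrite inE => vr.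
  have [f1 _ /(_ r) h1] := @sim_extend _ E E' 8 (10 + 6 * l + L) _ _ (simf v) isT.
  have R : rooted E r.
    split=> // x y rx ry; apply: sr => //; rewrite inE (connect_trans vr) //;
      exact: connect1.
  exists r, (f1 r); split=> //.
  have hr : sim E E' 8 (10 + 6 * l + L) [:: r] [:: f1 r] by apply: (sim_sub r [:: 0] h1).
  by apply: (sim_rooted card_l (n := 6 * l) R); apply: sim_leq hr; rewrite leq_add2r addnC leq_add2r.
have finv v : f (invF injf v) = v by rewrite f_invF.
have symE' : symmetric E'.
  by move=> x; have [r [r' [_ _ R' _]]] := rootP x; apply: (rooted_sym R').
pose P x := [set y | connect E x y]; pose P' x := [set y | connect E' x y].
have cls (e : rel 'I_n) : symmetric e -> {in [set: 'I_n], forall x y,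
    y \in [set y | connect e x y] -> [set z | connect e y z] = [set y | connect e x y]}.
  move=> sym x _ y; rewrite inE => xy; apply/setP => z; rewrite !inE.
  by apply/esym/(same_connect (sym_connect_sym sym)).
have iso v : piso E E' (fun=> tt) (fun=> tt) (P v) (P' (f v)).
  have [r [r' [vr R R' h]]] := rootP v.
  have PE : P v = bush E r r.
    apply/setP => x; rewrite (bush_root R) inE.
    exact: (same_connect (sym_connect_sym symE) vr).
  have vr' : connect E' (f v) r'.
    rewrite -(@sim_reach _ E E' l card_l (10 + 6 * l) v r) //.
    by apply: (sim_sub r [:: 1; 0] h).
  have PE' : P' (f v) = bush E' r' r'.
    apply/setP => x; rewrite (bush_root R') inE.
    exact: (same_connect (sym_connect_sym symE') vr').
  have hs : sim E E' 8 (10 + 6 * l + L) [:: r; r; r] [:: r'; r'; r'].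
    by apply: (sim_sub r [:: 0; 0; 0] h).
  have small : #|region E r r None| < 2 ^ l.
    by apply: leq_ltn_trans nl; rewrite -[X in _ <= X]card_ord max_card.
  have [p [m i k e c]] :=
    (solved_all card_l R R' l).1 r None r' None erefl erefl hs isT small.
  move: m i k e; rewrite /region !setD0 -PE -PE' => m i k e.
  by exists p; split.
have refl (e : rel 'I_n) : {in [set: 'I_n], forall x, x \in [set y | connect e x y]}.
  by move=> x _; rewrite inE connect0.
have sub (e : rel 'I_n) :
    {in [set: 'I_n], forall x, [set y | connect e x y] \subset [set: 'I_n]}.
  by move=> x _; apply: subsetT.
have [||||phi [_ inj _ ed pp]] := @glue_parts 'I_n E E' unit (fun=> tt) (fun=> tt) P P'
    [set: 'I_n] [set: 'I_n] f (refl E) (sub E) (cls E symE) (refl E') (sub E') (cls E' symE').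
- by move=> x _; rewrite inE.
- by move=> x y _ _; apply: injf.
- by [].
- by move=> x _; apply: iso.
have injphi : injective phi by move=> x y; apply: inj; rewrite inE.
exists phi; first exact: injF_bij.
move=> x y; have [xy|nxy] := boolP (y \in P x); first by rewrite /= (ed x) // inE.
have nxy' : phi y \notin P' (phi x) by rewrite -pp // inE.
rewrite inE in nxy; rewrite inE in nxy'.
by split=> /= h; [case/negP: nxy | case/negP: nxy']; apply: connect1.
Qed.

(** With [l] one more than the logarithm, the game takes [11 + 8 * l] rounds and its start from
    sentences 8 quantifiers; 40 leaves some room. *)
Definition log_depth (n : nat) : nat := 8 * trunc_log 2 n + 40.

(** If no sentence separates the two graphs, then they agree on all sentences of this depth, which
    are closed under negation, and the game yields an isomorphism. *)
Lemma distinguishing_sentence n (E E' : rel 'I_n) :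
  symmetric E -> irreflexive E -> edge_filled E -> clawless E ->
  exists psi, [/\ sentence psi, in_C 8 psi, qdepth psi <= log_depth n,
    models (as_graph E) psi
    & models (as_graph E') psi -> isomorphic (as_graph E') (as_graph E)].
Proof.
move=> symE irrE fillE clawE.
have [iso|niso] := pselect (isomorphic (as_graph E') (as_graph E)).
  (* At least 0 values: true in every structure, also in the empty one. *)
  exists (FExGe 0 0 (FEq 0 0)); split=> //; first by rewrite /log_depth addnC.
  by rewrite models_at_least; exists (fun i : 'I_0 => match notF (ltn_ord i) with end); case.
apply: contra_notP niso => nopsi.
have agree psi : sentence psi -> in_C 8 psi -> qdepth psi <= log_depth n ->
    models (as_graph E) psi -> models (as_graph E') psi.
  move=> sp kp dp Ep; apply: contra_notP nopsi => NE'p.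
  by exists psi; split.
pose l := (trunc_log 2 n).+1.
have [||f injf fP] := @eqv_sentences 'I_n E E' 8 (11 + 6 * l + (l + l)) => //.
  move=> psi sp kp dp.
  have dp' : qdepth psi <= log_depth n.
    by apply: leq_trans dp _; rewrite /log_depth /l; clear; lia.
  split; first exact: agree.
  by apply: contraPP => NEp; apply: (agree (FNot psi)).
apply: isomorphic_sym; apply: (global_isomorphism (l := l) (f := f)) => //.
  by rewrite /l trunc_log_ltn.
by move=> v; exists (fun=> v), (fun=> f v), [:: 0].
Qed.

(** [H] is an arbitrary structure; the order formula reduces it to one of finitely many relations on
    ['I_n]. A conjunction of one distinguishing sentence for each relation increases neither the
    depth nor the number of variables. *)
Lemma defining_sentence n (G : graph) :
  undirected G -> chordal G -> claw_free G -> has_order G n ->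
  exists phi : formula, [/\ sentence phi, in_C 8 phi, qdepth phi <= log_depth n
    & forall H : graph, models H phi <-> isomorphic H G].
Proof.
move=> [symG irrG] chG cfG ord_n; have [g bg] := ord_n.
pose E := edge_rel g; have isoE : isomorphic (as_graph E) G := edge_rel_isomorphic bg.
have symE : symmetric E by move=> a b; apply/idP/idP => /edge_relP/symG/edge_relP.
have irrE : irreflexive E by move=> a; apply/negbTE/negP => /edge_relP/irrG.
have fillE := chordal_edge_filled symE irrE (chordal_isomorphic isoE chG).
have clawE := claw_free_clawless symE irrE (claw_free_isomorphic isoE cfG).
pose rel_of (F : {ffun 'I_n * 'I_n -> bool}) : rel 'I_n := fun a b => F (a, b).
have [psi psiP] := choice (fun F => distinguishing_sentence (rel_of F) symE irrE fillE clawE).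
pose Psi := foldr (fun F chi => FAnd (psi F) chi) (order_formula n)
  (enum {: {ffun 'I_n * 'I_n -> bool}}).
have PsiP (H : graph) : models H Psi <-> models H (order_formula n) /\ forall F, models H (psi F).
  have : models H Psi <-> models H (order_formula n) /\
      forall F, F \in enum {: {ffun 'I_n * 'I_n -> bool}} -> models H (psi F).
    rewrite /Psi; elim: (enum _) => [|F s IH] /=; first by split=> [|[]].
    split=> [[h1 /IH [h2 h3]]|[h1 h2]].
      by split=> // F'; rewrite inE => /orP [/eqP ->|/h3].
    split; first by apply: h2; rewrite inE eqxx.
    by apply/IH; split=> // F' sF'; apply: h2; rewrite inE sF' orbT.
  case=> h1 h2; split=> [/h1 [h3 h4]|[h3 h4]]; last by apply: h2; split.
  by split=> // F; apply: h4; rewrite mem_enum.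
have [s1 s2 s3] : [/\ sentence Psi, in_C 8 Psi & qdepth Psi <= log_depth n].
  rewrite /Psi; elim: (enum _) => [|F s [IH1 IH2 IH3]] /=; first by rewrite /log_depth addnC.
  have [h1 h2 h3 _ _] := psiP F; split; first by rewrite /sentence /= h1 IH1.
    by rewrite h2 IH2.
  by rewrite geq_max h3 IH3.
exists Psi; split=> // H; split=> [/PsiP [/order_formulaP [h bh] hpsi]|isoH].
  pose F : {ffun 'I_n * 'I_n -> bool} := [ffun p => edge_rel h p.1 p.2].
  have isoF : isomorphic (as_graph (rel_of F)) H.
    exists h => // a b; rewrite /= /rel_of ffunE /=; exact: edge_relP.
  have [_ _ _ _ sep] := psiP F.
  apply: (isomorphic_trans (isomorphic_sym isoF)); apply: isomorphic_trans isoE.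
  by apply: sep; rewrite (models_isomorphic _ isoF).
apply/(models_isomorphic _ isoH)/PsiP; split; first exact/order_formulaP.
by move=> F; rewrite -(models_isomorphic _ isoE); have [] := psiP F.
Qed.

(** * Growth of the depth bound *)

Import Order.TTheory GRing.Theory Num.Theory.
Import numFieldNormedType.Exports.
Local Open Scope classical_set_scope.
Local Open Scope ring_scope.

Lemma log_depth_bigO :
  (fun n : nat => (log_depth n)%:R : Rdefinitions.R^o) =O_\oo
  (fun n : nat => ln (n%:R : Rdefinitions.R) : Rdefinitions.R^o).
Proof.
set R := Rdefinitions.R.
have ln2_gt0 : 0 < ln (2 : R) by apply: ln_gt0; rewrite ltr1n.
(* 48 is 8 + 40: from [n = 2] on the binary logarithm is at least 1 and absorbs the constant term;
   [ln 2] changes the base. *)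
apply/eqO_exP; exists (48 / ln 2); first by rewrite divr_gt0.
near=> n; have n2 : (1 < n)%N by near: n; exists 2%N.
have n0 : (0 < n)%N by apply: ltnW.
have ln_n0 : 0 <= ln (n%:R : R) by apply: ln_ge0; rewrite ler1n.
rewrite !ger0_norm // mulrAC ler_pdivlMr //.
have tl1 : (0 < trunc_log 2 n)%N by rewrite trunc_log_gt0.
have le48 : (log_depth n)%:R <= 48 * (trunc_log 2 n)%:R :> R.
  rewrite -natrM ler_nat /log_depth [(48 * _)%N](mulnDl 8 40) leq_add2l.
  by rewrite -[X in (X <= _)%N]muln1 leq_mul2l.
apply: (@le_trans _ _ (48 * (trunc_log 2 n)%:R * ln 2)); first by rewrite ler_pM2r.
rewrite -mulrA ler_pM2l // mulr_natl -lnXn // ler_ln ?posrE ?exprn_gt0 ?ltr0n //.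
by rewrite -natrX ler_nat trunc_logP.
Unshelve. all: by end_near.
Qed.

Theorem theorem3 :
  exists (k : nat) (f : nat -> nat),
    (fun n : nat => (f n)%:R : Rdefinitions.R^o) =O_\oo
      (fun n : nat => ln (n%:R : Rdefinitions.R) : Rdefinitions.R^o) /\
    forall (n : nat) (G : graph),
      undirected G -> chordal G -> claw_free G -> has_order G n ->
      exists phi : formula,
        [/\ sentence phi, in_C k phi, (qdepth phi <= f n)%N
          & forall H : graph, models H phi <-> isomorphic H G].
Proof.
by exists 8%N, log_depth; split; [exact: log_depth_bigO | exact: defining_sentence].
Qed.
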